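(* Consider the closed-loop system consisting of the plant $$\dot{x}_1=f_1(x)+g_1(x)u,\qquad \dot{x}_2=f_2(x,\theta)+g_2(x)u,$$ whose goal function $\psi$ satisfies along solutions the error equation $$\dot\psi=f(x,\theta,t)-f(x,\hat\theta,t)-\varphi(\psi,\omega,t)+\varepsilon(t),\qquad \varepsilon\in L_2^1[t_0,\infty]\cap\mathcal{C}^0,\tag{E}$$ together with the adaptation algorithm $$\hat\theta(x,t)=\Gamma(\hat\theta_P(x,t)+\hat\theta_I(t)),\quad \hat\theta_P(x,t)=\psi(x,t)\alpha(x,t)-\Psi(x,t),\quad \dot{\hat\theta}_I=\varphi(\psi(x,t),\omega,t)\alpha(x,t)+\mathcal{R}(x,\hat\theta,u(x,\hat\theta,t),t),$$ where $\Gamma\in\mathbb{R}^{d\times d}$, $\Gamma>0$ (symmetric positive definite), and $$\mathcal{R}=\frac{\partial\Psi}{\partial t}-\psi\Big(\frac{\partial\alpha}{\partial t}+L_{f_1}\alpha\Big)+L_{f_1}\Psi-\big(\psi L_{g_1}\alpha-L_{g_1}\Psi\big)u(x,\hat\theta,t),$$ with all functions as described in the context. Suppose that: (i) (Monotonicity and growth) $\alpha:\mathbb{R}^n\times\mathbb{R}_+\to\mathbb{R}^d$ is $\mathcal{C}^1$ and there is a constant $D>0$ such that for all $x,t,\theta,\hat\theta$ $$(f(x,\hat\theta,t)-f(x,\theta,t))\,(\alpha(x,t)^T(\hat\theta-\theta))\ge 0,\qquad |f(x,\hat\theta,t)-f(x,\theta,t)|\le D\,|\alpha(x,t)^T(\hat\theta-\theta)|;$$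 (ii) there is a constant $D_1>0$ such that for all $x,t,\theta,\hat\theta$: $|f(x,\hat\theta,t)-f(x,\theta,t)|\ge D_1|\alpha(x,t)^T(\hat\theta-\theta)|$; (iii) $\Psi:\mathbb{R}^n\times\mathbb{R}_+\to\mathbb{R}^d$ is $\mathcal{C}^1$ and $\dfrac{\partial\Psi(x,t)}{\partial x_2}-\psi(x,t)\dfrac{\partial\alpha(x,t)}{\partial x_2}=0$. Then the following hold. P1) For given initial conditions $x(t_0)$, $\hat\theta_I(t_0)$ and parameter vector $\theta$, let $[t_0,T^*]$ be the (maximal) time interval of existence of the solution of the closed-loop system. Then $$\|f(x(t),\theta,t)-f(x(t),\hat\theta(t),t)\|_{2,[t_0,T^*]}\le D_f(\theta,t_0,\Gamma,\|\varepsilon(t)\|_{2,[t_0,T^*]}),$$ $$D_f(\theta,t_0,\Gamma,\|\varepsilon(t)\|_{2,[t_0,T^*]})=\Big(\tfrac{D}{2}\|\theta-\hat\theta(t_0)\|^2_{\Gamma^{-1}}\Big)^{0.5}+\tfrac{D}{D_1}\|\varepsilon(t)\|_{2,[t_0,T^*]},$$ and for $t\in[t_0,T^*]$ $$\|\theta-\hat\theta(t)\|^2_{\Gamma^{-1}}\le\|\hat\theta(t_0)-\theta\|^2_{\Gamma^{-1}}+\tfrac{D}{2D_1^2}\|\varepsilon(t)\|^2_{2,[t_0,T^*]}.$$ In addition, suppose that the following two assumptions hold: (iv) (Target operator) $\|x(t)\|_{\infty,[t_0,T]}\le\tilde\gamma\big(x_0,\theta,\|\psi(x(t),t)\|_{\infty,[t_0,T]}\big)$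 along solutions of the plant, where $\tilde\gamma$ is a non-negative, locally bounded function of its arguments; (v) (Target dynamics operator) for every $\omega\in\Omega_\omega$ the scalar system $\dot\psi=-\varphi(\psi,\omega,t)+\zeta(t)$ has $L_2^1[t_0,\infty]\mapsto L_\infty^1[t_0,\infty]$ gain with respect to the input $\zeta$, i.e. there is a function $\gamma_{\infty,2}$ such that $\|\psi(t)\|_{\infty,[t_0,T]}\le\gamma_{\infty,2}(\psi_0,\omega,\|\zeta(t)\|_{2,[t_0,T]})$ for all $\zeta\in L_2^1[t_0,T]$. Then: P2) $\psi(x(t),t)\in L_\infty^1[t_0,\infty]$, $x(t)\in L_\infty^n[t_0,\infty]$ and $$\|\psi(x(t),t)\|_{\infty,[t_0,\infty]}\le\gamma_{\infty,2}(\psi(x_0,t_0),\omega,\mathcal{D}),\qquad \mathcal{D}=D_f(\theta,t_0,\Gamma,\|\varepsilon(t)\|_{2,[t_0,\infty]})+\|\varepsilon(t)\|_{2,[t_0,\infty]}.$$ P3) If $f(x,\theta,t)$ is locally bounded with respect to $x,\theta$ uniformly in $t$, $\varphi(\psi,\omega,t)$ is locally bounded in $\psi,\omega$ uniformly in $t$, and the system $\dot\psi=-\varphi(\psi,\omega,t)+\zeta(t)$ has $L_2^1[t_0,\infty]\mapsto L_p^1[t_0,\infty]$ gain for some $p>1$ with respect to input $\zeta$ and output $\psi$, then $$\varepsilon(t)\in L_2^1[t_0,\infty]\cap L_\infty^1[t_0,\infty]\ \Rightarrow\ \lim_{t\to\infty}\psi(x(t),t)=0.$$ P4) If, in addition to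 the conditions of P3 (including $\varepsilon\in L_2^1[t_0,\infty]\cap L_\infty^1[t_0,\infty]$), $f(x,\theta,t)\in\mathcal{C}^1$ and $\partial f(x,\theta,t)/\partial t$ is locally bounded with respect to $x,\theta$ uniformly in $t$, and the functions $\alpha(x,t)$ and $\partial\psi(x,t)/\partial t$ are locally bounded with respect to $x$ uniformly in $t$, then $$\lim_{t\to\infty}\big(f(x(t),\theta,t)-f(x(t),\hat\theta(t),t)\big)=0.$$
   Context: State and plant: $x=x_1\oplus x_2\in\mathbb{R}^n$ (concatenation), $x_1\in\mathbb{R}^q$, $x_2\in\mathbb{R}^p$, $q+p=n$; $\theta\in\Omega_\theta\subset\mathbb{R}^d$ is a vector of unknown parameters with $\Omega_\theta$ closed and bounded; $u\in\mathbb{R}$ is the control input. The functions $f_1:\mathbb{R}^n\to\mathbb{R}^q$, $f_2:\mathbb{R}^n\times\mathbb{R}^d\to\mathbb{R}^p$, $g_1:\mathbb{R}^n\to\mathbb{R}^q$, $g_2:\mathbb{R}^n\to\mathbb{R}^p$ are continuous and locally bounded. Write $\mathbf{f}(x,\theta)=f_1(x)\oplus f_2(x,\theta)$ and $\mathbf{g}(x)=g_1(x)\oplus g_2(x)$. $\mathbb{R}_+=[0,\infty)$. Goal function: $\psi:\mathbb{R}^n\times\mathbb{R}_+\to\mathbb{R}$, $\psi\in\mathcal{C}^1$. The scalar function $f$ is $f(x,\theta,t)=L_{\mathbf{f}(x,\theta)}\psi(x,t)$. It is assumed that $(L_{\mathbf{g}(x)}\psi(x,t))^{-1}$ exists everywhere.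 The function $\varphi:\mathbb{R}\times\mathbb{R}^w\times\mathbb{R}_+\to\mathbb{R}$ is chosen by the designer and $\omega\in\Omega_\omega\subset\mathbb{R}^w$ is a vector of known parameters. The feedback $$u(x,\hat\theta,\omega,t)=\frac{1}{L_{\mathbf{g}(x)}\psi(x,t)}\Big(-L_{\mathbf{f}(x,\hat\theta)}\psi(x,t)-\varphi(\psi,\omega,t)-\frac{\partial\psi(x,t)}{\partial t}\Big)$$ gives the error equation (E) with $\varepsilon\equiv0$; equation (E) is its extended version, in which the function $\varepsilon:\mathbb{R}_+\to\mathbb{R}$, $\varepsilon\in L_2^1[t_0,\infty]\cap\mathcal{C}^0$, accounts for additional signals such as couplings with other systems. The symbol $u(x,\hat\theta,t)$ in $\mathcal{R}$ is the control input applied to the plant. Lie derivatives: for a partition component $x_i$ ($i=1,2$) and a vector field $f_i$ with values in the space of $x_i$, $L_{f_i}\psi(x,t)=\sum_j\frac{\partial\psi(x,t)}{\partial x_{ij}}f_{ij}$; for vector-valued functions such as $\alpha,\Psi$ this is applied componentwise, e.g. $L_{f_1}\alpha=\frac{\partial\alpha}{\partial x_1}f_1$. $L_{\mathbf{f}}$, $L_{\mathbf{g}}$ are the usual Lie derivatives in $x$. Norms: $\|\cdot\|$ is the Euclidean norm, $\|x\|_\Gamma^2=x^T\Gamma x$. For $p\ge1$, $\|h\|_{p,[t_0,T]}=\big(\int_{t_0}^T\|h(\tau)\|^pd\tau\big)^{1/p}$ and $\|h\|_{\infty,[t_0,T]}=\mathrm{ess\,sup}\{\|h(t)\|:t\in[t_0,T]\}$;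 $L_p^n[t_0,T]$, $L_\infty^n[t_0,T]$ are the spaces of $\mathbb{R}^n$-valued functions for which these are finite. $\hat\theta(t)$ abbreviates $\hat\theta(x(t),t)$, and $x_0=x(t_0)$. Gains: a forward-complete system with state $z$, initial value $z_0$, parameters $\theta$ and input $v$ has an $L_p^m[t_0,T]\mapsto L_q^n[t_0,T]$ gain ($p,q\in[1,\infty]$) with respect to $v$ if $z(t)\in L_q^n[t_0,T]$ for every $v\in L_p^m[t_0,T]$ and there is a function $\gamma_{q,p}$ with values in $\mathbb{R}_+$, non-decreasing in its last argument and locally bounded in its arguments, such that $\|z(t)\|_{q,[t_0,T]}\le\gamma_{q,p}(z_0,\theta,\|v(t)\|_{p,[t_0,T]})$. Local boundedness: a function is locally bounded if it is bounded on every ball $\|x\|<\delta$ by a constant depending only on $\delta$; ''uniformly in $t$'' means the constant does not depend on $t$. In hypotheses (i), (ii), $x\in\mathbb{R}^n$, $t\in\mathbb{R}_+$, $\theta\in\Omega_\theta$, $\hat\theta\in\mathbb{R}^d$. The same function $\alpha$ is used in (i), (ii), (iii) and in the adaptation algorithm.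
   Formalization: P2–P4 additionally assume that φ(ψ,ω,t) is continuous in (ψ,t); P4 additionally assumes that ∂f(x,θ,t)/∂x is locally bounded in x,θ uniformly in t and that (L_g ψ(x,t))^{-1} is locally bounded in x uniformly in t; without these the claims fail. *)

(* Defs.v *)
(* MathComp-Analysis; vectors of R^n are column vectors 'cV[R]_n, and x1 (+) x2
   is col_mx x1 x2. *)
From HB Require Import structures.
From mathcomp Require Import all_boot all_order all_algebra.
From mathcomp Require Import all_classical all_reals all_analysis.
Set Implicit Arguments.
Unset Strict Implicit.
Unset Printing Implicit Defensive.
Import Order.TTheory GRing.Theory Num.Theory.
Import numFieldNormedType.Exports.

Local Open Scope classical_set_scope.
Local Open Scope ring_scope.

(* The library's norm on 'cV[R]_n is the max norm; enorm is the
   Euclidean one. *)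
Definition enorm {R : realType} {n : nat} (v : 'cV[R]_n) : R :=
  Num.sqrt (\sum_(i < n) v i 0 ^+ 2).

Definition wnorm2 {R : realType} {n : nat} (G : 'M[R]_n) (v : 'cV[R]_n) : R :=
  (v^T *m G *m v) 0 0.

Definition posdef {R : realType} {n : nat} (G : 'M[R]_n) : Prop :=
  G^T = G /\ forall v : 'cV[R]_n, v != 0 -> 0 < (v^T *m G *m v) 0 0.

Section intervals_and_norms.
Context {R : realType}.

Definition Rplus : set R := [set t | 0 <= t].

(* [t0, T] if T is real, [t0, oo[ if T = +oo *)
Definition cint (t0 : R) (T : \bar R) : set R := [set t | t0 <= t /\ (t%:E <= T)%E].

(* [t0, T[, with T real or +oo *)
Definition roint (t0 : R) (T : \bar R) : set R := [set t | t0 <= t /\ (t%:E < T)%E].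

(* Extending h by 0 outside J turns the library's norm over the whole line into
   the norm over J, for finite r and for r = +oo alike. *)
Definition LpN (r : \bar R) (J : set R) (h : R -> R) : \bar R :=
  ('N[lebesgue_measure]_r [(EFin \o h) \_ J])%E.

Definition inLp (r : \bar R) (J : set R) (h : R -> R) : Prop :=
  measurable_fun J h /\ (LpN r J h < +oo)%E.

Definition inLpv {n : nat} (r : \bar R) (J : set R) (h : R -> 'cV[R]_n) : Prop :=
  (forall i, measurable_fun J (fun t => h t i 0)) /\
  (LpN r J (enorm \o h) < +oo)%E.

(* Derivative of y at t relative to J: one-sided at an end point of J. *)
Definition has_deriv {V : normedModType R} (J : set R) (y : R -> V) (t : R)
    (v : V) : Prop :=
  (s - t)^-1 *: (y s - y t) @[s --> within J t^'] --> v.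

End intervals_and_norms.

Section local_boundedness.
Context {R : realType} {X Y : normedModType R}.

(* The library's norms are used for the balls and for the values: on the finite
   products of R and 'cV[R]_n considered here they are equivalent to the
   Euclidean norms, which does not affect local boundedness. *)
Definition locally_bounded_on (A : set X) (h : X -> Y) : Prop :=
  forall delta : R, exists M : R, forall z, A z -> `|z| < delta -> `|h z| <= M.

Definition locally_bounded (h : X -> Y) : Prop := locally_bounded_on setT h.

Definition unif_locally_bounded (h : X -> R -> Y) : Prop :=
  forall delta : R, exists M : R, forall z t, 0 <= t ->
    `|z| < delta -> `|h z t| <= M.

End local_boundedness.

(* Functions on R^n x R_+ are represented by h : 'cV[R]_n -> R -> W; their
   values at negative times are never constrained nor used. *)
Section derivatives.
Context {R : realType} {W : normedModType R}.

Definition dt {X : Type} (h : X -> R -> W) (x : X) (t : R) : W :=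
  lim ((s - t)^-1 *: (h x s - h x t) @[s --> within Rplus t^']).

Definition dx {n : nat} (h : 'cV[R]_n -> R -> W) (j : 'I_n) (x : 'cV[R]_n)
    (t : R) : W :=
  'D_(delta_mx j 0) (fun y => h y t) x.

Definition C1 {n : nat} (h : 'cV[R]_n -> R -> W) : Prop :=
  [/\ forall j x t, 0 <= t ->
        derivable (fun y => h y t) x (delta_mx j 0),
      forall x t, 0 <= t -> has_deriv Rplus (h x) t (dt h x t),
      forall j, {within [set z : 'cV[R]_n * R | 0 <= z.2],
                   continuous (fun z => dx h j z.1 z.2)}
    & {within [set z : 'cV[R]_n * R | 0 <= z.2],
         continuous (fun z => dt h z.1 z.2)}].

(* Lie derivatives: v is the value at x of the vector field. *)
Definition lie {n : nat} (v : 'cV[R]_n) (h : 'cV[R]_n -> R -> W)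
    (x : 'cV[R]_n) (t : R) : W :=
  \sum_(j < n) v j 0 *: dx h j x t.

(* Lie derivative along a field with values in the space of x1. *)
Definition lie1 {q p : nat} (v : 'cV[R]_q) (h : 'cV[R]_(q + p) -> R -> W)
    (x : 'cV[R]_(q + p)) (t : R) : W :=
  \sum_(j < q) v j 0 *: dx h (lshift p j) x t.

End derivatives.

Record plant (R : realType) (q p d : nat) := Plant {
  f1 : 'cV[R]_(q + p) -> 'cV[R]_q;
  f2 : 'cV[R]_(q + p) -> 'cV[R]_d -> 'cV[R]_p;
  g1 : 'cV[R]_(q + p) -> 'cV[R]_q;
  g2 : 'cV[R]_(q + p) -> 'cV[R]_p }.

Section plants.
Context {R : realType} {q p d : nat}.
Context (P : plant R q p d).

Definition plant_regular : Prop :=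
  [/\ continuous (f1 P) /\ locally_bounded (f1 P),
      continuous (fun z : 'cV[R]_(q + p) * 'cV[R]_d => f2 P z.1 z.2) /\
      locally_bounded (fun z : 'cV[R]_(q + p) * 'cV[R]_d => f2 P z.1 z.2),
      continuous (g1 P) /\ locally_bounded (g1 P)
    & continuous (g2 P) /\ locally_bounded (g2 P)].

Definition vf (x : 'cV[R]_(q + p)) (th : 'cV[R]_d) : 'cV[R]_(q + p) :=
  col_mx (f1 P x) (f2 P x th).

Definition vg (x : 'cV[R]_(q + p)) : 'cV[R]_(q + p) :=
  col_mx (g1 P x) (g2 P x).

(* Classical solution on J; u t is the control input applied at time t. *)
Definition plant_solution (th : 'cV[R]_d) (J : set R)
    (x : R -> 'cV[R]_(q + p)) (u : R -> R) : Prop :=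
  forall t, J t ->
    has_deriv J x t (col_mx (f1 P (x t) + u t *: g1 P (x t))
                            (f2 P (x t) th + u t *: g2 P (x t))).

Context (psi : 'cV[R]_(q + p) -> R -> R).

Definition fpsi (x : 'cV[R]_(q + p)) (th : 'cV[R]_d) (t : R) : R :=
  lie (vf x th) psi x t.

Context {w : nat}.
Context (phi : R -> 'cV[R]_w -> R -> R)
  (alpha Psi : 'cV[R]_(q + p) -> R -> 'cV[R]_d) (Gamma : 'M[R]_d).

Definition thetahat (x : 'cV[R]_(q + p)) (thI : 'cV[R]_d) (t : R) : 'cV[R]_d :=
  Gamma *m ((psi x t *: alpha x t - Psi x t) + thI).

Definition Rterm (x : 'cV[R]_(q + p)) (u t : R) : 'cV[R]_d :=
  dt Psi x t - psi x t *: (dt alpha x t + lie1 (f1 P x) alpha x t)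
  + lie1 (f1 P x) Psi x t
  - u *: (psi x t *: lie1 (g1 P x) alpha x t - lie1 (g1 P x) Psi x t).

(* Classical solutions on J. Since L_g psi <> 0, the first two equations
   determine the applied control:
     u = (- L_f(x,thetahat) psi - phi - d psi / d t + eps) / L_g psi. *)
Definition closed_loop (om : 'cV[R]_w) (eps : R -> R) (th : 'cV[R]_d)
    (J : set R) (x : R -> 'cV[R]_(q + p)) (thI : R -> 'cV[R]_d) (u : R -> R)
  : Prop :=
  [/\ plant_solution th J x u,
      forall t, J t ->
        has_deriv J (fun s => psi (x s) s) t
          (fpsi (x t) th t - fpsi (x t) (thetahat (x t) (thI t) t) t
           - phi (psi (x t) t) om t + eps t)
    & forall t, J t ->
        has_deriv J thI t
          (phi (psi (x t) t) om t *: alpha (x t) t + Rterm (x t) (u t) t)].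

Definition maximal_closed_loop (om : 'cV[R]_w) (eps : R -> R) (th : 'cV[R]_d)
    (t0 : R) (T : \bar R) (x : R -> 'cV[R]_(q + p)) (thI : R -> 'cV[R]_d)
    (u : R -> R) : Prop :=
  [/\ (t0%:E < T)%E,
      closed_loop om eps th (roint t0 T) x thI u
    & ~ exists T' x' thI' u',
        [/\ (T < T')%E,
            closed_loop om eps th (roint t0 T') x' thI' u'
          & forall t, roint t0 T t -> x' t = x t /\ thI' t = thI t]].

End plants.

Section target_dynamics.
Context {R : realType} {w : nat}.
Context (phi : R -> 'cV[R]_w -> R -> R).

(* Solution on [t0, T] of y' = - phi(y, om, t) + zeta(t) in the sense of
   Caratheodory, the input zeta being only an L_p function. *)
Definition target_solution (om : 'cV[R]_w) (zeta : R -> R) (t0 : R)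
    (T : \bar R) (y : R -> R) : Prop :=
  forall t, cint t0 T t ->
    lebesgue_measure.-integrable `[t0, t]
      (EFin \o (fun s => - phi (y s) om s + zeta s)) /\
    y t = y t0 +
      \int[lebesgue_measure]_(s in `[t0, t]) (- phi (y s) om s + zeta s).

(* Gain from L_r inputs zeta to the L_r' output y, for all om in Omw at once; the
   fourth clause is forward completeness. [fine] is applied to the norm of an
   input in L_r, hence to a real number. *)
Definition target_gain (Omw : set 'cV[R]_w) (t0 : R) (r r' : \bar R)
    (gam : R -> 'cV[R]_w -> R -> R) : Prop :=
  [/\ forall y0 om s, 0 <= s -> 0 <= gam y0 om s,
      forall y0 om s s', 0 <= s -> s <= s' -> gam y0 om s <= gam y0 om s',
      locally_bounded_on [set z : R * 'cV[R]_w * R | 0 <= z.2]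
        (fun z => gam z.1.1 z.1.2 z.2),
      forall om zeta y0, Omw om -> inLp r (cint t0 +oo%E) zeta ->
        exists2 y, target_solution om zeta t0 +oo%E y & y t0 = y0
    & forall om (T : \bar R) zeta y, Omw om -> (t0%:E < T)%E ->
        inLp r (cint t0 T) zeta -> target_solution om zeta t0 T y ->
        inLp r' (cint t0 T) y /\
        (LpN r' (cint t0 T) y
           <= (gam (y t0) om (fine (LpN r (cint t0 T) zeta)))%:E)%E].

End target_dynamics.

(* The bound on the 2-norm of f(x,theta,t) - f(x,thetahat,t): e is the initial
   error theta - thetahat(t0), r the 2-norm of eps. *)
Definition Dfbound {R : realType} {d : nat} (D D1 : R) (Gamma : 'M[R]_d)
    (e : 'cV[R]_d) (r : R) : R :=
  Num.sqrt (D / 2 * wnorm2 (invmx Gamma) e) + D / D1 * r.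

(* Main.v *)
(* Along the closed loop, condition (iii) cancels every term of the derivative of
   thetahat that contains the unknown dynamics of x2, so that
   thetahat' = Gamma (F + eps) alpha with F = f(x,theta,t) - f(x,thetahat,t).
   Hence V = |theta - thetahat|^2 in the norm of Gamma^-1 satisfies
   V' = 2 (F + eps) a with a = alpha^T (thetahat - theta); the sign condition and
   the two bounds D1 |a| <= |F| <= D |a| give, for every l > 0,
   V' <= (l / D1 - 2 / D) F^2 + eps^2 / (D1 l). Integration and the choice of l
   yield P1. The target dynamics driven by F + eps in L2 then bound psi, the target
   operator bounds x, and V bounds thetahat; a bounded solution on a finite interval
   can be continued by Peano's theorem, which gives P2. P3 and P4 follow from
   Barbalat-type arguments for psi in L_r and F in L2. *)

Require Import Defs.
From HB Require Import structures.
From mathcomp Require Import all_boot all_order all_algebra.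
From mathcomp Require Import all_classical all_reals all_analysis.
From mathcomp Require Import measurable_realfun ess_sup_inf.
From mathcomp Require Import ring lra.
Import Order.TTheory GRing.Theory Num.Theory.
Import numFieldNormedType.Exports.

Set Implicit Arguments.
Unset Strict Implicit.
Unset Printing Implicit Defensive.

Local Open Scope classical_set_scope.
Local Open Scope ring_scope.

(** * Derivatives relative to a set *)

Section relative_derivative.
Context {R : realType}.

(** The input [u] is an unknown of the closed loop, forced by the error equation. Once it is
    eliminated, the loop is an ordinary differential equation in [(x, thI)] whose field is merely
    continuous. Solutions need not be unique, so a finite maximal time is excluded by gluing a Peano
    solution to the given trajectory, differentiability at the junction included. Nothing is known
    at the right end of the interval of existence. All estimates are therefore made on segments
    [[t0, b]] inside it, uniformly in [b]; they pass to the whole interval by monotone convergence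
    for 2-norms, and by continuity for essential suprema. The two bounds of P1 come from two
    different [l]. One is a constant that cancels the term in [F^2]; the other depends on the
    2-norms of [F] and [eps] themselves and turns the energy estimate into a quadratic inequality
    for the norm of [F]. *)

Lemma has_derivP {V : normedModType R} (J : set R) (y : R -> V) (t : R) (v : V) :
  has_deriv J y t v <->
  forall e, 0 < e -> exists2 dl, 0 < dl & forall s, J s -> `|s - t| < dl ->
    `|y s - y t - (s - t) *: v| <= e * `|s - t|.
Proof.
split=> [H e e0|H].
  move/cvgrPdist_le : H => /(_ e e0); rewrite /within /= /dnbhs /within /=.
  move=> /nbhs_normP[dl /= dl0 H]; exists dl => // s Js sdl.
  have [->|st] := eqVneq s t; first by rewrite !subrr scale0r subr0 !normr0 mulr0.
  have := H s; rewrite /ball_ /= distrC => /(_ sdl st Js) {}H.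
  have st0 : 0 < `|s - t| by rewrite normr_gt0 subr_eq0.
  rewrite -ler_pdivrMr// -normfV mulrC -normrZ scalerBr scalerA mulVf ?subr_eq0//.
  by rewrite scale1r distrC.
apply/cvgrPdist_le => e e0; have [dl dl0 {}H] := H e e0.
rewrite /within /= /dnbhs /within /=; apply/nbhs_normP; exists dl => //= s.
rewrite /ball_ /= distrC => sdl st Js; have {}H := H s Js sdl.
have st0 : 0 < `|s - t| by rewrite normr_gt0 subr_eq0.
move: H; rewrite -ler_pdivrMr// -normfV mulrC -normrZ scalerBr scalerA mulVf
    ?subr_eq0//.
by rewrite scale1r distrC.
Qed.

Lemma has_deriv_sub {V : normedModType R} (J J' : set R) (y : R -> V) t v :
  J' `<=` J -> has_deriv J y t v -> has_deriv J' y t v.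
Proof.
move=> J'J /has_derivP H; apply/has_derivP => e /H[dl dl0 {}H].
by exists dl => // s /J'J; exact: H.
Qed.

Lemma has_deriv_cvg {V : normedModType R} (J : set R) (y : R -> V) t v :
  has_deriv J y t v -> y s @[s --> within J (nbhs t)] --> y t.
Proof.
move=> /has_derivP /(_ 1 ltr01)[dl dl0 H]; apply/cvgrPdist_le => e e0.
rewrite /within /=; apply/nbhs_normP.
have k0 : 0 < 1 + `|v| by rewrite ltr_wpDr.
exists (Num.min dl (e / (1 + `|v|))); first by rewrite /= lt_min dl0 divr_gt0.
move=> s; rewrite /ball_ /= distrC lt_min => /andP[sdl se] Js.
have {}H := H s Js sdl.
rewrite distrC -[y s - y t](subrK ((s - t) *: v)) (le_trans (ler_normD _ _))//.
rewrite (le_trans (lerD H (lexx _)))// normrZ mul1r -{1}(mulr1 `|s - t|) -mulrDr.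
by rewrite -ler_pdivlMr// ltW.
Qed.

Lemma has_deriv_within_continuous {V : normedModType R} (J : set R) (y : R -> V)
    (v : R -> V) :
  (forall t, J t -> has_deriv J y t (v t)) -> {within J, continuous y}.
Proof.
by move=> H; apply/subspace_continuousP => t Jt; exact: has_deriv_cvg (H t Jt).
Qed.

Lemma has_deriv_cst {V : normedModType R} (J : set R) (c : V) t :
  has_deriv J (fun=> c) t 0.
Proof.
apply/has_derivP => e e0; exists 1 => // s _ _.
by rewrite subrr scaler0 subrr normr0 mulr_ge0// ltW.
Qed.

Lemma has_derivD {V : normedModType R} (J : set R) (y z : R -> V) t v w :
  has_deriv J y t v -> has_deriv J z t w ->
  has_deriv J (fun s => y s + z s) t (v + w).
Proof.
move=> Hy Hz; rewrite /has_deriv.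
rewrite [X in X @ _ --> _](_ : _ = (fun s => (s - t)^-1 *: (y s - y t)
  + (s - t)^-1 *: (z s - z t))); last first.
  by apply/funext => s; rewrite -scalerDr opprD addrACA.
exact: cvgD.
Qed.

Lemma has_derivZ {V : normedModType R} (J : set R) (y : R -> V) t v (k : R) :
  has_deriv J y t v -> has_deriv J (fun s => k *: y s) t (k *: v).
Proof.
move=> Hy; rewrite /has_deriv.
rewrite [X in X @ _ --> _](_ : _ = (fun s => k *: ((s - t)^-1 *: (y s - y t)))).
  exact: cvgZr.
by apply/funext => s; rewrite -scalerBr !scalerA mulrC.
Qed.

Lemma has_derivN {V : normedModType R} (J : set R) (y : R -> V) t v :
  has_deriv J y t v -> has_deriv J (fun s => - y s) t (- v).
Proof.
move=> /(has_derivZ (k := -1)); rewrite scaleN1r; congr has_deriv.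
by apply/funext => s; rewrite scaleN1r.
Qed.

Lemma has_derivB {V : normedModType R} (J : set R) (y z : R -> V) t v w :
  has_deriv J y t v -> has_deriv J z t w ->
  has_deriv J (fun s => y s - z s) t (v - w).
Proof. by move=> Hy Hz; apply: has_derivD => //; exact: has_derivN. Qed.

Lemma has_deriv_sum {V : normedModType R} (J : set R) n (y : 'I_n -> R -> V) t
    (v : 'I_n -> V) :
  (forall i, has_deriv J (y i) t (v i)) ->
  has_deriv J (fun s => \sum_(i < n) y i s) t (\sum_(i < n) v i).
Proof.
elim: n y v => [|n IH] y v H.
  rewrite big_ord0 [X in has_deriv J X](_ : _ = fun=> 0); first exact: has_deriv_cst.
  by apply/funext => s; rewrite big_ord0.
rewrite big_ord_recl [X in has_deriv J X](_ : _ = fun s => y ord0 s +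
  \sum_(i < n) y (lift ord0 i) s); last by apply/funext => s; rewrite big_ord_recl.
by apply: has_derivD; [exact: H|apply: IH => i; exact: H].
Qed.

Lemma has_derivM (J : set R) (y z : R -> R) t (v w : R) :
  has_deriv J y t v -> has_deriv J z t w ->
  has_deriv J (fun s => y s * z s) t (v * z t + y t * w).
Proof.
move=> Hy Hz; rewrite /has_deriv.
rewrite [X in X @ _ --> _](_ : _ = (fun s => (s - t)^-1 *: (y s - y t) * z s
   + y t * ((s - t)^-1 *: (z s - z t)))); last first.
  by apply/funext => s; rewrite /GRing.scale /=; ring.
have tJ : within J t^' --> within J (nbhs t).
  move=> S; rewrite /within /= /dnbhs /within /= => HS.
  by apply: (@filterS _ (nbhs t) _ _ _ _ HS) => s H _.
apply: cvgD; apply: cvgM; [exact: Hy| |exact: cvg_cst|exact: Hz].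
exact: (cvg_comp idfun z tJ (has_deriv_cvg Hz)).
Qed.

(** At an isolated point of [J] every vector is a derivative, so the first hypothesis asks for
    points of [J] just to the right of [t]; at such a point the two linear approximations differ by
    at most [e * (s - t)]. *)
Lemma has_deriv_unique {V : normedModType R} (J : set R) (y : R -> V) t v w :
  (forall e, 0 < e -> exists2 s, J s & t < s < t + e) ->
  has_deriv J y t v -> has_deriv J y t w -> v = w.
Proof.
move=> Jt /has_derivP Hv /has_derivP Hw; apply/eqP; rewrite -subr_eq0 -normr_le0.
apply/ler_addgt0Pr => e e0; rewrite add0r.
have [d1 d10 {}Hv] := Hv (e / 2) ltac:(by rewrite divr_gt0).
have [d2 d20 {}Hw] := Hw (e / 2) ltac:(by rewrite divr_gt0).
have [s Js /andP[ts st]] := Jt (Num.min d1 d2) ltac:(by rewrite lt_min d10).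
have st0 : 0 < s - t by rewrite subr_gt0.
have : `|s - t| < Num.min d1 d2 by rewrite gtr0_norm// ltrBlDl.
rewrite lt_min => /andP[/(Hv s Js){}Hv /(Hw s Js){}Hw].
rewrite -(ler_pM2l st0) -{1}(gtr0_norm st0) -normrZ scalerBr.
rewrite (_ : _ - _ = (y s - y t - (s - t) *: w) - (y s - y t - (s - t) *: v)).
  rewrite (le_trans (ler_normB _ _))//.
  by move: Hv Hw; rewrite (gtr0_norm st0); lra.
by rewrite opprB [RHS]addrC subrKA.
Qed.

(** Vector values rule out an intermediate point, so the bound is propagated from [a] by a supremum
    argument, applied to [y] minus the linear map of slope [c]. Derivatives relative to the segment
    suffice, also at its end points. *)
Lemma mean_value_ineq {V : normedModType R} (a b L : R) (y v : R -> V) (c : V) :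
  a <= b -> (forall t, a <= t <= b -> has_deriv `[a, b] y t (v t)) ->
  (forall t, a <= t <= b -> `|v t - c| <= L) ->
  `|y b - y a - (b - a) *: c| <= L * (b - a).
Proof.
move=> ab Hy HL.
pose z s := y s - s *: c.
have Hz t : a <= t <= b -> has_deriv `[a, b] z t (v t - c).
  move=> tab; apply: has_derivB; first exact: Hy.
  apply/has_derivP => e e0; exists 1 => // s _ _.
  by rewrite -scalerBl subrr normr0 mulr_ge0// ltW.
rewrite (_ : _ - _ - _ = z b - z a); last first.
  by rewrite /z scalerBl !opprB addrACA [RHS]addrACA [- y a - _]addrC.
(* The slope is relaxed to [L + e] to absorb the error of the linear approximation at the supremum;
   the [+ 1] below keeps the divisor positive when [a = b]. *)
apply/ler_addgt0Pr => e0 e00.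
pose e := e0 / (b - a + 1).
have k0 : 0 < b - a + 1 by rewrite ltr_wpDl// subr_ge0.
have e_gt0 : 0 < e by rewrite divr_gt0.
suff : `|z b - z a| <= (L + e) * (b - a).
  move=> /le_trans; apply; rewrite mulrDl lerD2l /e mulrAC ler_pdivrMr//.
  by rewrite ler_pM2l// lerDl.
pose S := [set t | a <= t <= b /\ `|z t - z a| <= (L + e) * (t - a)].
have Sa : S a by rewrite /S /= lexx ab !subrr normr0 mulr0.
have hS : has_sup S.
  by split; [exists a|exists b => t [/andP[]]].
pose m := sup S.
have am : a <= m by apply: ub_le_sup => //; exact: hS.2.
have mb : m <= b by apply: ge_sup; [exists a|move=> t [/andP[]]].
have mab : a <= m <= b by rewrite am mb.
have /has_derivP /(_ e e_gt0)[dl dl0 Hm] := Hz m mab.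
have step s : a <= s <= b -> `|s - m| < dl -> `|z s - z m| <= (L + e) * `|s - m|.
  move=> sab sdl; have := Hm s; rewrite /= in_itv /= => /(_ sab sdl) H.
  rewrite -[z s - z m](subrK ((s - m) *: (v m - c))) (le_trans (ler_normD _ _))//.
  rewrite mulrDl [L * _ + _]addrC lerD// normrZ mulrC ler_wpM2r//.
  exact: HL.
(* The linear approximation at [m], used to the left, puts [m] itself in [S]; used to the right
   further down, it produces a larger element of [S] unless [m = b]. *)
have Sm : S m.
  split=> //; have [s Ss] := sup_adherent dl0 hS; rewrite -/m => ms.
  have sm : s <= m by apply: ub_le_sup => //; exact: hS.2.
  have [sab Hs] := Ss.
  have sdl : `|s - m| < dl by rewrite distrC ger0_norm ?subr_ge0//; lra.
  have := step s sab sdl; rewrite distrC [`|s - m|]distrC [`|m - s|]ger0_norm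
      ?subr_ge0// => H1.
  rewrite -[z m - z a](subrKA (z s)) (le_trans (ler_normD _ _))//.
  by rewrite (le_trans (lerD H1 Hs))// -mulrDr addrA subrK.
suff bm : b <= m by have -> : b = m; [apply/eqP; rewrite eq_le bm mb|exact: Sm.2].
rewrite leNgt; apply/negP => mltb.
pose s := Num.min b (m + dl / 2).
have ms : m < s by rewrite lt_min mltb ltrDl divr_gt0.
have sb : s <= b by rewrite ge_min lexx.
have sdl : `|s - m| < dl.
  rewrite gtr0_norm ?subr_gt0// ltrBlDl gt_min; apply/orP; right.
  by rewrite ltrD2l ltr_pdivrMr// ltr_pMr// ltr1n.
have sab : a <= s <= b by rewrite sb (le_trans am (ltW ms)).
have := step s sab sdl; rewrite [`|s - m|]gtr0_norm ?subr_gt0// => H1.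
have : S s.
  split=> //; rewrite -[z s - z a](subrKA (z m)) (le_trans (ler_normD _ _))//.
  by rewrite (le_trans (lerD H1 Sm.2))// -mulrDr addrA subrK.
by move/(ub_le_sup hS.2); rewrite leNgt -/m ms.
Qed.

End relative_derivative.

(** * Functions of class C1 *)

Lemma pair_norm_lt {R : realType} {V W : normedModType R} (a : V) (b : W) (r : R) :
  `|a| < r -> `|b| < r -> `|(a, b)| < r.
Proof. by move=> ar br; rewrite /Num.norm /= gt_max ar br. Qed.

(** * Column vectors and their coordinates *)

Section column_vectors.
Context {R : realType}.

Lemma cV_norm_le n (v : 'cV[R]_n) r :
  0 <= r -> (forall i, `|v i 0| <= r) -> `|v| <= r.
Proof.
move=> r0 H; rewrite [`|v|]/Num.norm/= mx_normrE.
by apply: bigmax_le => // -[i j] _ /=; rewrite ord1.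
Qed.

Lemma cV_coord_le n (v : 'cV[R]_n) i : `|v i 0| <= `|v|.
Proof.
rewrite [leRHS]/Num.norm/= mx_normrE.
by rewrite (le_bigmax _ (fun ij : 'I_n * 'I_1 => `|v ij.1 ij.2|) (i, 0)).
Qed.

Lemma cvg_cV n {T : Type} (F : set_system T) {FF : Filter F} (f : T ->
    'cV[R]_n) (l : 'cV[R]_n) :
  (forall i, f z i 0 @[z --> F] --> l i 0) -> f @ F --> l.
Proof.
move=> H; apply/cvgrPdist_le => e e0.
have : \forall z \near F, forall i, `|l i 0 - f z i 0| <= e.
  by apply: filter_forall => i; have /cvgrPdist_le/(_ e e0) := H i.
by apply: filterS => z Hz; apply: cV_norm_le (ltW e0) _ => i; rewrite !mxE.
Qed.

Lemma cvg_coord n {T : Type} (F : set_system T) {FF : Filter F} (f : T ->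
    'cV[R]_n) (l : 'cV[R]_n) :
  f @ F --> l -> forall i, f z i 0 @[z --> F] --> l i 0.
Proof.
move=> H i; apply/cvgrPdist_le => e e0; move/cvgrPdist_le : H => /(_ e e0).
by apply: filterS => z; apply: le_trans; have := cV_coord_le (l - f z) i; rewrite !mxE.
Qed.

Lemma cvg_col_mx n m {T : Type} (F : set_system T) {FF : Filter F}
    (f : T -> 'cV[R]_n) (g : T -> 'cV[R]_m) (l : 'cV[R]_n) (k : 'cV[R]_m) :
  f @ F --> l -> g @ F --> k -> (col_mx (f z) (g z)) @[z --> F] --> col_mx l k.
Proof.
move=> /cvg_coord Hf /cvg_coord Hg; apply: cvg_cV => i.
case: (splitP i) => j ij.
  have -> : i = lshift m j by apply/val_inj.
  rewrite col_mxEu; under eq_fun do rewrite col_mxEu; exact: Hf.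
have -> : i = rshift n j by apply/val_inj.
rewrite col_mxEd; under eq_fun do rewrite col_mxEd; exact: Hg.
Qed.

Lemma has_deriv_coord n (J : set R) (y : R -> 'cV[R]_n) t v :
  has_deriv J y t v <-> forall i, has_deriv J (fun s => y s i 0) t (v i 0).
Proof.
split=> H; last first.
  apply: cvg_cV => i; have := H i; rewrite /has_deriv /=.
  by under [X in _ -> X @ _ --> _]eq_fun do rewrite !mxE.
move=> i; move/cvg_coord : H => /(_ i); rewrite /has_deriv.
by under [X in X @ _ --> _ -> _]eq_fun do rewrite !mxE.
Qed.

End column_vectors.

Section smooth_functions.
Context {R : realType}.

Lemma within_proper (t : R) : 0 <= t -> ProperFilter (within Rplus t^').
Proof.
move=> t0; split; last exact: within_filter.
rewrite /within /= /dnbhs /within /= => /nbhs_normP[e /= e0 H].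
have e2 : 0 < e / 2 by rewrite divr_gt0.
apply: (H (t + e / 2)).
- by rewrite /ball_ /= opprD addrA subrr add0r normrN gtr0_norm// ltr_pdivrMr//
    ltr_pMr// ltr1n.
- by rewrite -subr_eq0 addrC addKr gt_eqF.
- by rewrite /Rplus /=; rewrite addr_ge0// ltW.
Qed.

Lemma dt_eq {W : normedModType R} {X : Type} (h : X -> R -> W) x t l :
  0 <= t -> has_deriv Rplus (h x) t l -> dt h x t = l.
Proof. by move=> t0 H; have ? := within_proper t0; exact: cvg_lim. Qed.

Lemma within2P {W : normedModType R} {X : normedModType R} (k : X -> R -> W) :
  {within [set z : X * R | 0 <= z.2], continuous (fun z => k z.1 z.2)} <->
  forall (x : X) (t : R), 0 <= t ->
    k z.1 z.2 @[z --> within [set z : X * R | 0 <= z.2] (nbhs (x, t))] --> k x t.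
Proof.
split=> [/subspace_continuousP H x t t0|H]; first exact: H (x, t) t0.
by apply/subspace_continuousP => -[x t] t0; exact: H.
Qed.

Lemma C1_coord n m (h : 'cV[R]_n -> R -> 'cV[R]_m) i : C1 h ->
  [/\ C1 (fun x t => h x t i 0),
      forall j x t, 0 <= t -> dx (fun x t => h x t i 0) j x t = dx h j x t i 0
    & forall x t, 0 <= t -> dt (fun x t => h x t i 0) x t = dt h x t i 0].
Proof.
move=> [h1 h2 h3 h4].
have hx j x t : 0 <= t -> dx (fun x t => h x t i 0) j x t = dx h j x t i 0.
  by move=> t0; rewrite /dx derive_mx ?mxE//; exact: h1.
have ht x t : 0 <= t -> has_deriv Rplus (fun s => h x s i 0) t (dt h x t i 0).
  by move=> t0; have /has_deriv_coord := h2 x t t0; exact.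
have hdt x t : 0 <= t -> dt (fun x t => h x t i 0) x t = dt h x t i 0.
  by move=> t0; exact: (dt_eq (h := fun x t => h x t i 0) t0 (ht x t t0)).
split=> //; split.
- by move=> j x t t0; have /derivable_mxP := h1 j x t t0; exact.
- by move=> x t t0; rewrite hdt//; exact: ht.
- move=> j; apply/within2P => x t t0; rewrite hx//.
  have /within2P /(_ x t t0) /cvg_coord /(_ i) := h3 j.
  apply: cvg_trans; apply: near_eq_cvg.
  by rewrite near_withinE; apply: nearW => -[y s] /= s0; rewrite hx.
- apply/within2P => x t t0; rewrite hdt//.
  have /within2P /(_ x t t0) /cvg_coord /(_ i) := h4.
  apply: cvg_trans; apply: near_eq_cvg.
  by rewrite near_withinE; apply: nearW => -[y s] /= s0; rewrite hdt.
Qed.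

Lemma line_increment n (h : 'cV[R]_n -> R) (z : 'cV[R]_n) (k : 'I_n) (b c e : R) :
  (forall y, derivable h y (delta_mx k 0)) ->
  (forall r, `|r| <= `|b| -> `|'D_(delta_mx k 0) h (z + r *: delta_mx k 0) - c| <= e) ->
  `|h (z + b *: delta_mx k 0) - h z - b * c| <= e * `|b|.
Proof.
move=> hd hc.
(* Travelling in the direction [sg] over the length [|b|] treats both signs of [b] on one segment
   starting at 0. *)
pose sg : R := if 0 <= b then 1 else -1.
have sgb : sg * `|b| = b.
  rewrite /sg; case: ifPn => [b0|]; first by rewrite mul1r ger0_norm.
  by rewrite -ltNge => b0; rewrite ltr0_norm// mulN1r opprK.
have sgn : `|sg| = 1 by rewrite /sg; case: ifP => _; rewrite ?normrN normr1.
pose y r := h (z + (sg * r) *: delta_mx k 0).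
have Hy r : 0 <= r <= `|b| ->
    has_deriv `[0, `|b|] y r (sg * 'D_(delta_mx k 0) h (z + (sg * r) *: delta_mx k 0)).
  move=> _.
  apply/has_derivP => eta eta0.
  set w := z + (sg * r) *: delta_mx k 0; set Dw := 'D_(delta_mx k 0) h w.
  have : (fun rho : R => rho^-1 *: (h (rho *: delta_mx k 0 + w) - h w)) @ 0^' --> Dw.
    exact: hd w.
  move/cvgrPdist_le/(_ eta eta0).
  rewrite /dnbhs /within /= => /nbhs_normP[dl /= dl0 H]; exists dl => // s _ sdl.
  have [->|sr] := eqVneq s r; first by rewrite !subrr scale0r subr0 !normr0 mulr0.
  pose rho := sg * (s - r).
  have srn : `|rho| = `|s - r| by rewrite normrM sgn mul1r.
  have rho0 : rho != 0 by rewrite -normr_gt0 srn normr_gt0 subr_eq0.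
  have {}H : `|Dw - rho^-1 *: (h (rho *: delta_mx k 0 + w) - h w)| <= eta.
    by apply: H => //; rewrite /ball_ /= sub0r normrN srn.
  have -> : y s = h (rho *: delta_mx k 0 + w).
    by rewrite /y /w addrCA -scalerDl; congr (h (_ + _ *: _)); rewrite /rho; ring.
  rewrite -[y r]/(h w) -srn (_ : (s - r) *: (sg * Dw) = rho * Dw); last first.
    by rewrite /GRing.scale /= /rho; ring.
  rewrite -ler_pdivrMr ?normr_gt0// -normfV -normrM (le_trans _ H)//.
  rewrite mulrBl [rho * _]mulrC mulfK// distrC le_eqVlt; apply/orP; left; apply/eqP.
  by congr (`|_ - _|); rewrite mulrC.
have := @mean_value_ineq _ R^o 0 `|b| e y _ (sg * c) (normr_ge0 b) Hy.
rewrite subr0 /y mulr0 scale0r addr0 sgb.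
rewrite (_ : `|b| *: _ = b * c); last by rewrite /GRing.scale /= mulrCA mulrA sgb.
apply => t /andP[t0 tb]; rewrite -mulrBr normrM sgn mul1r; apply: hc.
by rewrite normrM sgn mul1r ger0_norm.
Qed.

(** Only partial derivatives are given, so [x] is moved to [y] one coordinate at a time. The move
    takes place at time [s] while the gradient is frozen at [(x, t)]; the variation in time is left
    to a separate term in [C1_cvg] and [C1_chain]. *)
Lemma C1_increment n (h : 'cV[R]_n -> R -> R) x t e : C1 h -> 0 <= t -> 0 < e ->
  exists2 dl, 0 < dl & forall y s, 0 <= s -> `|y - x| < dl -> `|s - t| < dl ->
    `|h y s - h x s - \sum_(j < n) (y j 0 - x j 0) * dx h j x t| <= e * `|y - x|.
Proof.
move=> [h1 h2 h3 h4] t0 e0.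
(* One share for each of the [n] coordinates; [n + 1] also covers [n = 0]. *)
pose e' := e / n.+1%:R; have e'0 : 0 < e' by rewrite divr_gt0.
have [dl dl0 Hdl] : exists2 dl, 0 < dl & forall j y s, 0 <= s -> `|y - x| < dl ->
    `|s - t| < dl -> `|dx h j y s - dx h j x t| <= e'.
  have : \forall z \near within [set z : 'cV[R]_n * R | 0 <= z.2] (nbhs (x, t)),
      forall j, `|dx h j x t - dx h j z.1 z.2| <= e'.
    apply: filter_forall => j.
    have /within2P /(_ x t t0) /cvgrPdist_le := h3 j.
    exact.
  rewrite /within /= => /nbhs_normP[dl /= dl0 H]; exists dl => // j y s s0 yx st.
  rewrite distrC; apply: (H (y, s)) => //=; rewrite /ball_ /=.
  by rewrite /Num.norm /= gt_max !(distrC _ y, distrC _ s) yx st.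
exists dl => // y s s0 yx st.
pose z (k : nat) : 'cV[R]_n := \col_i (if (i < k)%N then y i 0 else x i 0).
have z0 : z 0%N = x by apply/colP => i; rewrite mxE.
have zn : z n = y by apply/colP => i; rewrite mxE ltn_ord.
have zS (k : 'I_n) : z k.+1 = z k + (y k 0 - x k 0) *: delta_mx k 0.
  apply/colP => i; rewrite !mxE ltnS leq_eqVlt eqxx andbT.
  have [->|ik] := eqVneq i k; first by rewrite eqxx ltnn mulr1 addrC subrK.
  by rewrite mulr0 addr0 val_eqE (negbTE ik).
have -> : h y s - h x s = \sum_(k < n) (h (z k.+1) s - h (z k) s).
  rewrite -[X in h X s - _]zn -[X in _ - h X s]z0.
  by rewrite -(big_mkord xpredT (fun k => h (z k.+1) s - h (z k) s)) telescope_sumr.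
rewrite -sumrB; apply: le_trans (ler_norm_sum _ _ _) _.
apply: (@le_trans _ _ (\sum_(k < n) e' * `|y - x|)); last first.
  rewrite sumr_const card_ord -mulr_natl mulrA ler_wpM2r// /e' mulrCA.
  by rewrite ger_pMr// ler_pdivrMr// mul1r ler_nat.
apply: ler_sum => k _; rewrite zS.
have ykx : `|y k 0 - x k 0| <= `|y - x| by have := cV_coord_le (y - x) k; rewrite !mxE.
apply: (@le_trans _ _ (e' * `|y k 0 - x k 0|)); last by rewrite ler_wpM2l// ltW.
apply: (line_increment (h := h ^~ s)) => [w|r rk]; first exact: h1.
(* In the max norm the intermediate points are no farther from [x] than [y] is, since no coordinate
   has moved by more than it does in [y]. *)
apply: Hdl => //; apply: le_lt_trans yx; apply: cV_norm_le => // i;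
    rewrite !mxE eqxx andbT.
have [->|ik] := eqVneq i k.
  by rewrite ltnn mulr1 addrAC subrr add0r (le_trans rk).
rewrite mulr0 addr0; case: ifP => _; last by rewrite subrr normr0.
by have := cV_coord_le (y - x) i; rewrite !mxE.
Qed.

Lemma within_cvg2 {W X : normedModType R} (k : X -> R -> W) {T : Type}
    (F : set_system T) {FF : Filter F} (xf : T -> X) (tf : T -> R) x t :
  {within [set z : X * R | 0 <= z.2], continuous (fun z => k z.1 z.2)} ->
  xf @ F --> x -> tf @ F --> t -> (\forall z \near F, 0 <= tf z) -> 0 <= t ->
  k (xf z) (tf z) @[z --> F] --> k x t.
Proof.
move=> /within2P /(_ x t) kc xfx tft tf0 t0.
apply/cvgrPdist_le => e e0; have /cvgrPdist_le /(_ e e0) := kc t0.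
rewrite /within /= => /nbhs_normP[dl /= dl0 H].
move/cvgrPdist_lt : xfx => /(_ dl dl0) Hx; move/cvgrPdist_lt : tft => /(_ dl dl0) Ht.
near=> z.
apply: (H (xf z, tf z)) => /=; last by near: z.
rewrite /ball_ /= /Num.norm /= gt_max; apply/andP; split; near: z; assumption.
Unshelve. all: by end_near. Qed.

(** [C1] does not list the continuity of [h] itself; it follows from the increment estimate in the
    state and from differentiability in time at the fixed state [x]. *)
Lemma C1_cvg n (h : 'cV[R]_n -> R -> R) {T : Type}
    (F : set_system T) {FF : Filter F} (xf : T -> 'cV[R]_n) (tf : T -> R) x t :
  C1 h -> xf @ F --> x -> tf @ F --> t -> (\forall z \near F, 0 <= tf z) -> 0 <= t ->
  h (xf z) (tf z) @[z --> F] --> h x t.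
Proof.
move=> hC xfx tft tf0 t0; have [_ h2 _ _] := hC.
have [dl dl0 Hdl] := C1_increment x hC t0 ltr01.
apply/cvgrPdist_le => e e0.
pose S := \sum_(j < n) `|dx h j x t|.
have S0 : 0 <= S by rewrite sumr_ge0.
have S1 : 0 < 1 + S by rewrite ltr_wpDr.
have /has_deriv_cvg /cvgrPdist_le /(_ (e / 2)) := h2 x t t0.
rewrite divr_gt0// => /(_ isT); rewrite /within /= => /nbhs_normP[d2 /= d20 H2].
have d10 : 0 < Num.min dl (e / 2 / (1 + S)) by rewrite lt_min dl0 !divr_gt0.
have d30 : 0 < Num.min dl d2 by rewrite lt_min dl0.
move/cvgrPdist_lt : xfx => /(_ _ d10) Hx; move/cvgrPdist_lt : tft => /(_ _ d30) Ht.
near=> z.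
have z0 : 0 <= tf z by near: z.
have : `|x - xf z| < Num.min dl (e / 2 / (1 + S)) by near: z.
rewrite distrC lt_min => /andP[xz1 xz2].
have : `|t - tf z| < Num.min dl d2 by near: z.
rewrite lt_min => /andP[tz1 tz2].
have A1 := H2 (tf z) tz2 z0; rewrite distrC in tz1.
have A2 := Hdl _ _ z0 xz1 tz1.
have A3 : `|\sum_(j < n) (xf z j 0 - x j 0) * dx h j x t| <= S * `|xf z - x|.
  apply: le_trans (ler_norm_sum _ _ _) _; rewrite /S mulr_suml; apply: ler_sum => j _.
  rewrite normrM mulrC ler_wpM2l//.
  by have := cV_coord_le (xf z - x) j; rewrite !mxE.
have A4 : (1 + S) * `|xf z - x| <= e / 2.
  by rewrite mulrC -ler_pdivlMr// ltW.
move: A2 A3 A1; set a := h _ _; set b := h x (tf z); set c := h x t;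
    set s := \sum_(_ < _) _.
move=> A2 A3 A1.
rewrite (_ : c - a = (c - b) - ((a - b - s) + s)); last by ring.
apply: le_trans (ler_normB _ _) _.
have := ler_normD (a - b - s) s; move: A1 A2 A3 A4; lra.
Unshelve. all: by end_near. Qed.

Lemma C1_chain n (h : 'cV[R]_n -> R -> R) (J : set R) (x : R -> 'cV[R]_n) t v :
  C1 h -> J `<=` Rplus -> 0 <= t -> has_deriv J x t v ->
  has_deriv J (fun s => h (x s) s) t (dt h (x t) t + lie v h (x t) t).
Proof.
move=> hC J0 t0 hx; have [_ h2 _ _] := hC.
apply/has_derivP => e e0.
pose S := \sum_(j < n) `|dx h j (x t) t|.
have S0 : 0 <= S by rewrite sumr_ge0.
(* The increment is split into three errors of at most [e / 3 * |s - t|]. Since [e2 <= 1], the path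
   moves by at most [k * |s - t|], which fixes [e1]; the partial derivatives sum to [S] in absolute
   value, which fixes [e2]. *)
pose k := `|v| + 1; have k0 : 0 < k by rewrite ltr_wpDl.
pose e1 := e / 3 / k; have e10 : 0 < e1 by rewrite !divr_gt0.
pose e2 := Num.min 1 (e / 3 / (1 + S)).
have S1 : 0 < 1 + S by rewrite ltr_wpDr.
have e20 : 0 < e2 by rewrite lt_min ltr01 !divr_gt0.
have e30 : 0 < e / 3 by rewrite divr_gt0.
have [d1 d10 H1] := C1_increment (x t) hC t0 e10.
have /has_derivP /(_ _ e20)[d2 d20 H2] := hx.
have /has_derivP /(_ _ e30)[d3 d30 H3] := h2 (x t) t t0.
have /cvgrPdist_lt /(_ d1 d10) := has_deriv_cvg hx.
rewrite /within /= => /nbhs_normP[d4 /= d40 H4].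
exists (Num.min (Num.min d1 d2) (Num.min d3 d4)); first by rewrite !lt_min d10 d20 d30.
move=> s Js; rewrite !lt_min => /andP[/andP[s1 s2] /andP[s3 s4]].
have s0 : 0 <= s := J0 s Js.
have {}H4 : `|x s - x t| < d1 by rewrite distrC; apply: H4 => //;
    rewrite /ball_ /= distrC.
have {}H1 := H1 (x s) s s0 H4 s1.
have {}H2 := H2 s Js s2; have {}H3 := H3 s s0 s3.
have e21 : e2 <= 1 by rewrite ge_min lexx.
have e22 : (1 + S) * e2 <= e / 3.
  by rewrite mulrC -ler_pdivlMr// ge_min lexx orbT.
have xk : `|x s - x t| <= k * `|s - t|.
  rewrite -[x s - x t](subrK ((s - t) *: v)) (le_trans (ler_normD _ _))// normrZ.
  rewrite (le_trans (lerD H2 (lexx _)))// /k mulrDl addrC mulrC lerD// ler_wpM2r//.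
set st := `|s - t| in H2 H3 xk *; have st0 : 0 <= st := normr_ge0 _.
have B1 : e1 * `|x s - x t| <= e / 3 * st.
  by apply: (le_trans (ler_wpM2l (ltW e10) xk)); rewrite mulrA /e1 mulfVK ?gt_eqF.
have B2 : `|\sum_(j < n) (x s j 0 - x t j 0 - (s - t) * v j 0) * dx h j (x t) t| <= e /
    3 * st.
  apply: (@le_trans _ _ (S * (e2 * st))).
    apply: le_trans (ler_norm_sum _ _ _) _; rewrite /S mulr_suml; apply: ler_sum => j _.
    rewrite normrM mulrC ler_wpM2l//; apply: le_trans H2.
    by have := cV_coord_le (x s - x t - (s - t) *: v) j; rewrite !mxE.
  rewrite mulrA ler_wpM2r//; apply: le_trans e22; rewrite ler_wpM2r ?ltW//; lra.
have -> : h (x s) s - h (x t) t - (s - t) *: (dt h (x t) t + lie v h (x t) t) =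
   (h (x s) s - h (x t) s - \sum_(j < n) (x s j 0 - x t j 0) * dx h j (x t) t)
   + (h (x t) s - h (x t) t - (s - t) *: dt h (x t) t)
   + \sum_(j < n) (x s j 0 - x t j 0 - (s - t) * v j 0) * dx h j (x t) t.
  have -> : \sum_(j < n) (x s j 0 - x t j 0 - (s - t) * v j 0) * dx h j (x t) t =
     \sum_(j < n) (x s j 0 - x t j 0) * dx h j (x t) t - (s - t) * lie v h (x t) t.
    rewrite /lie mulr_sumr -sumrB; apply: eq_bigr => j _; rewrite /GRing.scale /=; ring.
  rewrite /GRing.scale /=; ring.
apply: le_trans (ler_normD _ _) _.
have := ler_normD (h (x s) s - h (x t) s - \sum_(j < n) (x s j 0 - x t j 0) * dx h j (x
    t) t)
   (h (x t) s - h (x t) t - (s - t) *: dt h (x t) t).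
move: B1 B2 H1 H3; lra.
Qed.

End smooth_functions.

(** * Peano's theorem and continuation of bounded solutions *)

Lemma ultrafilter_image {T T' : Type} (f : T -> T') (F : set_system T) :
  UltraFilter F -> UltraFilter (f @ F).
Proof.
move=> FU; split; first exact: fmap_proper_filter.
move=> G PG FG; rewrite predeqE => A; split; last exact: FG.
move=> GA; have [//|nFA] := in_ultra_setVsetC (f @^-1` A) FU.
have GnA : G (~` A) by apply: FG.
by have /filter_ex[x []] : G (A `&` ~` A) by exact: filterI.
Qed.

Section peano.
Context {R : realType} {V : normedModType R} (G : V -> R -> V).

Fixpoint euler (a eta : R) (v0 : V) (i : nat) : V :=
  if i is i'.+1 then
    euler a eta v0 i' + eta *: G (euler a eta v0 i') (a + i'%:R * eta)
  else v0.

(** Each step adds [eta] times a slope error to the deviation from the line of slope [g]. With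
    [g = 0] this is a Lipschitz bound for the polygons; with [g = G (y t) t] it yields the
    derivative of their limit. *)
Lemma euler_slope a eta v0 i m g e : 0 <= eta ->
  (forall l, (i <= l < i + m)%N -> `|G (euler a eta v0 l) (a + l%:R * eta) - g| <= e) ->
  `|euler a eta v0 (i + m) - euler a eta v0 i - (m%:R * eta) *: g|
    <= e * (m%:R * eta).
Proof.
move=> eta0; elim: m => [|m IH] H.
  by rewrite addn0 subrr mul0r scale0r subr0 normr0 mulr0.
have {}IH := IH _; rewrite addnS /=.
set X := euler a eta v0 in H IH *; set g' := G _ _.
have -> : X (i + m)%N + eta *: g' - X i - (m.+1%:R * eta) *: g =
    (X (i + m)%N - X i - (m%:R * eta) *: g) + eta *: (g' - g).
  rewrite -natr1 mulrDl mul1r scalerDl scalerBr opprD !addrA.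
  by congr (_ + _); rewrite [RHS]addrAC; congr (_ + _); exact: addrAC.
apply: le_trans (ler_normD _ _) _.
rewrite -natr1 mulrDl mul1r mulrDr lerD//.
  by apply: IH => l /andP[il lm]; apply: H; rewrite il (ltn_trans lm)// addnS.
rewrite normrZ ger0_norm// mulrC ler_wpM2r//; apply: H.
by rewrite leq_addr addnS ltnS leqnn.
Qed.

Hypothesis Vc : forall r : R, compact [set v : V | `|v| <= r].

Lemma continuous_at_epsdelta (a : R) (t : R) (v : V) e :
  {within [set z : V * R | a <= z.2], continuous (fun z => G z.1 z.2)} ->
  a <= t -> 0 < e -> exists2 dl, 0 < dl &
    forall w s, a <= s -> `|w - v| < dl -> `|s - t| < dl -> `|G w s - G v t| <= e.
Proof.
move=> /subspace_continuousP /(_ (v, t)) Gc at0 e0.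
have /cvgrPdist_le /(_ e e0) := Gc at0.
rewrite /within /= => /nbhs_normP[dl /= dl0 H]; exists dl => // w s sa wv st.
rewrite distrC; apply: (H (w, s)) => //=; rewrite /ball_ /=.
by rewrite /Num.norm /= gt_max !(distrC _ w, distrC _ s) wv st.
Qed.

(* The step functions of the explicit Euler scheme with step h / k converge
   pointwise along an ultrafilter on k; every limit point of the difference
   quotients is then governed by the continuity of G, so that neither
   equicontinuity theorems nor integral equations are needed. *)
Lemma peano (a : R) (v0 : V) :
  {within [set z : V * R | a <= z.2], continuous (fun z => G z.1 z.2)} ->
  exists2 h, 0 < h & exists2 y : R -> V, y a = v0 &
    forall t, a <= t <= a + h -> has_deriv `[a, a + h] y t (G (y t) t).
Proof.
move=> Gc.
have [d0 d00 Hd0] := continuous_at_epsdelta v0 Gc (lexx a) ltr01.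
pose L := `|G v0 a| + 1; have L0 : 0 < L by rewrite ltr_wpDl.
have HL w s : a <= s -> `|w - v0| < d0 -> `|s - a| < d0 -> `|G w s| <= L.
  move=> sa wv sd; rewrite -[G w s](subrK (G v0 a)) (le_trans (ler_normD _ _))//.
  by rewrite /L addrC lerD2l; exact: Hd0.
(* Over a time [h] the polygon, whose speed is at most [L] near [(v0, a)], moves by at most
   [d0 / 2], so it never leaves the region where this speed bound holds. *)
pose h := Num.min (d0 / 2) (d0 / 2 / L).
have h0 : 0 < h by rewrite lt_min !divr_gt0.
have hd : h < d0 by rewrite gt_min ltr_pdivrMr// ltr_pMr// ltr1n.
have hL : h * L <= d0 / 2 by rewrite -ler_pdivlMr// ge_min lexx orbT.
pose eta (k : nat) := h / k.+1%:R.
have eta0 k : 0 < eta k by rewrite divr_gt0.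
have etak k : k.+1%:R * eta k = h by rewrite /eta mulrCA mulfV ?mulr1.
pose X k := euler a (eta k) v0.
have ieta k i : (i <= k.+1)%N -> i%:R * eta k <= h.
  by move=> ik; rewrite -(etak k) ler_wpM2r ?ler_nat// ltW.
have Xv0 k i : (i <= k.+1)%N -> `|X k i - v0| <= d0 / 2 /\
    forall l, (l < i)%N -> `|G (X k l) (a + l%:R * eta k)| <= L.
  elim: i => [|i IH] ik; first by rewrite /X /= subrr normr0 divr_ge0 ?ltW.
  have [IH1 IH2] := IH (ltnW ik).
  have Gi : `|G (X k i) (a + i%:R * eta k)| <= L.
    have i0 : 0 <= i%:R * eta k by rewrite mulr_ge0// ltW.
    apply: HL; first by rewrite lerDl.
      by apply: le_lt_trans IH1 _; rewrite ltr_pdivrMr// ltr_pMr// ltr1n.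
    rewrite addrAC subrr add0r ger0_norm//; apply: le_lt_trans hd.
    by apply: ieta; exact: ltnW.
  have Gl l : (l < i.+1)%N -> `|G (X k l) (a + l%:R * eta k)| <= L.
    by rewrite ltnS leq_eqVlt => /predU1P[->//|]; exact: IH2.
  split=> //.
  have := @euler_slope a (eta k) v0 0 i.+1 0 L (ltW (eta0 k)).
  rewrite scaler0 subr0 add0n => /(_ _)/le_trans; apply.
    by move=> l; rewrite subr0; exact: Gl.
  apply: le_trans hL; rewrite mulrC ler_wpM2r ?(ltW L0)//; exact: ieta.
have Xlip k i j : (i <= k.+1)%N -> (j <= k.+1)%N ->
    `|X k i - X k j| <= `|i%:R * eta k - j%:R * eta k| * L.
  wlog ij : i j / (j <= i)%N => [H|] ik jk.
    have [ji|/ltnW ji] := leqP j i; first exact: H.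
    by rewrite distrC [X in _ <= X * _]distrC; exact: H.
  have := @euler_slope a (eta k) v0 j (i - j) 0 L (ltW (eta0 k)).
  rewrite scaler0 subr0 subnKC// => /(_ _)/le_trans; apply.
    move=> l /andP[_ li]; rewrite subr0; have [_] := Xv0 k i ik; exact.
  by rewrite mulrC ler_wpM2r ?(ltW L0)// natrB// mulrBl ler_norm.
pose idx k t := Num.truncn ((t - a) / eta k).
have idxP k t : a <= t <= a + h ->
    [/\ (idx k t <= k.+1)%N, (idx k t)%:R * eta k <= t - a
      & t - a < (idx k t)%:R * eta k + eta k].
  move=> /andP[at0 th].
  have t0 : 0 <= (t - a) / eta k by rewrite divr_ge0 ?subr_ge0// ltW.
  have /andP[i1 i2] := truncn_itv t0.
  have A1 : (idx k t)%:R * eta k <= t - a by rewrite -ler_pdivlMr.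
  split=> //.
    have : (idx k t)%:R * eta k <= k.+1%:R * eta k.
      by rewrite etak (le_trans A1)// lerBlDl.
    by rewrite ler_pM2r// ler_nat.
  by rewrite -[X in _ < _ + X]mul1r -mulrDl natr1 -ltr_pdivrMr.
pose x k t := X k (idx k t).
have [U [UU sU]] := @ultraFilterLemma nat \oo _.
pose y t := lim (x k t @[k --> U]).
have yP t : a <= t <= a + h -> x k t @[k --> U] --> y t.
  move=> tah; have := @Vc (`|v0| + d0); rewrite compact_ultra.
  move=> /(_ (x k t @[k --> U]) _)[].
    exact: ultrafilter_image.
    apply: (@filterS _ U _ setT); [|exact: filterT] => k _.
    have [ik _ _] := idxP k t tah; have [xv _] := Xv0 k _ ik.
    rewrite /= -[x k t](subrK v0) (le_trans (ler_normD _ _))// addrC lerD2l.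
    by apply: le_trans xv _; rewrite ler_pdivrMr// ler_pMr// ler1n.
  move=> l [_ xl]; have : cvg (x k t @[k --> U]) by apply/cvg_ex; exists l.
  exact.
exists h => //; exists y.
  have ah : a <= a <= a + h by rewrite lexx lerDl ltW.
  apply: (cvg_unique _ (yP a ah)).
    exact: norm_hausdorff.
  rewrite (_ : (fun k => x k a) = fun=> v0); first exact: cvg_cst.
  by apply/funext => k; rewrite /x /idx subrr mul0r truncn0.
move=> t tah; have /andP[at0 _] := tah.
apply/has_derivP => e e0.
have [d1 d10 Hd1] := continuous_at_epsdelta (y t) Gc at0 e0.
(* Nodes between those of [s] and [t] lie within [2 * dl] of the node of [t], so the polygon varies
   there by at most [d1 / 2]; with [d1 / 4] for the distance to the limit, the arguments of [G] stay
   within [d1] of [(y t, t)]. *)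
pose dl := Num.min (d1 / 4) (d1 / 4 / L).
have dl0 : 0 < dl by rewrite lt_min !divr_gt0.
have dl1 : dl <= d1 / 4 by rewrite ge_min lexx.
have dl2 : dl * L <= d1 / 4 by rewrite -ler_pdivlMr// ge_min lexx orbT.
exists dl => // s; rewrite /= in_itv /= => sah st.
set g := G (y t) t.
apply/ler_addgt0Pr => z z0.
have C0 : 0 < 1 + e + `|g| by rewrite ltr_wpDr// ltr_wpDr// ltW.
(* Rounding [s] and [t] to grid nodes changes their difference by at most [eta k], at a cost of
   [eta k * (e + |g|)], which [z1] keeps below [z / 3]. *)
pose z1 := Num.min dl (z / 3 / (1 + e + `|g|)).
have z10 : 0 < z1 by rewrite lt_min dl0 !divr_gt0.
have Uk : \forall k \near U, eta k < z1.
  apply: sU; near=> k; rewrite /eta ltr_pdivrMr// mulrC -ltr_pdivrMr//.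
  apply: lt_le_trans (truncnS_gt _) _; rewrite ler_nat ltnS; near: k.
  by exists (Num.truncn (h / z1)).
have d140 : 0 < d1 / 4 by rewrite divr_gt0.
have z30 : 0 < z / 6 by rewrite divr_gt0.
have /cvgrPdist_lt /(_ _ d140) Ut := yP t tah.
have /cvgrPdist_le /(_ _ z30) Ut' := yP t tah.
have /cvgrPdist_le /(_ _ z30) Us := yP s sah.
have : exists k, [/\ eta k < z1, `|y t - x k t| < d1 / 4, `|y t - x k t| <= z / 6
    & `|y s - x k s| <= z / 6].
  have UP : ProperFilter U by exact: ultra_proper.
  near U => k; exists k; split; near: k; assumption.
move=> [k [kz kt kt' ks]].
have [it1 it2 it3] := idxP k t tah; have [is1 is2 is3] := idxP k s sah.
move: kz; rewrite lt_min => /andP[kz1 kz2].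
have kz3 : eta k * (1 + e + `|g|) < z / 3 by rewrite -ltr_pdivlMr.
have main i j : (i <= j)%N -> (j <= k.+1)%N ->
    (forall l, (i <= l < j)%N -> `|l%:R * eta k - (idx k t)%:R * eta k| <= `|s - t| +
        eta k) ->
    `|X k j - X k i - (j%:R * eta k - i%:R * eta k) *:
        g| <= e * (j%:R * eta k - i%:R * eta k).
  move=> ij jk Hl.
  have := @euler_slope a (eta k) v0 i (j - i) g e (ltW (eta0 k)).
  rewrite subnKC// natrB// mulrBl; apply => l lij.
  have {}Hl := Hl l lij; have lk : (l <= k.+1)%N.
    by case/andP: lij => _ lj; rewrite (leq_trans (ltnW lj)).
  apply: Hd1.
  - by rewrite lerDl mulr_ge0// ltW.
  - rewrite -[X in `|X|](subrKA (x k t)) (le_lt_trans (ler_normD _ _))//.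
    have : `|X k l - x k t| <= d1 / 2.
      apply: (le_trans (Xlip k _ _ lk it1)).
      apply: (@le_trans _ _ ((dl + dl) * L)); last by rewrite mulrDl; lra.
      rewrite ler_wpM2r ?(ltW L0)// (le_trans Hl)// lerD// ltW//.
    by rewrite distrC in kt; move: kt d10; lra.
  - rewrite (_ : a + _ - t = (l%:R * eta k - (idx k t)%:R * eta k)
        + ((idx k t)%:R * eta k - (t - a))); last by ring.
    rewrite (le_lt_trans (ler_normD _ _))//.
    have : `|(idx k t)%:R * eta k - (t - a)| <= eta k.
      by rewrite distrC ger0_norm; lra.
    by move: Hl kz1 st dl1 d10; lra.
have key : `|x k s - x k t - ((idx k s)%:R * eta k - (idx k t)%:R * eta k) *: g|
    <= e * `|(idx k s)%:R * eta k - (idx k t)%:R * eta k|.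
  have bnd : `|(idx k s)%:R * eta k - (idx k t)%:R * eta k| <= `|s - t| + eta k.
    by rewrite ler_norml; have := ler_norm (s - t); have := ler_norm (t - s);
       rewrite (distrC t s); move: it2 it3 is2 is3; lra.
  have [ts|/ltnW st'] := leqP (idx k t) (idx k s).
    rewrite [X in _ <= e * X]ger0_norm;
        last by rewrite -mulrBl mulr_ge0 ?subr_ge0 ?ler_nat// ltW.
    apply: main => // l /andP[tl ls]; apply: le_trans bnd.
    rewrite -!mulrBl !normrM ler_wpM2r// !ger0_norm ?subr_ge0 ?ler_nat//.
    by rewrite lerD2r ler_nat ltnW.
  rewrite -normrN (_ : - (x k s - _ - _) = x k t - x k s
      - ((idx k t)%:R * eta k - (idx k s)%:R * eta k) *: g); last first.
    by rewrite opprD opprB opprK -[X in _ = _ - X *: _]opprB scaleNr opprK.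
  rewrite [X in _ <= e * X]distrC [X in _ <= e * X]ger0_norm;
      last by rewrite -mulrBl mulr_ge0 ?subr_ge0 ?ler_nat// ltW.
  apply: main => // l /andP[tl ls]; apply: le_trans bnd.
  rewrite -!mulrBl !normrM ler_wpM2r// ler0_norm ?subr_le0 ?ler_nat ?(ltnW ls)//.
  rewrite [leRHS]ler0_norm ?subr_le0 ?ler_nat//.
  by rewrite !opprB lerD2l lerN2 ler_nat.
set dd := (idx k s)%:R * eta k - (idx k t)%:R * eta k in key.
have ddst : `|dd - (s - t)| <= eta k.
  by rewrite ler_norml /dd; move: it2 it3 is2 is3; lra.
have -> : y s - y t - (s - t) *: g =
    (x k s - x k t - dd *: g) + (y s - x k s) - (y t - x k t) + (dd - (s - t)) *: g.
  have -> : x k s - x k t - dd *: g + (y s - x k s) - (y t - x k t)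
      = y s - y t - dd *: g.
    move: (x k s) (x k t) (y s) (y t) (dd *: g) => A B C D E.
    rewrite (addrC (A - B - E)) -(addrA A) subrKA opprB !addrA.
    by rewrite (addrAC (C - B) (- E) B) subrK addrAC.
  by rewrite (scalerBl dd) addrA subrK.
apply: le_trans (ler_normD _ _) _; apply: le_trans (lerD (ler_normB _ _) (lexx _)) _.
apply: le_trans (lerD (lerD (ler_normD _ _) (lexx _)) (lexx _)) _.
rewrite normrZ.
have B1 : e * `|dd| <= e * `|s - t| + e * eta k.
  rewrite -mulrDr ler_wpM2l ?(ltW e0)// -[dd](subrK (s - t)) (le_trans (ler_normD _
      _))//.
  by rewrite addrC lerD2l.
have B2 : `|dd - (s - t)| * `|g| <= eta k * `|g| by rewrite ler_wpM2r.
have := eta0 k; move: key ks kt' B1 B2 kz3;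
    rewrite mulrDr mulrDr mulr1 [eta k * e]mulrC; lra.
Unshelve. all: by end_near. Qed.

End peano.

Lemma bounded_on_tube {R : realType} {V W : normedModType R} (G : V -> R -> W)
    (t0 T M : R) : compact [set v : V | `|v| <= M] ->
  {within [set z : V * R | t0 <= z.2], continuous (fun z => G z.1 z.2)} ->
  exists2 L, 0 < L & forall w s, `|w| <= M -> t0 <= s <= T -> `|G w s| <= L.
Proof.
move=> Vc Gc.
pose K := [set v : V | `|v| <= M] `*` `[t0, T].
have Kc : compact K by apply: compact_setX; [exact: Vc|exact: segment_compact].
have KG : {within K, continuous (fun z : V * R => G z.1 z.2)}.
  apply: continuous_subspaceW Gc => -[w s] /= [_].
  by rewrite /= in_itv /= => /andP[].
have [L0 [_ HL]] := compact_bounded (continuous_compact KG Kc).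
exists (Num.max 1 (L0 + 1)); first by rewrite lt_max ltr01.
move=> w s wM sT; apply: (HL (Num.max 1 (L0 + 1))).
  by rewrite lt_max ltrDl ltr01 orbT.
by exists (w, s) => //; split => //=; rewrite in_itv.
Qed.

(** * Continuation of a bounded solution past a finite time *)

Section continuation.
Context {R : realType} {V : normedModType R} (G : V -> R -> V).
Hypothesis Vc : forall r : R, compact [set v : V | `|v| <= r].

(** A bounded solution is Lipschitz, hence has a limit [vs] at [T], and continuity of [G] makes
    [G vs T] its left derivative there. This is also the right derivative of a Peano solution
    started from [vs] at time [T], so the glued function is differentiable at [T]. *)
Lemma continue_solution (t0 T M : R) (v : R -> V) : t0 < T ->
  {within [set z : V * R | t0 <= z.2], continuous (fun z => G z.1 z.2)} ->
  (forall t, t0 <= t < T -> has_deriv `[t0, T[ v t (G (v t) t)) ->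
  (forall t, t0 <= t < T -> `|v t| <= M) ->
  exists2 T', T < T' & exists v',
    (forall t, t0 <= t < T -> v' t = v t) /\
    (forall t, t0 <= t < T' -> has_deriv `[t0, T'[ v' t (G (v' t) t)).
Proof.
move=> t0T Gc Hv vM.
have [L L0 HL] := bounded_on_tube T (@Vc M) Gc.
have mvi s r c e : t0 <= s -> s <= r -> r < T ->
    (forall t, s <= t <= r -> `|G (v t) t - c| <= e) ->
    `|v r - v s - (r - s) *: c| <= e * (r - s).
  move=> t0s sr rT H; apply: (mean_value_ineq (v := fun t => G (v t) t)) => // t
      /andP[st tr].
  apply: has_deriv_sub (Hv t _).
    move=> z; rewrite /= !in_itv /= => /andP[sz zr].
    by rewrite (le_trans t0s) ?(le_lt_trans zr).
  by rewrite (le_trans t0s) ?(le_lt_trans tr).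
have lip s r : t0 <= s -> s <= r -> r < T -> `|v r - v s| <= L * (r - s).
  move=> t0s sr rT; have := mvi s r 0 L t0s sr rT; rewrite scaler0 subr0; apply.
  move=> t /andP[st tr]; rewrite subr0.
  have t0t : t0 <= t by exact: le_trans st.
  have tT : t < T by exact: le_lt_trans rT.
  by apply: HL; rewrite ?t0t ?(ltW tT)//; apply: vM; rewrite t0t.
(* Compactness only gives a cluster point; the Lipschitz bound turns it into the limit in [vlim]. *)
have [vs [vsM clu]] : exists vs, `|vs| <= M /\ cluster (v @ T^'-) vs.
  have [|vs [? ?]] := @Vc M (v @ T^'-); last by exists vs.
  rewrite /= /nbhs /=; near=> s => /=; apply: vM; apply/andP; split.
    by near: s; exact: nbhs_left_ge.
  by near: s; exact: nbhs_left_lt.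
have vlim t : t0 <= t < T -> `|v t - vs| <= L * (T - t).
  move=> /andP[t0t tT]; apply/ler_addgt0Pr => z z0.
  have [] := clu (v @` `]t, T[) (ball vs z).
  - rewrite /= /nbhs /=; near=> s; exists s => //=; rewrite in_itv /=; apply/andP;
      split.
      by near: s; exact: nbhs_left_gt.
    by near: s; exact: nbhs_left_lt.
  - exact: nbhsx_ballx.
  move=> _ [[s + <-]]; rewrite /= in_itv /= => /andP[ts sT].
  rewrite -ball_normE /ball_ /= => sz.
  rewrite -[v t - vs](subrKA (v s)) (le_trans (ler_normD _ _))// lerD//.
    rewrite distrC (le_trans (lip t s t0t (ltW ts) sT))// ler_wpM2l ?(ltW L0)//.
    by rewrite lerD2r ltW.
  by rewrite distrC ltW.
have left e : 0 < e -> exists2 dl, 0 < dl & forall s, t0 <= s < T -> T - s < dl ->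
    `|v s - vs - (s - T) *: G vs T| <= e * (T - s).
  move=> e0; have [d1 d10 Hd1] := continuous_at_epsdelta vs Gc (ltW t0T) e0.
  exists (Num.min d1 (d1 / L)); first by rewrite lt_min d10 divr_gt0.
  move=> s /andP[t0s sT]; rewrite lt_min => /andP[sd1 sd2].
  apply/ler_addgt0Pr => z z0; set g := G vs T.
  have C0 : 0 < L + `|g| by rewrite ltr_wpDr.
  (* The value of [v] at [T] is unconstrained, so [s] is compared with [r = T - k]; replacing [r] by
     [T] afterwards costs at most [k * (L + |g|) <= z]. *)
  pose k := Num.min ((T - s) / 2) (z / (L + `|g|)).
  have k0 : 0 < k by rewrite lt_min !divr_gt0// subr_gt0.
  have ks : k <= (T - s) / 2 by rewrite ge_min lexx.
  have kz : k * (L + `|g|) <= z by rewrite -ler_pdivlMr// ge_min lexx orbT.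
  pose r := T - k.
  have sr : s <= r by rewrite /r; move: sT ks; lra.
  have rT : r < T by rewrite /r; lra.
  have H : `|v r - v s - (r - s) *: g| <= e * (r - s).
    apply: mvi => // t /andP[st tr].
    have t0t : t0 <= t by exact: le_trans st.
    have tT : t < T by exact: le_lt_trans rT.
    apply: Hd1 => //.
      apply: le_lt_trans (vlim t _) _; first by rewrite t0t.
      by rewrite mulrC -ltr_pdivlMr//; apply: le_lt_trans sd2; rewrite lerD2l lerN2.
    by rewrite distrC gtr0_norm ?subr_gt0//; apply: le_lt_trans sd1;
        rewrite lerD2l lerN2.
  have H2 : `|v r - vs| <= L * k.
    have Trk : T - r = k by rewrite /r; ring.
    by rewrite -Trk; apply: vlim; rewrite rT (le_trans t0s sr).
  have -> : v s - vs - (s - T) *: g = (v r - vs) - (v r - v s - (r - s) *: g) + k *: g.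
    rewrite (_ : k = (T - s) - (r - s)); last by rewrite /r; ring.
    rewrite (scalerBl (T - s)) -[s - T]opprB scaleNr opprK !opprB.
    move: (v s) (v r) ((T - s) *: g) ((r - s) *: g) => A B C D.
    rewrite (addrC (B - vs)) -(addrA D) subrKA (addrC D) -(addrA (A - vs)).
    by rewrite (addrC D) subrK.
  apply: le_trans (ler_normD _ _) _; apply: le_trans (lerD (ler_normB _ _) (lexx _)) _.
  rewrite normrZ (gtr0_norm k0); move: H H2 kz; rewrite /r.
  have : e * (T - k - s) <= e * (T - s) by rewrite ler_wpM2l ?(ltW e0)//; move: k0; lra.
  lra.
have GcT : {within [set z : V * R | T <= z.2], continuous (fun z => G z.1 z.2)}.
  by apply: continuous_subspaceW Gc => z /=; apply: le_trans; exact: ltW.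
have [h h0 [y yT Hy]] := peano Vc vs GcT.
exists (T + h); first by rewrite ltrDl.
exists (fun t => if t < T then v t else y t); split.
  by move=> t /andP[_ ->].
move=> t /andP[t0t tTh]; apply/has_derivP => e e0.
have [tT|Tt] := ltP t T.
  have /has_derivP /(_ e e0)[dl dl0 H] := Hv t ltac:(by rewrite t0t tT).
  exists (Num.min dl (T - t)); first by rewrite lt_min dl0 subr_gt0.
  move=> s; rewrite /= in_itv /= => /andP[t0s _]; rewrite lt_min => /andP[sd st].
  have sT : s < T by have := ler_norm (s - t); move: st; lra.
  by rewrite sT; apply: H => //; rewrite /= in_itv /= t0s.
have /has_derivP /(_ e e0)[dl dl0 H] := Hy t ltac:(by rewrite Tt ltW).
move: Tt; rewrite le_eqVlt => /predU1P[Te|Tt].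
  rewrite -{t}Te in t0t tTh H *; have [d1 d10 H1] := left e e0.
  exists (Num.min dl d1); first by rewrite lt_min dl0.
  move=> s; rewrite /= in_itv /= => /andP[t0s sTh]; rewrite lt_min => /andP[sd st].
  case: ltP => sT; last by apply: H => //; rewrite /= in_itv /= sT ltW.
  rewrite yT [`|s - T|]distrC [`|T - s|]gtr0_norm ?subr_gt0//; apply: H1;
      first by rewrite t0s.
  by move: st; rewrite distrC gtr0_norm ?subr_gt0.
exists (Num.min dl (t - T)); first by rewrite lt_min dl0 subr_gt0.
move=> s; rewrite /= in_itv /= => /andP[t0s sTh]; rewrite lt_min => /andP[sd st].
have sT : T <= s by have := ler_norm (t - s); move: st; rewrite distrC; lra.
by rewrite ltNge sT /=; apply: H => //; rewrite /= in_itv /= sT ltW.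
Unshelve. all: by end_near. Qed.

End continuation.

(** * Derivatives and quadratic forms of vector functions *)

Section lie_derivatives.
Context {R : realType}.

Lemma lieD {n : nat} {W : normedModType R} (v v' : 'cV[R]_n) (h : 'cV[R]_n -> R ->
    W) x t :
  lie (v + v') h x t = lie v h x t + lie v' h x t.
Proof. by rewrite /lie -big_split; apply: eq_bigr => j _; rewrite !mxE scalerDl. Qed.

Lemma lieZ {n : nat} {W : normedModType R} (a : R) (v : 'cV[R]_n) (h : 'cV[R]_n ->
    R -> W) x t :
  lie (a *: v) h x t = a *: lie v h x t.
Proof. by rewrite /lie scaler_sumr; apply: eq_bigr => j _; rewrite !mxE scalerA. Qed.

Lemma lie1D {q p : nat} {W : normedModType R} (v v' : 'cV[R]_q)
    (h : 'cV[R]_(q + p) -> R -> W) x t :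
  lie1 (v + v') h x t = lie1 v h x t + lie1 v' h x t.
Proof. by rewrite /lie1 -big_split; apply: eq_bigr => j _; rewrite !mxE scalerDl. Qed.

Lemma lie1Z {q p : nat} {W : normedModType R} (a : R) (v : 'cV[R]_q)
    (h : 'cV[R]_(q + p) -> R -> W) x t :
  lie1 (a *: v) h x t = a *: lie1 v h x t.
Proof. by rewrite /lie1 scaler_sumr; apply: eq_bigr => j _; rewrite !mxE scalerA. Qed.

Lemma lie_col_mx {q p : nat} {W : normedModType R} (v : 'cV[R]_q) (v' : 'cV[R]_p)
    (h : 'cV[R]_(q + p) -> R -> W) x t :
  lie (col_mx v v') h x t
    = lie1 v h x t + \sum_(j < p) v' j 0 *: dx h (rshift q j) x t.
Proof.
rewrite /lie big_split_ord /=; congr (_ + _); apply: eq_bigr => j _.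
  by rewrite col_mxEu.
by rewrite col_mxEd.
Qed.

Lemma C1_chain_cV n m (h : 'cV[R]_n -> R -> 'cV[R]_m) (J : set R) (x : R ->
    'cV[R]_n) t v :
  C1 h -> J `<=` Rplus -> 0 <= t -> has_deriv J x t v ->
  has_deriv J (fun s => h (x s) s) t (dt h (x t) t + lie v h (x t) t).
Proof.
move=> hC J0 t0 hx; apply/has_deriv_coord => i.
have [hCi hdx hdt] := C1_coord i hC.
have := C1_chain hCi J0 t0 hx; rewrite hdt//; congr has_deriv.
rewrite mxE /lie summxE; congr (_ + _); apply: eq_bigr => j _.
by rewrite hdx// mxE.
Qed.

Lemma has_deriv_scale n (J : set R) (y : R -> R) (z : R -> 'cV[R]_n) t v w :
  has_deriv J y t v -> has_deriv J z t w ->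
  has_deriv J (fun s => y s *: z s) t (v *: z t + y t *: w).
Proof.
move=> Hy /has_deriv_coord Hz; apply/has_deriv_coord => i.
have := has_derivM Hy (Hz i); rewrite !mxE.
by congr has_deriv; apply/funext => s; rewrite mxE.
Qed.

Lemma has_deriv_mulmx n m (A : 'M[R]_(m, n)) (J : set R) (z : R -> 'cV[R]_n) t w :
  has_deriv J z t w -> has_deriv J (fun s => A *m z s) t (A *m w).
Proof.
move=> /has_deriv_coord Hz; apply/has_deriv_coord => i; rewrite mxE.
rewrite [X in has_deriv J X](_ : _ = fun s => \sum_j A i j * z s j 0).
  by apply: has_deriv_sum => j; exact: (has_derivZ (k := A i j) (Hz j)).
by apply/funext => s; rewrite mxE.
Qed.

Lemma mulmx_norm_le n m (A : 'M[R]_(m, n)) (v : 'cV[R]_n) (B : R) : 0 <= B ->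
    `|v| <= B ->
  `|A *m v| <= (\sum_i \sum_j `|A i j|) * B.
Proof.
move=> B0 vB; have S0 i : 0 <= \sum_j `|A i j| by rewrite sumr_ge0.
apply: cV_norm_le => [|i]; first by rewrite mulr_ge0// sumr_ge0.
rewrite mxE; apply: (le_trans (ler_norm_sum _ _ _)).
apply: (@le_trans _ _ (\sum_j `|A i j| * B)).
  apply: ler_sum => j _; rewrite normrM ler_wpM2l//.
  exact: le_trans (cV_coord_le _ _) vB.
by rewrite -mulr_suml ler_wpM2r// [leRHS](bigD1 i)//= lerDl sumr_ge0.
Qed.

(** A difference quotient of [f] in [y] is one of the joint function along a coordinate of the upper
    block, so joint regularity passes to every slice. *)
Lemma C1_slice n m (f : 'cV[R]_n -> 'cV[R]_m -> R -> R) (b : 'cV[R]_m) :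
  C1 (fun (z : 'cV[R]_(n + m)) t => f (usubmx z) (dsubmx z) t) ->
  C1 (fun y t => f y b t).
Proof.
set H := fun z t => f (usubmx z) (dsubmx z) t; move=> [h1 h2 h3 h4].
have quotient j (y : 'cV[R]_n) t :
    (fun h : R => h^-1 *: (((fun y => f y b t) \o shift y) (h *:
        delta_mx j 0) - f y b t))
    = (fun h : R => h^-1 *: (((fun z => H z t) \o shift (col_mx y b))
         (h *: delta_mx (lshift m j) 0) - H (col_mx y b) t)).
  apply/funext => h; rewrite /H /= col_mxKu col_mxKd.
  have -> : usubmx (h *: delta_mx (lshift m j) 0 + col_mx y b) = h *: delta_mx j 0 + y.
    by apply/colP => i; rewrite mxE mxE col_mxEu !mxE eq_lshift.
  have -> // : dsubmx (h *: delta_mx (lshift m j) 0 + col_mx y b) = b.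
  by apply/colP => i; rewrite mxE mxE col_mxEd !mxE eq_rlshift mulr0 add0r.
have dxE j y t : dx (fun y t => f y b t) j y t = dx H (lshift m j) (col_mx y b) t.
  by rewrite /dx /derive quotient.
have dtE y t : dt (fun y t => f y b t) y t = dt H (col_mx y b) t.
  by rewrite /dt /H col_mxKu col_mxKd.
have idF (y : 'cV[R]_n) (t : R) :
    z @[z --> within [set z : 'cV[R]_n * R | 0 <= z.2] (nbhs (y, t))] --> (y, t).
  exact: cvg_within.
have colc (y : 'cV[R]_n) (t : R) :
    col_mx z.1 b @[z --> within [set z : 'cV[R]_n * R | 0 <= z.2] (nbhs (y,
        t))] --> col_mx y b.
  have yc : z.1 @[z --> within [set z : 'cV[R]_n * R | 0 <= z.2] (nbhs (y, t))] --> y.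
    exact: (cvg_comp idfun fst (idF y t) (cvg_fst (G := nbhs t))).
  by apply: (cvg_col_mx yc); exact: cvg_cst.
have sndc (y : 'cV[R]_n) (t : R) :
    z.2 @[z --> within [set z : 'cV[R]_n * R | 0 <= z.2] (nbhs (y, t))] --> t.
  exact: (cvg_comp idfun snd (idF y t) (cvg_snd (F := nbhs y))).
split.
- by move=> j y t t0; rewrite /derivable quotient; exact: h1.
- move=> y t t0; rewrite dtE; have := h2 (col_mx y b) t t0.
  by rewrite /H /has_deriv col_mxKu col_mxKd.
- move=> j; apply/within2P => y t t0; rewrite dxE; under eq_fun do rewrite dxE.
  apply: (within_cvg2 (k := dx H (lshift m j)) (h3 _) (colc y t) (sndc y t) _ t0).
  by rewrite near_withinE; exact: nearW.
- apply/within2P => y t t0; rewrite dtE; under eq_fun do rewrite dtE.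
  apply: (within_cvg2 (k := dt H) h4 (colc y t) (sndc y t) _ t0).
  by rewrite near_withinE; exact: nearW.
Qed.

Lemma has_deriv_dot n (J : set R) (y z : R -> 'cV[R]_n) t v w :
  has_deriv J y t v -> has_deriv J z t w ->
  has_deriv J (fun s => ((y s)^T *m z s) 0 0) t
    ((v^T *m z t) 0 0 + ((y t)^T *m w) 0 0).
Proof.
move=> /has_deriv_coord Hy /has_deriv_coord Hz.
rewrite !mxE -big_split /=.
rewrite [X in has_deriv J X](_ : _ = fun s => \sum_j y s j 0 * z s j 0); last first.
  by apply/funext => s; rewrite mxE; apply: eq_bigr => j _; rewrite mxE.
apply: has_deriv_sum => j; rewrite !mxE; exact: has_derivM.
Qed.

End lie_derivatives.

(** * The quadratic form of the inverse of a positive definite matrix *)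

Section positive_definite.
Context {R : realType} {d : nat} (Gamma : 'M[R]_d).
Hypothesis Gpos : posdef Gamma.

Lemma posdef_unitmx : Gamma \in unitmx.
Proof.
rewrite unitmxE unitfE; apply/negP => /det0P[v v0 vG].
have := Gpos.2 v^T; rewrite trmxK vG mul0mx mxE ltxx.
suff vT0 : v^T != 0 by move=> /(_ vT0).
by apply: contra v0 => /eqP H; rewrite -[v]trmxK H trmx0.
Qed.

Lemma posdef_inv_sym : (invmx Gamma)^T = invmx Gamma.
Proof. by rewrite trmx_inv Gpos.1. Qed.

Lemma wnorm2_inv_ge0 e : 0 <= wnorm2 (invmx Gamma) e.
Proof.
pose v := invmx Gamma *m e.
have -> : wnorm2 (invmx Gamma) e = (v^T *m Gamma *m v) 0 0.
  by rewrite /wnorm2 /v trmx_mul posdef_inv_sym mulmxA mulmxKV ?posdef_unitmx.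
have [->|v0] := eqVneq v 0; first by rewrite mulmx0 mxE.
exact/ltW/(Gpos.2 v v0).
Qed.

Lemma wnorm2N (M : 'M[R]_d) e : wnorm2 M (- e) = wnorm2 M e.
Proof. by rewrite /wnorm2 [(- e)^T]linearN /= !mulNmx mulmxN opprK. Qed.

(* Cauchy-Schwarz for the scalar product of Gamma^-1 and the vector
   Gamma delta_i, whose squared norm is Gamma_ii. *)
Lemma coord_wnorm2_inv (e : 'cV[R]_d) (i : 'I_d) :
    e i 0 ^+ 2 <= Gamma i i * wnorm2 (invmx Gamma) e.
Proof.
have d0 : (delta_mx i 0 : 'cV[R]_d) != 0.
  apply/eqP => /matrixP /(_ i 0); rewrite !mxE !eqxx => /eqP; exact/negP/oner_neq0.
have Gii : 0 < Gamma i i.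
  have := Gpos.2 _ d0; rewrite trmx_delta -rowE -colE !mxE; exact.
(* This [s] minimises the quadratic polynomial that the form becomes along the line
   [e - s Gamma delta_i]. *)
pose s := e i 0 / Gamma i i.
have := wnorm2_inv_ge0 (e - s *: (Gamma *m delta_mx i 0)).
have -> : wnorm2 (invmx Gamma) (e - s *: (Gamma *m delta_mx i 0)) =
  wnorm2 (invmx Gamma) e - 2 * s * e i 0 + s ^+ 2 * Gamma i i.
  rewrite /wnorm2 [(e - _)^T]linearB /= [(s *:
      _)^T]linearZ /= trmx_mul Gpos.1 trmx_delta.
  rewrite mulmxBr !mulmxBl -!scalemxAr -!scalemxAl.
  rewrite !mulmxA mulmxK ?posdef_unitmx// mulmxKV ?posdef_unitmx//.
  rewrite -rowE -rowE -colE -colE !mxE expr2; ring.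
rewrite /s.
have -> : wnorm2 (invmx Gamma) e - 2 * (e i 0 / Gamma i i) * e i 0 +
  (e i 0 / Gamma i i) ^+ 2 * Gamma i i = wnorm2 (invmx Gamma) e - e i 0 ^+ 2 / Gamma i
      i.
  by field; rewrite gt_eqF.
by rewrite subr_ge0 ler_pdivrMr// mulrC.
Qed.

End positive_definite.

(** * Dynamics of the closed loop *)

Section limits.
Context {R : realType} {T : Type} (F : set_system T) {FF : Filter F}.

Lemma cvg_bigsum {W : normedModType R} n (f : 'I_n -> T -> W) (l : 'I_n -> W) :
  (forall i, f i @ F --> l i) ->
  (\sum_(i < n) f i z) @[z --> F] --> \sum_(i < n) l i.
Proof. by move=> H; apply: cvg_big => //; exact: add_continuous. Qed.

Lemma cvg_mulmx n m (A : 'M[R]_(m, n)) (f : T -> 'cV[R]_n) (l : 'cV[R]_n) :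
  f @ F --> l -> (A *m f z) @[z --> F] --> A *m l.
Proof.
move=> /cvg_coord H; apply: cvg_cV => i; rewrite mxE.
under eq_fun do rewrite mxE.
by apply: cvg_bigsum => j; apply: cvgM; [exact: cvg_cst|exact: H].
Qed.

Lemma cvg_dot n (f g : T -> 'cV[R]_n) (l k : 'cV[R]_n) :
  f @ F --> l -> g @ F --> k ->
  ((f z)^T *m g z) 0 0 @[z --> F] --> (l^T *m k) 0 0.
Proof.
move=> /cvg_coord Hf /cvg_coord Hg; rewrite mxE.
under eq_fun do rewrite mxE.
apply: cvg_bigsum => j; rewrite mxE; under eq_fun do rewrite mxE.
by apply: cvgM; [exact: Hf|exact: Hg].
Qed.

Context (tf : T -> R) (t : R) (tft : tf @ F --> t)
  (tf0 : \forall z \near F, 0 <= tf z) (t0 : 0 <= t).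

Section state.
Context {n : nat} (yf : T -> 'cV[R]_n) (y : 'cV[R]_n) (yfy : yf @ F --> y).

Lemma C1_cvg_cV m (h : 'cV[R]_n -> R -> 'cV[R]_m) : C1 h ->
  h (yf z) (tf z) @[z --> F] --> h y t.
Proof.
move=> hC; apply: cvg_cV => i; have [hCi _ _] := C1_coord i hC.
exact: (C1_cvg hCi).
Qed.

Lemma dt_cvg {W : normedModType R} (h : 'cV[R]_n -> R -> W) : C1 h ->
  dt h (yf z) (tf z) @[z --> F] --> dt h y t.
Proof. by case=> _ _ _ hc; apply: (within_cvg2 (k := dt h)). Qed.

Lemma lie_cvg {W : normedModType R} (h : 'cV[R]_n -> R -> W)
    (vf : T -> 'cV[R]_n) (v : 'cV[R]_n) : C1 h ->
  vf @ F --> v -> lie (vf z) h (yf z) (tf z) @[z --> F] --> lie v h y t.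
Proof.
case=> _ _ hc _ /cvg_coord vfv; apply: cvg_bigsum => j; apply: cvgZ; first exact: vfv.
exact: (within_cvg2 (k := dx h j)).
Qed.

End state.

Lemma lie1_cvg {q p : nat} {W : normedModType R} (h : 'cV[R]_(q + p) -> R -> W)
    (yf : T -> 'cV[R]_(q + p)) (y : 'cV[R]_(q + p))
    (vf : T -> 'cV[R]_q) (v : 'cV[R]_q) : C1 h -> yf @ F --> y ->
  vf @ F --> v -> lie1 (vf z) h (yf z) (tf z) @[z --> F] --> lie1 v h y t.
Proof.
case=> _ _ hc _ yfy /cvg_coord vfv; apply: cvg_bigsum => j; apply: cvgZ;
    first exact: vfv.
exact: (within_cvg2 (k := dx h (lshift p j))).
Qed.

End limits.

(** * Time intervals, half-open and closed *)

Section half_open_intervals.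
Context {R : realType}.

Lemma rointE (a b : R) : roint a b%:E = `[a, b[%classic.
Proof.
apply/seteqP; split=> t; rewrite /roint /= in_itv /= lte_fin; first by move=> [-> ->].
by move=> /andP[].
Qed.

Lemma cintE (a b : R) : cint a b%:E = `[a, b]%classic.
Proof.
apply/seteqP; split=> t; rewrite /cint /= in_itv /= lee_fin; first by move=> [-> ->].
by move=> /andP[].
Qed.

(** Serves twice: points to the right make derivatives relative to the interval unique, and a claim
    at time [t], even at the initial time, reduces to a nondegenerate segment that ends after
    [t]. *)
Lemma roint_right_point (a t e : R) (T : \bar R) : roint a T t -> 0 < e ->
  exists2 s, roint a T s & t < s < t + e.
Proof.
rewrite /roint /=; case: T => [T| |] [at0] // tT e0; last first.
  exists (t + e / 2); last by lra.
  by split; [lra|rewrite ltry].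
move: tT; rewrite lte_fin => tT.
pose m := Num.min e (T - t).
have m0 : 0 < m by rewrite lt_min e0 subr_gt0.
have me : m <= e by rewrite ge_min lexx.
have mT : m <= T - t by rewrite ge_min lexx orbT.
exists (t + m / 2); last by lra.
by rewrite lte_fin; split; lra.
Qed.

Lemma roint_Rplus (a : R) T : 0 <= a -> roint a T `<=` Rplus.
Proof. by move=> a0 t [at0 _]; exact: le_trans at0. Qed.

Lemma cint_roint (a b : R) T : (b%:E < T)%E -> `[a, b]%classic `<=` roint a T.
Proof.
move=> bT t; rewrite /= in_itv /= => /andP[at0 tb]; split=> //.
by apply: le_lt_trans bT; rewrite lee_fin.
Qed.

Lemma cvg_near_ge0 (J : set R) (t : R) : J `<=` Rplus ->
  \forall s \near within J (nbhs t), 0 <= s.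
Proof. by move=> J0; rewrite near_withinE; apply: nearW => s /J0. Qed.

Lemma cvg_within_id (J : set R) (t : R) : s @[s --> within J (nbhs t)] --> t.
Proof. by apply: cvg_within. Qed.

End half_open_intervals.

Lemma compact_cV_ball (R : realType) n (r : R) : compact [set v : 'cV[R]_n | `|v| <= r].
Proof.
have c : compact [set v : 'rV[R]_n | forall i, `[- r, r]%classic (v ord0 i)].
  by apply: (@rV_compact _ _ (fun=> `[- r, r]%classic)) => i; exact: segment_compact.
have tc : {within [set v : 'rV[R]_n | forall i, `[- r, r]%classic (v ord0 i)],
    continuous (fun v : 'rV[R]_n => v^T)}.
  apply: continuous_subspaceT => v.
  apply: (@cvg_cV _ _ _ (nbhs v) (nbhs_filter v)) => i.
  under eq_fun do rewrite mxE; rewrite mxE; exact: coord_continuous.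
have [r0|r0] := leP 0 r; last first.
  rewrite (_ : [set _ | _] = set0); first exact: compact0.
  apply/seteqP; split=> // v /= vr; have := le_lt_trans vr r0.
  by rewrite ltNge normr_ge0.
have := continuous_compact tc c; congr compact.
apply/seteqP; split=> [_ [v H <-]|v H] /=.
  apply: cV_norm_le => // i; have := H i.
  by rewrite /= in_itv /= mxE ler_norml.
exists v^T; last by rewrite trmxK.
by move=> i; rewrite /= in_itv /= mxE -ler_norml (le_trans (cV_coord_le v i)).
Qed.

Section closed_loop_dynamics.
Context {R : realType} {q p d w : nat} (P : plant R q p d).
Context (psi : 'cV[R]_(q + p) -> R -> R) (phi : R -> 'cV[R]_w -> R -> R)
  (alpha Psi : 'cV[R]_(q + p) -> R -> 'cV[R]_d) (Gamma : 'M[R]_d).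
Context (eps : R -> R) (th : 'cV[R]_d) (om : 'cV[R]_w).
Hypothesis Preg : plant_regular P.
Hypothesis psiC : C1 psi.
Hypothesis Lg0 : forall y t, 0 <= t -> lie (vg P y) psi y t != 0.
Hypothesis alphaC : C1 alpha.
Hypothesis PsiC : C1 Psi.
Hypothesis dx2 : forall (j : 'I_p) y t, 0 <= t ->
  dx Psi (rshift q j) y t - psi y t *: dx alpha (rshift q j) y t = 0.

(** The control law with [eps] added in its numerator. The argument [b] is the integral part of the
    estimate, not the estimate itself, so that the law is a function of the state [(y, b)] and of
    time. *)
Definition feedback (y : 'cV[R]_(q + p)) (b : 'cV[R]_d) (t : R) : R :=
  (- fpsi P psi y (thetahat psi alpha Psi Gamma y b t) t - phi (psi y t) om t
   + eps t - dt psi y t) / lie (vg P y) psi y t.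

Lemma plant_field y (v : R) :
  col_mx (f1 P y + v *: g1 P y) (f2 P y th + v *: g2 P y)
    = vf P y th + v *: vg P y.
Proof. by rewrite /vf /vg scale_col_mx add_col_mx. Qed.

Lemma psi_deriv (J : set R) x (v : R) t : J `<=` Rplus -> J t ->
  has_deriv J x t (vf P (x t) th + v *: vg P (x t)) ->
  has_deriv J (fun s => psi (x s) s) t
    (dt psi (x t) t + fpsi P psi (x t) th t + v * lie (vg P (x t)) psi (x t) t).
Proof.
move=> J0 Jt Hx; have := C1_chain psiC J0 (J0 _ Jt) Hx.
by rewrite lieD lieZ addrA.
Qed.

Lemma error_equation_feedback (J : set R) x b t : J `<=` Rplus -> J t ->
  has_deriv J x t (vf P (x t) th + feedback (x t) b t *: vg P (x t)) ->
  has_deriv J (fun s => psi (x s) s) t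
   (fpsi P psi (x t) th t - fpsi P psi (x t) (thetahat psi alpha Psi Gamma (x t) b t) t
    - phi (psi (x t) t) om t + eps t).
Proof.
move=> J0 Jt /(psi_deriv J0 Jt); congr has_deriv.
by rewrite /feedback divfK ?Lg0 ?J0//; ring.
Qed.

Section trajectory.
Context (t0 : R) (T : \bar R) (x : R -> 'cV[R]_(q + p)) (thI : R -> 'cV[R]_d)
  (u : R -> R).
Hypothesis t00 : 0 <= t0.
Let J := roint t0 T.
Hypothesis cl : closed_loop P psi phi alpha Psi Gamma om eps th J x thI u.
Let thh t := thetahat psi alpha Psi Gamma (x t) (thI t) t.
Let F t := fpsi P psi (x t) th t - fpsi P psi (x t) (thh t) t.

Let J0 : J `<=` Rplus := roint_Rplus t00.

Lemma closed_loop_state t : J t ->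
  has_deriv J x t (vf P (x t) th + u t *: vg P (x t)).
Proof. by move=> Jt; case: cl => /(_ t Jt) + _ _; rewrite plant_field. Qed.

(** The chain rule and the error equation give two derivatives of [psi] along the solution. They
    agree by uniqueness, and the nonzero factor [L_g psi] of [u] can be cancelled. *)
Lemma closed_loop_input t : J t -> u t = feedback (x t) (thI t) t.
Proof.
move=> Jt; have H1 := psi_deriv J0 Jt (closed_loop_state Jt).
have [_ /(_ t Jt) H2 _] := cl.
have E : forall e, 0 < e -> exists2 s, J s & t < s < t + e.
  by move=> e; exact: roint_right_point.
have := has_deriv_unique E H1 H2; rewrite -/(thh t) => H.
apply: (mulIf (Lg0 (x t) (J0 Jt))).
rewrite /feedback divfK ?Lg0 ?J0// -/(thh t).
by move: H; lra.
Qed.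

Lemma thetahat_deriv t : J t ->
  has_deriv J thh t (Gamma *m ((F t + eps t) *: alpha (x t) t)).
Proof.
move=> Jt; have t_ge0 : 0 <= t := J0 Jt.
have Hx := closed_loop_state Jt.
have [_ /(_ t Jt) Hpsi /(_ t Jt) HI] := cl.
have Ha := C1_chain_cV alphaC J0 t_ge0 Hx.
have HP := C1_chain_cV PsiC J0 t_ge0 Hx.
apply: has_deriv_mulmx.
have := has_derivD (has_derivB (has_deriv_scale Hpsi Ha) HP) HI.
congr has_deriv; rewrite -/(thh t) -plant_field !lie_col_mx.
(* Condition (iii) contracted with the velocity of the second block, the only block of the velocity
   that contains [th]. The contributions of the first block and of time are those that [Rterm]
   removes. *)
have B : psi (x t) t *: (\sum_(j < p) (f2 P (x t) th + u t *: g2 P (x t)) j 0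
      *: dx alpha (rshift q j) (x t) t)
    = \sum_(j < p) (f2 P (x t) th + u t *: g2 P (x t)) j 0
      *: dx Psi (rshift q j) (x t) t.
  rewrite scaler_sumr; apply: eq_bigr => j _.
  by rewrite scalerA mulrC -scalerA; congr (_ *: _); apply/esym/subr0_eq/dx2.
rewrite !addrA scalerDr B {B} /Rterm !lie1D !lie1Z.
set S := \sum_(_ < _) _.
by apply/colP => i; rewrite !mxE -/(F t); rewrite /F; ring.
Qed.

End trajectory.

Section continuity.
Context {X : Type} (Fi : set_system X) {FF : Filter Fi}.
Context (tf : X -> R) (t : R) (tft : tf @ Fi --> t)
  (tf0 : \forall z \near Fi, 0 <= tf z) (t_ge0 : 0 <= t).
Context (yf : X -> 'cV[R]_(q + p)) (y : 'cV[R]_(q + p)) (yfy : yf @ Fi --> y).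
Context (bf : X -> 'cV[R]_d) (b : 'cV[R]_d) (bfb : bf @ Fi --> b).

Lemma vg_cvg : vg P (yf z) @[z --> Fi] --> vg P y.
Proof.
case: Preg => _ _ [g1c _] [g2c _].
by apply: cvg_col_mx; [apply: cvg_comp yfy _; exact: g1c|apply: cvg_comp yfy _;
    exact: g2c].
Qed.

Lemma vf_cvg : vf P (yf z) (bf z) @[z --> Fi] --> vf P y b.
Proof.
case: Preg => [[f1c _]] [f2c _] _ _.
apply: cvg_col_mx; first by apply: cvg_comp yfy _; exact: f1c.
have := cvg_pair yfy bfb => H.
apply: (@cvg_comp _ _ _ (fun z => (yf z, bf z)) (fun z => f2 P z.1 z.2) _ (nbhs (y,
    b))).
  exact: H.
exact: (f2c (y, b)).
Qed.

Lemma fpsi_cvg : fpsi P psi (yf z) (bf z) (tf z) @[z --> Fi] --> fpsi P psi y b t.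
Proof. exact: (lie_cvg tft tf0 t_ge0 yfy psiC vf_cvg). Qed.

Lemma thetahat_cvg : thetahat psi alpha Psi Gamma (yf z) (bf z) (tf z) @[z --> Fi]
  --> thetahat psi alpha Psi Gamma y b t.
Proof.
apply: cvg_mulmx; apply: cvgD => //; apply: cvgB.
  by apply: cvgZ; [exact: (C1_cvg psiC)|exact: (C1_cvg_cV tft tf0 t_ge0 yfy alphaC)].
exact: (C1_cvg_cV tft tf0 t_ge0 yfy PsiC).
Qed.

End continuity.

(** Right-hand side of the loop after elimination of the input, as a field on pairs [(x, thI)]: the
    proportional part of the estimate is a function of [x] and time and adds no state. *)
Definition loop_field (z : 'cV[R]_(q + p) * 'cV[R]_d) (t : R) :
    'cV[R]_(q + p) * 'cV[R]_d :=
  let u := feedback z.1 z.2 t in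
  (vf P z.1 th + u *: vg P z.1,
   phi (psi z.1 t) om t *: alpha z.1 t + Rterm P psi alpha Psi z.1 u t).

Lemma loop_field_continuous :
  {within Rplus, continuous eps} ->
  {within [set z : R * R | 0 <= z.2], continuous (fun z => phi z.1 om z.2)} ->
  {within [set z : ('cV[R]_(q + p) * 'cV[R]_d) * R | 0 <= z.2],
    continuous (fun z => loop_field z.1 z.2)}.
Proof.
move=> epsc phic; apply/within2P => -[y b] t t_ge0.
set Fi := within _ _.
have FF : Filter Fi by exact: within_filter.
have idF : z @[z --> Fi] --> (y, b, t) by exact: cvg_within.
have tft : z.2 @[z --> Fi] --> t.
  exact: (cvg_comp idfun snd idF (cvg_snd (F := nbhs (y, b)))).
have H1 : z.1 @[z --> Fi] --> (y, b).
  exact: (cvg_comp idfun fst idF (cvg_fst (G := nbhs t))).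
have yfy : z.1.1 @[z --> Fi] --> y.
  exact: (cvg_comp fst fst H1 (cvg_fst (G := nbhs b))).
have bfb : z.1.2 @[z --> Fi] --> b.
  exact: (cvg_comp fst snd H1 (cvg_snd (F := nbhs y))).
have tf0 : \forall z \near Fi, 0 <= z.2 by rewrite near_withinE; exact: nearW.
have psif : psi z.1.1 z.2 @[z --> Fi] --> psi y t by exact: (C1_cvg psiC).
have phif : phi (psi z.1.1 z.2) om z.2 @[z --> Fi] --> phi (psi y t) om t.
  exact: (within_cvg2 (k := fun a s => phi a om s)).
have epsf : eps z.2 @[z --> Fi] --> eps t.
  have /subspace_continuousP /(_ t t_ge0) H := epsc.
  apply/cvgrPdist_le => e e0; have /cvgrPdist_le /(_ e e0) := H.
  rewrite /within /= => /nbhs_normP[dl /= dl0 {}H].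
  move/cvgrPdist_lt : tft => /(_ dl dl0) Ht; near=> z.
  by apply: H; near: z.
have af := C1_cvg_cV tft tf0 t_ge0 yfy alphaC.
have uf : feedback z.1.1 z.1.2 z.2 @[z --> Fi] --> feedback y b t.
  apply: cvgM; last first.
    apply: cvgV; first exact: Lg0.
    exact: (lie_cvg tft tf0 t_ge0 yfy psiC (vg_cvg yfy)).
  apply: cvgB; last exact: (dt_cvg tft tf0 t_ge0 yfy psiC).
  apply: cvgD => //; apply: cvgB => //; apply: cvgN.
  exact: (fpsi_cvg tft tf0 t_ge0 yfy (thetahat_cvg tft tf0 t_ge0 yfy bfb)).
have f1f : f1 P z.1.1 @[z --> Fi] --> f1 P y.
  by case: Preg => -[f1c _] _ _ _; apply: cvg_comp yfy _; exact: f1c.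
have g1f : g1 P z.1.1 @[z --> Fi] --> g1 P y.
  by case: Preg => _ _ [g1c _] _; apply: cvg_comp yfy _; exact: g1c.
have H1' : (vf P z.1.1 th + feedback z.1.1 z.1.2 z.2 *: vg P z.1.1) @[z --> Fi]
    --> vf P y th + feedback y b t *: vg P y.
  apply: cvgD; first by apply: (vf_cvg yfy); exact: cvg_cst.
  by apply: cvgZ => //; exact: vg_cvg.
have H2' : (phi (psi z.1.1 z.2) om z.2 *: alpha z.1.1 z.2
      + Rterm P psi alpha Psi z.1.1 (feedback z.1.1 z.1.2 z.2) z.2) @[z --> Fi]
    --> phi (psi y t) om t *: alpha y t + Rterm P psi alpha Psi y (feedback y b t) t.
  apply: cvgD; first by apply: cvgZ; [exact: phif|exact: af].
  apply: cvgB.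
    apply: cvgD; last exact: (lie1_cvg tft tf0 t_ge0 PsiC yfy f1f).
    apply: cvgB; first exact: (dt_cvg tft tf0 t_ge0 yfy PsiC).
    apply: cvgZ => //; apply: cvgD; first exact: (dt_cvg tft tf0 t_ge0 yfy alphaC).
    exact: (lie1_cvg tft tf0 t_ge0 alphaC yfy f1f).
  apply: cvgZ => //; apply: cvgB.
    by apply: cvgZ => //; exact: (lie1_cvg tft tf0 t_ge0 alphaC yfy g1f).
  exact: (lie1_cvg tft tf0 t_ge0 PsiC yfy g1f).
exact: cvg_pair H1' H2'.
Unshelve. all: by end_near. Qed.

Lemma has_deriv_pair {V W : normedModType R} (J : set R) (y : R -> V) (z : R ->
    W) t v v' :
  has_deriv J (fun s => (y s, z s)) t (v,
      v') <-> has_deriv J y t v /\ has_deriv J z t v'.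
Proof.
split=> [H|[H1 H2]].
  split.
    exact: (cvg_comp _ fst H (cvg_fst (G := nbhs v'))).
  exact: (cvg_comp _ snd H (cvg_snd (F := nbhs v))).
exact: (cvg_pair H1 H2).
Qed.

Lemma closed_loop_fieldP (t0 : R) (T : \bar R) x thI u : 0 <= t0 ->
  closed_loop P psi phi alpha Psi Gamma om eps th (roint t0 T) x thI u ->
  forall t, roint t0 T t ->
    has_deriv (roint t0 T) (fun s => (x s, thI s)) t (loop_field (x t, thI t) t).
Proof.
move=> t00 cl t Jt; have ut := closed_loop_input t00 cl Jt.
apply/has_deriv_pair; rewrite /= -ut; split; first exact: closed_loop_state cl t Jt.
by have [_ _ /(_ t Jt)] := cl.
Qed.

(** Needed for continued solutions, which are only known to follow the field: the feedback then
    enforces the error equation. *)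
Lemma field_closed_loop (t0 : R) (T : \bar R) (z : R -> 'cV[R]_(q + p) * 'cV[R]_d) :
  0 <= t0 ->
  (forall t, roint t0 T t -> has_deriv (roint t0 T) z t (loop_field (z t) t)) ->
  closed_loop P psi phi alpha Psi Gamma om eps th (roint t0 T)
    (fun t => (z t).1) (fun t => (z t).2) (fun t => feedback (z t).1 (z t).2 t).
Proof.
move=> t00 H.
have {}H t : roint t0 T t -> has_deriv (roint t0 T) (fun s => (z s).1) t (loop_field (z
    t) t).1
   /\ has_deriv (roint t0 T) (fun s => (z s).2) t (loop_field (z t) t).2.
  move=> Jt; apply/has_deriv_pair; have := H t Jt; rewrite -surjective_pairing.
  by congr has_deriv; apply/funext => s; rewrite -surjective_pairing.
split=> t Jt; have [H1 H2] := H t Jt => //.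
  by rewrite plant_field.
by apply: error_equation_feedback => //; exact: roint_Rplus.
Qed.

Lemma compact_pair_ball (r : R) :
  compact [set v : 'cV[R]_(q + p) * 'cV[R]_d | `|v| <= r].
Proof.
have := compact_setX (@compact_cV_ball R (q + p) r) (@compact_cV_ball R d r);
    congr compact.
apply/seteqP; split=> -[y b] /=; rewrite /Num.norm /= ge_max; first by case=> -> ->.
by move=> /andP[].
Qed.

Lemma continue_closed_loop (t0 T M : R) x thI u : 0 <= t0 -> t0 < T ->
  {within Rplus, continuous eps} ->
  {within [set z : R * R | 0 <= z.2], continuous (fun z => phi z.1 om z.2)} ->
  (forall t, t0 <= t < T -> `|x t| <= M) -> (forall t, t0 <= t < T -> `|thI t| <= M) ->
  ~ maximal_closed_loop P psi phi alpha Psi Gamma om eps th t0 T%:E x thI u.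
Proof.
move=> t00 t0T epsc phic xM IM [_ cl]; apply.
have Gc : {within [set z : ('cV[R]_(q + p) * 'cV[R]_d) * R | t0 <= z.2],
    continuous (fun z => loop_field z.1 z.2)}.
  apply: continuous_subspaceW (loop_field_continuous epsc phic) => z /=.
  exact: le_trans.
have vM t : t0 <= t < T -> `|(x t, thI t)| <= M.
  by move=> tT; rewrite /Num.norm /= ge_max xM ?IM.
have Hv t : t0 <= t < T ->
    has_deriv `[t0, T[ (fun s => (x s, thI s)) t (loop_field (x t, thI t) t).
  move=> tT; rewrite -rointE; apply: (closed_loop_fieldP t00 cl).
  by rewrite rointE /= in_itv.
have [T' TT' [v' [v'E Hv']]] := continue_solution compact_pair_ball t0T Gc Hv vM.
exists T'%:E, (fun t => (v' t).1), (fun t => (v' t).2),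
  (fun t => feedback (v' t).1 (v' t).2 t); split.
- by rewrite lte_fin.
- apply: field_closed_loop => // t; rewrite rointE /= in_itv /= => tT'.
  exact: Hv'.
- by move=> t; rewrite rointE /= in_itv /= => /v'E ->.
Qed.

End closed_loop_dynamics.

(** * Integrals and Lp norms *)

Section integrals.
Context {R : realType}.
Let mu := @lebesgue_measure R.

Lemma integrable_segment (a b : R) (g : R -> R) : {within `[a, b], continuous g} ->
  mu.-integrable `[a, b] (EFin \o g).
Proof. by move=> gc; apply: continuous_compact_integrable => //;
    exact: segment_compact. Qed.

(** Inside the segment the relative derivative is the ordinary one; at the end points continuity of
    [y] is enough for the fundamental theorem. *)
Lemma FTC_has_deriv (a b : R) (y g : R -> R) : a < b ->
  (forall t, a <= t <= b -> has_deriv `[a, b] y t (g t)) ->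
  {within `[a, b], continuous g} ->
  \int[mu]_(s in `[a, b]) g s = y b - y a.
Proof.
move=> ab Hy gc; rewrite /Rintegral.
have yd t : a < t < b -> (fun h => h^-1 *: (y (h *: 1 + t) - y t)) @ 0^' --> g t.
  move=> /andP[at0 tb]; apply/cvgrPdist_le => e e0.
  have /has_derivP /(_ e e0)[dl dl0 H] := Hy t ltac:(by rewrite !ltW).
  rewrite /dnbhs /within /=; apply/nbhs_normP.
  exists (Num.min dl (Num.min (t - a) (b - t))).
    by rewrite /= !lt_min dl0 !subr_gt0 at0.
  move=> h; rewrite /ball_ /= sub0r normrN !lt_min => /and3P[h1 h2 h3] h0.
  have ht : h *: 1 + t - t = h by rewrite addrK [h *: _]mulr1.
  have := H (h *: 1 + t); rewrite ht => /(_ _ h1).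
  rewrite /= in_itv /= [h *: 1]mulr1.
  have -> : (a <= h + t <= b).
    by have := ler_norm h; have := ler_norm (- h); rewrite normrN; move: h2 h3; lra.
  move=> /(_ isT) {}H.
  have n0 : 0 < `|h| by rewrite normr_gt0.
  rewrite -(ler_pM2r n0) -normrM mulrBl -[_^-1 *: _]/(_^-1 * _).
  by rewrite [h^-1 * _ * _]mulrAC mulVf// mul1r distrC [g t * h]mulrC.
have yc : {within `[a, b], continuous y}.
  by apply: has_deriv_within_continuous => t; rewrite /= in_itv => tab; exact: Hy.
have [_ ya yb] := (continuous_within_itvP _ ab).1 yc.
rewrite (@continuous_FTC2 _ g y a b) //.
  split=> // t; rewrite in_itv /= => tab; apply/cvg_ex; exists (g t); exact: yd.
move=> t; rewrite in_itv /= => tab; rewrite derive1E.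
by have ytab := yd t tab; exact: cvg_lim.
Qed.

Lemma LpN_powE (r : R) (J : set R) (h : R -> R) : 0 < r ->
  (LpN r%:E J h = (\int[mu]_(t in J) (`|h t| `^ r)%:E) `^ r^-1)%E.
Proof.
move=> r0; rewrite /LpN unlock; congr (_ `^ _)%E.
rewrite [RHS]integral_mkcond; apply: eq_integral => t _.
rewrite /patch; case: ifP => _; rewrite ?abse_EFin poweR_EFin //.
by rewrite normr0 powR0 ?gt_eqF.
Qed.

Lemma measurable_powR_norm (r : R) (J : set R) (h : R -> R) :
  measurable_fun J h -> measurable_fun J (EFin \o (fun t => `|h t| `^ r)).
Proof.
move=> mh; apply/measurable_EFinP.
apply: (@measurableT_comp _ _ _ _ _ _ (@powR R ^~ r)) => //.
exact: measurableT_comp.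
Qed.

Lemma LpN_ge0 (r : \bar R) (J : set R) (h : R -> R) : (0 <= LpN r J h)%E.
Proof. exact: Lnorm_ge0. Qed.

Lemma le_LpN (r : R) (J J' : set R) (h : R -> R) : 0 < r ->
  measurable J -> measurable J' -> measurable_fun J' h -> J `<=` J' ->
  (LpN r%:E J h <= LpN r%:E J' h)%E.
Proof.
move=> r0 mJ mJ' mh JJ'; rewrite !LpN_powE//; apply: gt0_ler_poweR.
- by rewrite invr_ge0 ltW.
- by rewrite in_itv /= leey andbT; apply: integral_ge0 => t _; rewrite lee_fin powR_ge0.
- by rewrite in_itv /= leey andbT; apply: integral_ge0 => t _; rewrite lee_fin powR_ge0.
apply: ge0_subset_integral => //; first exact: measurable_powR_norm.
Qed.

Lemma integral_le_LpN (r : R) (J : set R) (h : R -> R) (a b : R) : 0 < r ->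
  measurable J -> measurable_fun J h -> `[a, b] `<=` J ->
  (LpN r%:E J h < +oo)%E ->
  (\int[mu]_(t in `[a, b]) (`|h t| `^ r)%:E <= ((fine (LpN r%:E J h)) `^ r)%:E)%E.
Proof.
move=> r0 mJ mh abJ hoo.
rewrite -poweR_EFin fineK; last by rewrite ge0_fin_numE// LpN_ge0.
rewrite LpN_powE// -poweRrM mulVf ?gt_eqF// poweRe1; last first.
  by apply: integral_ge0 => t _; rewrite lee_fin powR_ge0.
apply: ge0_subset_integral => //; first exact: measurable_powR_norm.
Qed.

Lemma within_continuousM (A : set R) (g h : R -> R) :
  {within A, continuous g} -> {within A, continuous h} ->
  {within A, continuous (fun t => g t * h t)}.
Proof.
move=> /subspace_continuousP gc /subspace_continuousP hc.
apply/subspace_continuousP => t At.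
by apply: cvgM; [exact: gc|exact: hc].
Qed.

Lemma within_continuousD (A : set R) (g h : R -> R) :
  {within A, continuous g} -> {within A, continuous h} ->
  {within A, continuous (fun t => g t + h t)}.
Proof.
move=> /subspace_continuousP gc /subspace_continuousP hc.
apply/subspace_continuousP => t At.
by apply: cvgD; [exact: gc|exact: hc].
Qed.

Lemma within_continuous_cst (A : set R) (k : R) : {within A, continuous (fun=> k)}.
Proof. by apply/subspace_continuousP => t At; exact: cvg_cst. Qed.

(** The energy estimates are linear in this real number; [EFin_sqint] and [LpN2_segment] translate
    it into the extended-real 2-norm. *)
Definition sqint (a b : R) (h : R -> R) : R := \int[mu]_(t in `[a, b]) (h t * h t).

Lemma sqint_ge0 a b h : 0 <= sqint a b h.
Proof. by apply: Rintegral_ge0 => t _; rewrite -expr2 sqr_ge0. Qed.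

Lemma EFin_sqint a b h : {within `[a, b], continuous h} ->
  (sqint a b h)%:E = (\int[mu]_(t in `[a, b]) (`|h t| `^ 2)%:E)%E.
Proof.
move=> hc; rewrite /sqint /Rintegral fineK.
  by apply: eq_integral => t _; rewrite powR_mulrn// expr2 -normrM ger0_norm// -expr2
      sqr_ge0.
apply: integrable_fin_num => //; apply: integrable_segment; exact: within_continuousM.
Qed.

Lemma LpN2_segment a b h : {within `[a, b], continuous h} ->
  LpN 2%:E `[a, b] h = (Num.sqrt (sqint a b h))%:E.
Proof.
by move=> hc; rewrite LpN_powE// -EFin_sqint// poweR_EFin powR12_sqrt// sqint_ge0.
Qed.

Lemma sqint_le_LpN (J : set R) (h : R -> R) (a b : R) :
  measurable J -> measurable_fun J h -> {within `[a, b], continuous h} ->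
      `[a, b] `<=` J ->
  (LpN 2%:E J h < +oo)%E -> sqint a b h <= (fine (LpN 2%:E J h)) ^+ 2.
Proof.
move=> mJ mh hc abJ hoo; rewrite -lee_fin EFin_sqint// -powR_mulrn; last first.
  by rewrite fine_ge0// LpN_ge0.
exact: integral_le_LpN.
Qed.

Lemma roint_exhaustion (t0 : R) (T : \bar R) : (t0%:E < T)%E ->
  exists b : nat -> R, [/\ {homo b : m n / (m <= n)%N >-> m <= n},
    forall n, t0 < b n /\ ((b n)%:E < T)%E &
    roint t0 T = \bigcup_n `[t0, b n]%classic].
Proof.
case: T => [T| |] // t0T; last first.
  exists (fun n => t0 + n.+1%:R); split.
  - by move=> m n mn; rewrite lerD2l ler_nat.
  - by move=> n; rewrite ltrDl ltr0n ltry.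
  apply/seteqP; split=> t; last first.
    by move=> [n _] /=; rewrite in_itv /= /roint /= => /andP[-> _]; rewrite ltry.
  move=> [/= t0t _]; exists (Num.truncn (t - t0)) => //=; rewrite in_itv /= t0t /=.
  by rewrite -lerBlDl ltW// truncnS_gt.
rewrite lte_fin in t0T; have d0 : 0 < T - t0 by rewrite subr_gt0.
(* With [n + 2] instead of [n + 1], already the first end point exceeds [t0]. *)
exists (fun n => T - (T - t0) / n.+2%:R); split.
- by move=> m n mn; rewrite lerD2l lerN2 ler_pM2l// lef_pV2 ?posrE// ler_nat.
- move=> n; rewrite lte_fin; split; last by rewrite ltrBlDr ltrDl divr_gt0.
  by rewrite ltrBrDr -ltrBrDl ltr_pdivrMr// ltr_pMr// ltr1n.
apply/seteqP; split=> t.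
  rewrite rointE /= in_itv /= => /andP[t0t tT].
  exists (Num.truncn ((T - t0) / (T - t))) => //=; rewrite in_itv /= t0t /=.
  have Tt : 0 < T - t by rewrite subr_gt0.
  rewrite lerBrDr -lerBrDl ler_pdivrMr// mulrC -ler_pdivrMr//.
  by rewrite (le_trans (ltW (truncnS_gt _)))// ler_nat.
move=> [n _] /=; rewrite in_itv /= => /andP[t0t tb]; rewrite rointE /= in_itv /= t0t /=.
by apply: le_lt_trans tb _; rewrite ltrBlDr ltrDl divr_gt0.
Qed.

Lemma measurable_roint (t0 : R) (T : \bar R) : measurable (roint t0 T).
Proof.
case: T => [T| |].
- by rewrite rointE.
- rewrite (_ : roint _ _ = `[t0, +oo[%classic)//.
  by apply/seteqP; split=> t; rewrite /roint /= in_itv /= ltry andbT => // -[].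
- rewrite (_ : roint _ _ = set0)//.
  by apply/seteqP; split=> // t [_]; rewrite ltNge leNye.
Qed.

(** Monotone convergence along exhausting segments: bounds uniform in [b] become a bound on the
    interval of existence, whose right end the solution need not reach. *)
Lemma LpN2_roint_le (t0 : R) (T : \bar R) (h : R -> R) (B : R) : (t0%:E < T)%E ->
  {within roint t0 T, continuous h} -> 0 <= B ->
  (forall b, t0 < b -> (b%:E < T)%E -> sqint t0 b h <= B ^+ 2) ->
  (LpN 2%:E (roint t0 T) h <= B%:E)%E.
Proof.
move=> t0T hc B0 H.
have [b [bh bT JE]] := roint_exhaustion t0T.
have mh : measurable_fun (roint t0 T) h.
  by apply: subspace_continuous_measurable_fun => //; exact: measurable_roint.
have bJ n : `[t0, b n] `<=` roint t0 T by apply: cint_roint; exact: (bT n).2.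
suff H2 : (\int[mu]_(t in roint t0 T) (`|h t| `^ 2)%:E <= (B ^+ 2)%:E)%E.
  rewrite LpN_powE//; apply: (@le_trans _ _ ((B ^+ 2)%:E `^ 2^-1)%E).
    apply: gt0_ler_poweR => //.
      by rewrite in_itv /= leey andbT; apply: integral_ge0 => t _;
          rewrite lee_fin powR_ge0.
    by rewrite in_itv /= leey andbT lee_fin sqr_ge0.
  by rewrite poweR_EFin powR12_sqrt ?sqr_ge0// sqrtr_sqr ger0_norm.
have <- : limn (fun n => \int[mu]_(t in `[t0, b n]) (`|h t| `^ 2)%:E)%E =
   (\int[mu]_(t in roint t0 T) (`|h t| `^ 2)%:E)%E.
  apply: cvg_lim => //; rewrite JE; apply: ge0_nondecreasing_set_cvg_integral.
  - move=> m n mn; apply/subsetPset => t;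
      rewrite /= !in_itv /= => /andP[-> /le_trans]; apply.
    exact: bh.
  - by [].
  - move=> n; apply: measurable_funS (measurable_powR_norm 2 mh) => //;
      exact: measurable_roint.
  - by move=> n t _; rewrite lee_fin powR_ge0.
apply: lime_le.
  apply: ereal_nondecreasing_is_cvgn => m n mn; apply: ge0_subset_integral => //.
  - apply: measurable_funS (measurable_powR_norm 2 mh) => //; exact: measurable_roint.
  - move=> t; rewrite /= !in_itv /= => /andP[-> /le_trans]; apply; exact: bh.
apply: nearW => n; rewrite -EFin_sqint; last exact: continuous_subspaceW hc.
by rewrite lee_fin; apply: H; [exact: (bT n).1|exact: (bT n).2].
Qed.

Lemma LpNy_le (J : set R) (h : R -> R) (M : R) : 0 <= M ->
  (forall t, J t -> `|h t| <= M) -> (LpN +oo J h <= M%:E)%E.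
Proof.
move=> M0 H; rewrite /LpN unlock; case: ifP => _; last by rewrite lee_fin.
apply/ess_supP; apply: nearW => t /=; rewrite /patch; case: ifPn => [|_];
    last by rewrite -[point]/(0%E) abse0.
by rewrite inE => Jt; rewrite abse_EFin lee_fin; exact: H.
Qed.

(** A value above [M] persists, by continuity, on a nondegenerate segment, which no null set
    contains. This is how the essential suprema in the gains become bounds at each time. *)
Lemma LpNy_ge (J : set R) (h : R -> R) (M a b : R) : a < b ->
  {within `[a, b], continuous h} -> `[a, b] `<=` J -> (LpN +oo J h <= M%:E)%E ->
  forall t, a <= t <= b -> `|h t| <= M.
Proof.
move=> ab hc abJ HM t tab; have /andP[at0 tb] := tab.
rewrite leNgt; apply/negP => Mh.
have ess : \forall t \ae mu, (`|((EFin \o h) \_ J) t| <= M%:E)%E.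
  apply/ess_supP; move: HM; rewrite /LpN unlock ifT//.
  apply: (@lt_le_trans _ _ (mu `[0, 1]));
      first by rewrite /mu lebesgue_measure_itv /= lte_fin ltr01 sube0 lte_fin.
  by apply: le_measure; rewrite ?inE.
have /subspace_continuousP /(_ t) := hc.
rewrite /= in_itv /= => /(_ tab) /cvgrPdist_lt /(_ (`|h t| - M)).
rewrite subr_gt0 => /(_ Mh); rewrite /within /= => /nbhs_normP[dl /= dl0 H].
have dl2 : 0 < dl / 2 by rewrite divr_gt0.
(* Clipping to [[a, b]] leaves positive length even when [t] is an end point, because [a < b]. *)
pose c := Num.max a (t - dl / 2); pose e := Num.min b (t + dl / 2).
have ce : c < e by rewrite /c /e lt_min !gt_max ab /=; lra.
have big s : `[c, e]%classic s -> ~ (`|((EFin \o h) \_ J) s| <= M%:E)%E.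
  rewrite /= in_itv /= ge_max le_min => /andP[/andP[as0 ts] /andP[sb st]].
  have Js : J s by apply: abJ; rewrite /= in_itv /= as0.
  rewrite /patch ifT ?inE// abse_EFin lee_fin.
  have := H s; rewrite /ball_ /= in_itv /= as0 sb => /(_ _ isT) H'.
  have {}H' : `|h t - h s| < `|h t| - M.
    by apply: H'; rewrite ltr_norml; lra.
  have := ler_normD (h t - h s) (h s); rewrite subrK; move: H'; lra.
have [N [mN muN NP]] := ess.
have : (mu `[c, e] <= mu N)%E.
  by apply: le_measure; rewrite ?inE// => s /big; exact: NP.
by rewrite [leRHS]muN /mu lebesgue_measure_itv /= lte_fin ce -EFinB lee_fin leNgt
    subr_gt0 ce.
Qed.

End integrals.

Section more_integrals.
Context {R : realType}.
Let mu := @lebesgue_measure R.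

Lemma cint_inftyE (t0 : R) : cint t0 +oo%E = roint t0 +oo%E.
Proof.
apply/seteqP; split=> t; rewrite /cint /roint /= => -[t0t _]; split=> //;
    first exact: ltry.
exact: leey.
Qed.

Lemma LpN_triangle (a b : R) (g h : R -> R) :
  {within `[a, b], continuous g} -> {within `[a, b], continuous h} ->
  (LpN 2%:E `[a, b] (fun t => (g t + h t)%R) <= LpN 2%:E `[a, b] g + LpN 2%:E `[a,
      b] h)%E.
Proof.
move=> gc hc.
have E (k : R -> R) : (EFin \o k) \_ `[a, b] = EFin \o (k \_ `[a, b]).
  by apply/funext => t; rewrite /= /patch; case: ifP.
have mr (k : R -> R) : {within `[a, b], continuous k} ->
    measurable_fun [set: R] (k \_ `[a, b]).
  move=> kc; have mk : measurable_fun `[a,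
      b] k by exact: subspace_continuous_measurable_fun.
  exact: ((measurable_restrictT k (measurable_itv _)).1 mk).
rewrite /LpN !E (_ : (fun t => g t + h t) \_ `[a, b] = (g \_ `[a, b]) \+ (h \_ `[a,
    b])).
  apply: minkowski_EFin; last by rewrite ler1n.
    exact: mr.
  exact: mr.
by apply/funext => t; rewrite /= /patch; case: ifP => // _; rewrite addr0.
Qed.

(* If [|g| >= eta] recurred at arbitrarily late times, each occurrence would add
   the fixed amount [dl * eta' ^ r] to the integral of [|g|^r]. *)
Lemma barbalat (t0 r : R) (g : R -> R) : 0 < r ->
  {within roint t0 +oo%E, continuous g} ->
  (LpN r%:E (roint t0 +oo%E) g < +oo)%E ->
  (forall eta, 0 < eta -> exists2 dl, 0 < dl & exists2 eta', 0 < eta' &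
    forall t, t0 <= t -> eta <= `|g t| -> forall s, t <= s <= t + dl ->
        eta' <= `|g s|) ->
  g t @[t --> +oo] --> (0 : R).
Proof.
move=> r0 gc goo H.
pose J := roint t0 +oo%E.
have mJ : measurable J by exact: measurable_roint.
have mg : measurable_fun J g by exact: subspace_continuous_measurable_fun.
have mgr : measurable_fun J (EFin \o (fun t => `|g t| `^ r)) by exact:
    measurable_powR_norm.
have segJ b : `[t0, b] `<=` J.
  by move=> t; rewrite /= in_itv /= => /andP[t0t _]; split=> //; exact: ltry.
pose I b := (\int[mu]_(t in `[t0, b]) (`|g t| `^ r)%:E)%E.
pose B := fine (LpN r%:E J g) `^ r.
have IB b : (I b <= B%:E)%E by exact: integral_le_LpN.
have I0 b : (0 <= I b)%E by apply: integral_ge0 => t _; rewrite lee_fin powR_ge0.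
have If b : I b \is a fin_num.
  by rewrite ge0_fin_numE//; apply: le_lt_trans (IB b) _; exact: ltry.
pose S := [set z | exists b, t0 <= b /\ z = fine (I b)].
have hS : has_sup S.
  split; first by exists (fine (I t0)), t0.
  by exists B => _ [b [_ ->]]; rewrite -lee_fin fineK.
apply/cvgrPdist_lt => eta eta0.
have [dl dl0 [eta' eta'0 Heta]] := H eta eta0.
pose c := eta' `^ r; have c0 : 0 < c by rewrite powR_gt0.
have cd : 0 < c * dl by rewrite mulr_gt0.
(* Past [b] the integral grows by less than [c * dl], the least amount that one later excursion
   would add. *)
have [_ [b [t0b ->]] supb] := sup_adherent cd hS.
exists b; split; first exact: num_real.
move=> t bt; rewrite sub0r normrN ltNge; apply/negP => gt.
have t0t : t0 <= t by rewrite (le_trans t0b)// ltW.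
have HE := Heta t t0t gt.
have key : (I b + (c * dl)%:E <= I (t + dl)%R)%E.
  apply: (@le_trans _ _ (I b + \int[mu]_(s in `]t, (t + dl)%R]) (`|g s| `^ r)%:E)%E).
    apply: leeD => //.
    apply: (@le_trans _ _ (\int[mu]_(s in `]t, (t + dl)%R]) (cst c%:E) s)%E).
      rewrite integral_cst//= /mu lebesgue_measure_itv /= lte_fin ltrDl dl0.
      by rewrite -EFinB -EFinM lee_fin addrAC subrr add0r.
    apply: ge0_le_integral => //.
    - by move=> s _; rewrite lee_fin ltW.
    - apply: measurable_funS mgr => // s; rewrite /= in_itv /= => /andP[ts _].
      by split; [rewrite (le_trans t0t)// ltW|exact: ltry].
    - move=> s; rewrite /= in_itv /= => /andP[ts std]; rewrite lee_fin.
      apply: ge0_ler_powR; rewrite ?nnegrE ?(ltW r0) ?(ltW eta'0)//.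
      by apply: HE; rewrite std ltW.
  rewrite /I -ge0_integral_setU//.
  - apply: ge0_subset_integral => //.
    + by apply: measurableU.
    + by apply: measurable_funS mgr => //; exact: segJ.
    + move=> s [|] /=; rewrite !in_itv /= => /andP[s1 s2]; apply/andP; split=> //.
        by rewrite (le_trans s2)// (le_trans (ltW bt))// lerDl ltW.
      by rewrite (le_trans t0t)// ltW.
  - apply: measurable_funS mgr => // s [|] /=; rewrite in_itv /= => /andP[s1 s2].
      by split=> //; exact: ltry.
    by split; [rewrite (le_trans t0t)// ltW|exact: ltry].
  - apply/disj_setPS => s [] /=; rewrite !in_itv /= => /andP[_ sb] /andP[ts _].
    by have := le_lt_trans sb (lt_trans bt ts); rewrite ltxx.
have : fine (I b) + c * dl <= fine (I (t + dl)).
  by rewrite -lee_fin EFinD !fineK.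
have : fine (I (t + dl)) <= sup S.
  apply: ub_le_sup; first exact: hS.2.
  by exists (t + dl); split=> //; rewrite (le_trans t0t)// lerDl ltW.
by move: supb; rewrite ltrBlDr; move=> h1 h2 h3;
    have := lt_le_trans h1 (le_trans h3 h2); rewrite ltxx.
Qed.

End more_integrals.

(** * Energy estimates and asymptotics *)

Section energy.
Context {R : realType}.
Let mu := @lebesgue_measure R.

(* With [F a <= 0], Young's inequality [2 |eps| |F| <= l F^2 + eps^2 / l]
   absorbs the cross term. *)
Lemma energy_rate (D D1 l F e a : R) : 0 < D -> 0 < D1 -> 0 < l ->
  F * a <= 0 -> `|F| <= D * `|a| -> D1 * `|a| <= `|F| ->
  2 * (F + e) * a <= (l / D1 - 2 / D) * (F * F) + (D1 * l)^-1 * (e * e).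
Proof.
move=> D0 D10 l0 Fa FD FD1.
have FF : F * F = `|F| * `|F| by rewrite -normrM ger0_norm// -expr2 sqr_ge0.
have ee : e * e = `|e| * `|e| by rewrite -normrM ger0_norm// -expr2 sqr_ge0.
have H1 : 2 * F * a <= - (2 / D) * (F * F).
  have -> : 2 * F * a = - 2 * (`|F| * `|a|) by rewrite -normrM ler0_norm//; ring.
  have : `|F| * `|F| / D <= `|F| * `|a| by rewrite ler_pdivrMr// -mulrA ler_wpM2l//
      mulrC.
  rewrite FF (_ : - (2 / D) * _ = - 2 * (`|F| * `|F| / D)); last by ring.
  lra.
have H2 : 2 * e * a <= l / D1 * (F * F) + (D1 * l)^-1 * (e * e).
  have aF : `|a| <= `|F| / D1 by rewrite ler_pdivlMr// mulrC.
  apply: (@le_trans _ _ (2 * (`|e| * (`|F| / D1)))).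
    rewrite -mulrA ler_pM2l//; apply: (le_trans (ler_norm _)); rewrite normrM.
    by rewrite ler_wpM2l.
  rewrite FF ee -subr_ge0.
  have -> : l / D1 * (`|F| * `|F|) + (D1 * l)^-1 * (`|e| * `|e|) - 2 * (`|e| * (`|F| /
      D1))
     = (l * `|F| - `|e|) ^+ 2 / (D1 * l) by field; rewrite !gt_eqF.
  by rewrite divr_ge0 ?sqr_ge0// ltW// mulr_gt0.
rewrite mulrDr mulrDl.
move: H1 H2; set c1 := l / D1; set c2 := 2 / D; set Y := F * F; set Z := _ * (e * e).
have -> : (c1 - c2) * Y = c1 * Y - c2 * Y by ring.
by lra.
Qed.

Lemma energy_ineq (a b D D1 l : R) (V F eps al : R -> R) : a < b ->
  0 < D -> 0 < D1 -> 0 < l ->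
  (forall t, a <= t <= b -> has_deriv `[a, b] V t (2 * (F t + eps t) * al t)) ->
  {within `[a, b], continuous F} -> {within `[a, b], continuous eps} ->
  {within `[a, b], continuous al} ->
  (forall t, a <= t <= b -> [/\ F t * al t <= 0, `|F t| <= D * `|al t|
     & D1 * `|al t| <= `|F t|]) ->
  V b - V a <= (l / D1 - 2 / D) * sqint a b F + (D1 * l)^-1 * sqint a b eps.
Proof.
move=> ab D0 D10 l0 HV Fc ec ac H.
have Vc : {within `[a, b], continuous (fun t => 2 * (F t + eps t) * al t)}.
  apply: within_continuousM => //; apply: within_continuousM;
      first exact: within_continuous_cst.
  exact: within_continuousD.
rewrite -(FTC_has_deriv ab HV Vc) /sqint.
have FFc := within_continuousM Fc Fc; have eec := within_continuousM ec ec.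
have k1c := within_continuousM (@within_continuous_cst R `[a, b] (l / D1 - 2 / D)) FFc.
have k2c := within_continuousM (@within_continuous_cst R `[a, b] (D1 * l)^-1) eec.
rewrite -!RintegralZl//; [|exact: integrable_segment|exact: integrable_segment].
rewrite -RintegralD//; [|exact: integrable_segment|exact: integrable_segment].
apply: le_Rintegral => //.
- exact: integrable_segment.
- by apply: integrable_segment; exact: within_continuousD.
- move=> t; rewrite /= in_itv /= => /H[? ? ?]; exact: energy_rate.
Qed.

(** For given norms the best [l] is [E / X]. It turns the hypothesis into [X^2 <= s^2 + k X], with
    [s] and [k] the two terms of the conclusion, and this forces [X <= s + k]. *)
Lemma energy_L2_bound (D D1 V0 E X : R) : 0 < D -> 0 < D1 -> 0 <= E -> 0 <= X ->
  (forall l, 0 < l -> 0 <= V0 + (l / D1 - 2 / D) * X ^+ 2 + (D1 * l)^-1 * E ^+ 2) ->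
  0 <= V0 -> X <= Num.sqrt (D / 2 * V0) + D / D1 * E.
Proof.
move=> D0 D10 E0 X0 H V00.
apply/ler_addgt0Pr => z z0.
have DD : 0 < D / D1 by rewrite divr_gt0.
(* If [E = 0] the best [l] would be 0, which is not allowed; enlarging [E] to a positive [E'] costs
   exactly [z] in the conclusion. *)
pose E' := E + z * (D / D1)^-1.
have E'0 : 0 < E' by rewrite /E' ltr_wpDl// mulr_gt0// invr_gt0.
have -> : Num.sqrt (D / 2 * V0) + D / D1 * E + z = Num.sqrt (D / 2 * V0) + D / D1 * E'.
  by rewrite /E' mulrDr [D / D1 * (z * _)]mulrCA mulfV ?gt_eqF// mulr1 addrA.
set s := Num.sqrt _; have s0 : 0 <= s by exact: sqrtr_ge0.
have ss : s ^+ 2 = D / 2 * V0 by rewrite sqr_sqrtr// mulr_ge0// divr_ge0// ltW.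
set k := D / D1 * E'; have k0 : 0 < k by rewrite mulr_gt0.
move: X0; rewrite le_eqVlt => /predU1P[<-|X0]; first by rewrite addr_ge0// ltW.
have {}H := H (E' / X) (divr_gt0 E'0 X0).
have EE : E ^+ 2 <= E' ^+ 2.
  rewrite ler_pXn2r ?nnegrE// ?ltW// /E'; first by rewrite ltrDl mulr_gt0// invr_gt0.
have : X ^+ 2 <= s ^+ 2 + k * X.
  have {}H : 0 <= V0 + (E' / X / D1 - 2 / D) * X ^+ 2 + (D1 * (E' / X))^-1 * E' ^+ 2.
    apply: le_trans H _; rewrite lerD2l ler_wpM2l// invr_ge0 ltW// mulr_gt0//
        divr_gt0//.
  have E2 : V0 + (E' / X / D1 - 2 / D) * X ^+ 2 + (D1 * (E' / X))^-1 * E' ^+ 2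
     = (2 / D) * (s ^+ 2 + k * X - X ^+ 2).
    by rewrite ss /k; field; rewrite !gt_eqF.
  by move: H; rewrite E2 pmulr_rge0 ?divr_gt0// subr_ge0.
move=> HX; rewrite leNgt; apply/negP => Xsk.
have sX : s < X by apply: le_lt_trans Xsk; rewrite lerDl ltW.
have : s ^+ 2 + k * X < X ^+ 2.
  apply: (@le_lt_trans _ _ ((s + k) * X)).
    by rewrite mulrDl lerD2r expr2 ler_wpM2l// ltW.
  by rewrite expr2 ltr_pM2r.
by rewrite ltNge HX.
Qed.

End energy.

(** * Energy along the closed loop, and bounds on psi, x and the estimate *)

Section performance.
Context {R : realType} {q p d w : nat} (P : plant R q p d).
Context (psi : 'cV[R]_(q + p) -> R -> R) (phi : R -> 'cV[R]_w -> R -> R)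
  (alpha Psi : 'cV[R]_(q + p) -> R -> 'cV[R]_d) (Gamma : 'M[R]_d).
Context (eps : R -> R) (th : 'cV[R]_d) (om : 'cV[R]_w).
Hypothesis Preg : plant_regular P.
Hypothesis psiC : C1 psi.
Hypothesis Lg0 : forall y t, 0 <= t -> lie (vg P y) psi y t != 0.
Hypothesis alphaC : C1 alpha.
Hypothesis PsiC : C1 Psi.
Hypothesis dx2 : forall (j : 'I_p) y t, 0 <= t ->
  dx Psi (rshift q j) y t - psi y t *: dx alpha (rshift q j) y t = 0.
Hypothesis Gpos : posdef Gamma.
Context (D D1 : R).
Hypothesis D0 : 0 < D.
Hypothesis D10 : 0 < D1.
Let f := fpsi P psi.
Hypothesis mono : forall y t bh, 0 <= t ->
  0 <= (f y bh t - f y th t) * (((alpha y t)^T *m (bh - th)) 0 0) /\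
  `|f y bh t - f y th t| <= D * `|((alpha y t)^T *m (bh - th)) 0 0|.
Hypothesis growth : forall y t bh, 0 <= t ->
  D1 * `|((alpha y t)^T *m (bh - th)) 0 0| <= `|f y bh t - f y th t|.
Hypothesis epsc : {within Rplus, continuous eps}.
Context (t0 : R) (T : \bar R) (x : R -> 'cV[R]_(q + p)) (thI : R -> 'cV[R]_d)
  (u : R -> R).
Hypothesis t00 : 0 <= t0.
Hypothesis t0T : (t0%:E < T)%E.
Let J := roint t0 T.
Hypothesis cl : closed_loop P psi phi alpha Psi Gamma om eps th J x thI u.
Let thh t := thetahat psi alpha Psi Gamma (x t) (thI t) t.
Let F t := f (x t) th t - f (x t) (thh t) t.
Let psit t := psi (x t) t.
Let V t := wnorm2 (invmx Gamma) (th - thh t).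

Let J0 : J `<=` Rplus := roint_Rplus t00.

Lemma eps_within_continuous : {within J, continuous eps}.
Proof. exact: continuous_subspaceW epsc. Qed.

Lemma state_cvg t : J t -> x s @[s --> within J (nbhs t)] --> x t.
Proof. by move=> /(closed_loop_state cl) /has_deriv_cvg. Qed.

Lemma thetahat_path_cvg t : J t -> thh s @[s --> within J (nbhs t)] --> thh t.
Proof.
by move=> /(thetahat_deriv alphaC PsiC dx2 t00 cl) /has_deriv_cvg.
Qed.

Lemma F_within_continuous : {within J, continuous F}.
Proof.
apply/subspace_continuousP => t Jt; have t_ge0 := J0 Jt.
have tft := @cvg_within_id _ J t; have tf0 := cvg_near_ge0 t J0.
have xc := state_cvg Jt.
apply: cvgB; first exact: (fpsi_cvg Preg psiC tft tf0 t_ge0 xc (cvg_cst th)).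
exact: (fpsi_cvg Preg psiC tft tf0 t_ge0 xc (thetahat_path_cvg Jt)).
Qed.

Lemma psi_path_continuous : {within J, continuous psit}.
Proof.
apply/subspace_continuousP => t Jt.
by have [_ /(_ t Jt) /has_deriv_cvg H _] := cl; exact: H.
Qed.

Let al t := ((alpha (x t) t)^T *m (thh t - th)) 0 0.

Lemma al_within_continuous : {within J, continuous al}.
Proof.
apply/subspace_continuousP => t Jt; have t_ge0 := J0 Jt.
have tft := @cvg_within_id _ J t; have tf0 := cvg_near_ge0 t J0.
have xc := state_cvg Jt.
apply: cvg_dot; first exact: (C1_cvg_cV tft tf0 t_ge0 xc alphaC).
by apply: cvgB; [exact: thetahat_path_cvg|exact: cvg_cst].
Qed.

(** The weight [Gamma^-1] cancels the gain matrix of the adaptation law, so that both terms of the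
    product rule equal [(F + eps) al]. *)
Lemma V_deriv t : J t -> has_deriv J V t (2 * (F t + eps t) * al t).
Proof.
move=> Jt; pose e s := thh s - th.
have He : has_deriv J e t (Gamma *m ((F t + eps t) *: alpha (x t) t)).
  rewrite -[_ *m _]subr0; apply: has_derivB; last exact: has_deriv_cst.
  exact: (thetahat_deriv alphaC PsiC dx2 t00 cl).
have := has_deriv_dot He (has_deriv_mulmx (A := invmx Gamma) He).
rewrite (_ : (fun s => _) = V); last first.
  by apply/funext => s; rewrite /V -wnorm2N opprB /wnorm2 mulmxA.
congr has_deriv.
rewrite trmx_mul Gpos.1 mulKmx ?posdef_unitmx// -mulmxA mulKVmx ?posdef_unitmx//.
rewrite linearZ /= -scalemxAl -scalemxAr !mxE -/(e t).
rewrite (_ : \sum_j (e t)^T 0 j * alpha (x t) t j 0 = al t); last first.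
  by rewrite /al mxE; apply: eq_bigr => j _; rewrite !mxE mulrC.
rewrite (_ : \sum_j (alpha (x t) t)^T 0 j * e t j 0 = al t); last first.
  by rewrite /al mxE.
by ring.
Qed.

Lemma V_ge0 t : 0 <= V t.
Proof. exact: wnorm2_inv_ge0. Qed.

Lemma energy_along b l : t0 < b -> (b%:E < T)%E -> 0 < l ->
  V b - V t0 <= (l / D1 - 2 / D) * sqint t0 b F + (D1 * l)^-1 * sqint t0 b eps.
Proof.
move=> t0b bT l0; have bJ : `[t0, b] `<=` J by exact: cint_roint.
have Jb t : t0 <= t <= b -> J t by move=> tb; apply: bJ; rewrite /= in_itv.
apply: (energy_ineq (al := al)) => //.
- by move=> t tb; apply: has_deriv_sub bJ _; apply: V_deriv; exact: Jb.
- exact: continuous_subspaceW bJ F_within_continuous.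
- exact: continuous_subspaceW bJ eps_within_continuous.
- exact: continuous_subspaceW bJ al_within_continuous.
- move=> t /Jb /J0 t_ge0.
  have [m1 m2] := mono (x t) (thh t) t_ge0; have m3 := growth (x t) (thh t) t_ge0.
  have FE : F t = - (f (x t) (thh t) t - f (x t) th t) by rewrite opprB.
  by rewrite FE normrN mulNr oppr_le0; split.
Qed.

Lemma sqint_F_le b nu : t0 < b -> (b%:E < T)%E -> 0 <= nu ->
    sqint t0 b eps <= nu ^+ 2 ->
  sqint t0 b F <= (Dfbound D D1 Gamma (th - thh t0) nu) ^+ 2.
Proof.
move=> t0b bT nu0 Hnu.
have S0 : 0 <= sqint t0 b F by exact: sqint_ge0.
rewrite -[leLHS]sqr_sqrtr// ler_pXn2r ?nnegrE ?sqrtr_ge0//; last first.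
  by rewrite /Dfbound addr_ge0 ?sqrtr_ge0// mulr_ge0// divr_ge0 ?ltW.
apply: energy_L2_bound; rewrite ?sqrtr_ge0//; last exact: V_ge0.
move=> l l0; have := energy_along t0b bT l0; have := V_ge0 b.
rewrite sqr_sqrtr//.
have : (D1 * l)^-1 * sqint t0 b eps <= (D1 * l)^-1 * nu ^+ 2.
  by rewrite ler_wpM2l// invr_ge0 ltW// mulr_gt0.
rewrite -/(V t0); lra.
Qed.

Lemma V_le b nu : t0 < b -> (b%:E < T)%E -> sqint t0 b eps <= nu ^+ 2 ->
  V b <= V t0 + D / (2 * D1 ^+ 2) * nu ^+ 2.
Proof.
move=> t0b bT Hnu.
(* This [l] cancels the coefficient of [F^2] and makes that of [eps^2] equal to
   [D / (2 * D1 ^+ 2)]. *)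
have l0 : 0 < 2 * D1 / D by rewrite !divr_gt0 ?mulr_gt0.
have := energy_along t0b bT l0.
have -> : 2 * D1 / D / D1 - 2 / D = 0 by field; rewrite !gt_eqF.
have -> : (D1 * (2 * D1 / D))^-1 = D / (2 * D1 ^+ 2) by field; rewrite !gt_eqF.
have : D / (2 * D1 ^+ 2) * sqint t0 b eps <= D / (2 * D1 ^+ 2) * nu ^+ 2.
  by rewrite ler_wpM2l// divr_ge0 ?ltW// mulr_gt0// exprn_gt0.
lra.
Qed.

Context (nu : R).
Hypothesis nu0 : 0 <= nu.
Hypothesis sqint_eps : forall b, t0 < b -> (b%:E < T)%E -> sqint t0 b eps <= nu ^+ 2.

(** The bound [nu] on [eps] stays abstract from here on: it is the norm over [J] for P1, and the
    norm over the whole half-line afterwards. *)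
Lemma LpN_F_le : (LpN 2%:E J F <= (Dfbound D D1 Gamma (th - thh t0) nu)%:E)%E.
Proof.
apply: LpN2_roint_le => //.
- exact: F_within_continuous.
- by rewrite /Dfbound addr_ge0 ?sqrtr_ge0// mulr_ge0// divr_ge0 ?ltW.
- by move=> b t0b bT; apply: sqint_F_le => //; exact: sqint_eps.
Qed.

Lemma V_path_le t : J t -> V t <= V t0 + D / (2 * D1 ^+ 2) * nu ^+ 2.
Proof.
move=> [t0t tT]; move: t0t; rewrite le_eqVlt => /predU1P[<-|t0t].
  by rewrite lerDl mulr_ge0 ?sqr_ge0// divr_ge0 ?ltW// mulr_gt0// exprn_gt0.
by apply: V_le => //; exact: sqint_eps.
Qed.


Hypothesis phic : {within [set z : R * R | 0 <= z.2],
    continuous (fun z => phi z.1 om z.2)}.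

Lemma phi_path_continuous : {within J, continuous (fun t => phi (psit t) om t)}.
Proof.
apply/subspace_continuousP => t Jt.
have /subspace_continuousP /(_ t Jt) pc := psi_path_continuous.
exact: (within_cvg2 (k := fun a s => phi a om s) phic pc (@cvg_within_id _ J t)
  (cvg_near_ge0 t J0) (J0 Jt)).
Qed.

Lemma zeta_continuous : {within J, continuous (fun t => F t + eps t)}.
Proof.
exact: within_continuousD F_within_continuous eps_within_continuous.
Qed.

(** The error equation is the target dynamics with input [F + eps]. The gains speak of integral
    solutions, and the fundamental theorem makes the classical solution one of them. *)
Lemma psi_target_solution (T' : \bar R) : cint t0 T' `<=` J ->
  target_solution phi om (fun t => F t + eps t) t0 T' psit.
Proof.
move=> TJ t tT'; have [t0t _] := tT'.
have Jt := TJ t tT'.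
have tJ : `[t0, t] `<=` J by case: Jt => _; exact: cint_roint.
pose g s := - phi (psit s) om s + (F s + eps s).
have gc : {within `[t0, t], continuous g}.
  apply: continuous_subspaceW tJ _; apply: within_continuousD;
      last exact: zeta_continuous.
  have /subspace_continuousP pc := phi_path_continuous.
  by apply/subspace_continuousP => s Js; apply: cvgN; exact: pc.
split; first exact: integrable_segment.
move: t0t; rewrite le_eqVlt => /predU1P[<-|t0t].
  by rewrite set_itv1 Rintegral_set1 addr0.
have := @FTC_has_deriv R t0 t psit g t0t _ gc.
rewrite -/g => ->; first by rewrite addrC subrK.
move=> s st; have Js : J s by apply: tJ; rewrite /= in_itv.
have [_ /(_ s Js) H _] := cl; apply: has_deriv_sub tJ _.
by move: H; congr has_deriv; rewrite /g /psit /F /f /thh; ring.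
Qed.

Let Dnu := Dfbound D D1 Gamma (th - thh t0) nu + nu.

Lemma Dnu_ge0 : 0 <= Dnu.
Proof.
by rewrite /Dnu /Dfbound !addr_ge0 ?sqrtr_ge0// mulr_ge0// divr_ge0 ?ltW.
Qed.

Lemma zeta_LpN_le b : t0 < b -> (b%:E < T)%E ->
  (LpN 2%:E `[t0, b] (fun t => (F t + eps t)%R) <= Dnu%:E)%E.
Proof.
move=> t0b bT; have bJ : `[t0, b] `<=` J by exact: cint_roint.
have Fc := continuous_subspaceW bJ F_within_continuous.
have ec := continuous_subspaceW bJ eps_within_continuous.
apply: le_trans (LpN_triangle Fc ec) _; rewrite /Dnu [leRHS]EFinD; apply: leeD.
  rewrite LpN2_segment// lee_fin.
  have B0 : 0 <= Dfbound D D1 Gamma (th - thh t0) nu.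
    by rewrite /Dfbound addr_ge0 ?sqrtr_ge0// mulr_ge0// divr_ge0 ?ltW.
  rewrite -[leRHS]ger0_norm// -sqrtr_sqr ler_wsqrtr//.
  by apply: sqint_F_le => //; exact: sqint_eps.
rewrite LpN2_segment// lee_fin -[leRHS]ger0_norm// -sqrtr_sqr ler_wsqrtr//.
exact: sqint_eps.
Qed.

Lemma zeta_LpN_roint : (LpN 2%:E J (fun t => (F t + eps t)%R) <= Dnu%:E)%E.
Proof.
apply: LpN2_roint_le => //; [exact: zeta_continuous|exact: Dnu_ge0|].
move=> b t0b bT; have bJ : `[t0, b] `<=` J by exact: cint_roint.
have := zeta_LpN_le t0b bT.
rewrite LpN2_segment; last exact: continuous_subspaceW bJ zeta_continuous.
set S := sqint _ _ _; have S0 : 0 <= S by exact: sqint_ge0.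
by rewrite lee_fin -[X in _ -> X <= _]sqr_sqrtr// => H;
    rewrite ler_pXn2r ?nnegrE ?sqrtr_ge0 ?Dnu_ge0.
Qed.

(** The gain is applied on a segment reaching slightly beyond [t], where the input has norm at most
    [Dnu]; monotonicity of [gam] in its last argument makes the bound common to all segments. *)
Lemma psi_path_le (Omw : set 'cV[R]_w) (gam : R -> 'cV[R]_w -> R -> R) :
  Omw om -> target_gain phi Omw t0 2%:E +oo%E gam ->
  forall t, J t -> `|psit t| <= gam (psit t0) om Dnu.
Proof.
move=> Oom [gam0 gamm _ _ gain] t Jt.
have [b [t0b' bT] /andP[tb _]] := roint_right_point Jt ltr01.
have [t0t _] := Jt; have t0b : t0 < b by exact: le_lt_trans tb.
have bJ : `[t0, b] `<=` J by exact: cint_roint.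
have zc := continuous_subspaceW bJ zeta_continuous.
have zL : inLp 2%:E (cint t0 b%:E) (fun s => F s + eps s).
  rewrite cintE; split; first exact: subspace_continuous_measurable_fun.
  by apply: le_lt_trans (zeta_LpN_le t0b bT) _; exact: ltry.
have sol : target_solution phi om (fun s => F s + eps s) t0 b%:E psit.
  by apply: psi_target_solution; rewrite cintE.
have [_ Hle] := gain om b%:E _ psit Oom ltac:(by rewrite lte_fin) zL sol.
rewrite cintE in Hle.
have pc := continuous_subspaceW bJ psi_path_continuous.
apply: (LpNy_ge t0b pc _ _ (J := `[t0, b])) => //; last by rewrite t0t ltW.
apply: le_trans Hle _; rewrite lee_fin; apply: gamm.
  by rewrite fine_ge0// LpN_ge0.
rewrite -lee_fin fineK; last first.
  rewrite ge0_fin_numE ?LpN_ge0//.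
  by apply: le_lt_trans (zeta_LpN_le t0b bT) _; exact: ltry.
exact: zeta_LpN_le.
Qed.

Lemma thetahat_path_bounded : exists M, forall t, J t -> `|thh t| <= M.
Proof.
pose C := V t0 + D / (2 * D1 ^+ 2) * nu ^+ 2.
have C0 : 0 <= C.
  rewrite addr_ge0 ?V_ge0// mulr_ge0 ?sqr_ge0// divr_ge0 ?ltW// mulr_gt0// exprn_gt0//.
(* The form bounds the square of each coordinate [e_i] of the error; [|e_i| <= 1 + e_i^2] spares a
   square root. *)
exists (1 + \sum_(i < d) `|Gamma i i| * C + `|th|) => t Jt.
rewrite -[thh t](subrK th) (le_trans (ler_normD _ _))// lerD2r -normrN opprB.
apply: cV_norm_le => [|i]; first by rewrite addr_ge0// sumr_ge0// => j _;
    rewrite mulr_ge0.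
set e := th - thh t.
have H : e i 0 ^+ 2 <= \sum_(i < d) `|Gamma i i| * C.
  apply: (le_trans (coord_wnorm2_inv Gpos e i)).
  rewrite (bigD1 i)//= -[leLHS]addr0 lerD ?sumr_ge0//; last by move=> j _;
      rewrite mulr_ge0.
  apply: le_trans (ler_wpM2r _ (ler_norm _)) _; first exact: V_ge0.
  by rewrite ler_wpM2l//; exact: V_path_le.
have [e1|e1] := leP `|e i 0| 1;
    first by rewrite (le_trans e1)// lerDl (le_trans _ H)// sqr_ge0.
apply: (@le_trans _ _ (e i 0 ^+ 2)); last by rewrite (le_trans H)// lerDr.
rewrite -normr_id in e1.
by rewrite -real_normK ?num_real// expr2 ler_peMl// ltW// -normr_id.
Qed.

(** Inverting [Gamma] expresses [thI] by the bounded estimate and by [psi alpha - Psi]. On a finite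
    horizon [(x, t)] stays in a compact tube, on which these continuous functions are bounded. *)
Lemma thetaI_path_bounded (M b : R) : (forall t, J t -> `|x t| <= M) ->
  (forall t, J t -> t <= b) -> exists M', forall t, J t -> `|thI t| <= M'.
Proof.
move=> xM Jb; have [Mt HMt] := thetahat_path_bounded.
have tube (W : normedModType R) (k : 'cV[R]_(q + p) -> R -> W) :
    {within [set z : 'cV[R]_(q + p) * R | 0 <= z.2], continuous (fun z => k z.1 z.2)} ->
    exists2 L, 0 < L & forall t, J t -> `|k (x t) t| <= L.
  move=> kc; have [L L0 HL] := bounded_on_tube b (@compact_cV_ball R (q + p) M) kc.
  by exists L => // t Jt; apply: HL; [exact: xM|rewrite J0//= Jb].
have C1c m (k : 'cV[R]_(q + p) -> R -> 'cV[R]_m) : C1 k ->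
    {within [set z : 'cV[R]_(q + p) * R | 0 <= z.2], continuous (fun z => k z.1 z.2)}.
  move=> kC; apply/within2P => y t t_ge0.
  have idF : z @[z --> within [set z : 'cV[R]_(q + p) * R | 0 <= z.2] (nbhs (y, t))]
      --> (y, t) by exact: cvg_within.
  apply: C1_cvg_cV => //.
  - exact: (cvg_comp idfun snd idF (cvg_snd (F := nbhs y))).
  - by rewrite near_withinE; exact: nearW.
  - exact: (cvg_comp idfun fst idF (cvg_fst (G := nbhs t))).
have psic : {within [set z : 'cV[R]_(q + p) * R | 0 <= z.2],
    continuous (fun z => psi z.1 z.2)}.
  apply/within2P => y t t_ge0.
  have idF : z @[z --> within [set z : 'cV[R]_(q + p) * R | 0 <= z.2] (nbhs (y, t))]
      --> (y, t) by exact: cvg_within.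
  apply: C1_cvg => //.
  - exact: (cvg_comp idfun fst idF (cvg_fst (G := nbhs t))).
  - exact: (cvg_comp idfun snd idF (cvg_snd (F := nbhs y))).
  - by rewrite near_withinE; exact: nearW.
have [La La0 Ha] := tube _ alpha (C1c _ _ alphaC).
have [LP LP0 HP] := tube _ Psi (C1c _ _ PsiC).
have [Lp Lp0 Hp] := tube _ psi psic.
pose K := \sum_(i < d) \sum_(j < d) `|invmx Gamma i j|.
have K0 : 0 <= K by rewrite sumr_ge0// => i _; rewrite sumr_ge0.
exists (K * Mt + (Lp * La + LP)) => t Jt.
have -> : thI t = invmx Gamma *m thh t - (psi (x t) t *: alpha (x t) t - Psi (x t) t).
  by rewrite /thh /thetahat mulKmx ?posdef_unitmx// addrC addKr.
apply: (le_trans (ler_normB _ _)); apply: lerD.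
  have Mt0 : 0 <= Mt by apply: le_trans (HMt t Jt).
  apply: cV_norm_le; first by rewrite mulr_ge0.
  move=> i; rewrite mxE; apply: (le_trans (ler_norm_sum _ _ _)).
  apply: (@le_trans _ _ (\sum_j `|invmx Gamma i j| * Mt)).
    apply: ler_sum => j _; rewrite normrM ler_wpM2l//.
    exact: le_trans (cV_coord_le _ _) (HMt t Jt).
  rewrite -mulr_suml ler_wpM2r// /K [leRHS](bigD1 i)//= lerDl sumr_ge0// => k _.
  by rewrite sumr_ge0.
apply: (le_trans (ler_normB _ _)); apply: lerD; last exact: HP.
by rewrite normrZ ler_pM//; [exact: Hp|exact: Ha].
Qed.

(** [gamt] is not assumed monotone, and the norm [N] of [psi] varies with the segment; local
    boundedness on one ball containing all [(x t0, th, N)] with [N <= K] gives a common bound. *)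
Lemma state_path_bounded (gamt : 'cV[R]_(q + p) -> 'cV[R]_d -> R -> R) (K : R) :
  locally_bounded_on [set z : 'cV[R]_(q + p) * 'cV[R]_d * R | 0 <= z.2]
    (fun z => gamt z.1.1 z.1.2 z.2) ->
  (forall (b : R) y v, t0 < b ->
     plant_solution P th (cint t0 b%:E) y v ->
     (LpN +oo (cint t0 b%:E) (enorm \o y)
       <= (gamt (y t0) th
             (fine (LpN +oo (cint t0 b%:E) (fun t => psi (y t) t))))%:E)%E) ->
  (forall t, J t -> `|psit t| <= K) ->
  exists2 M, 0 <= M & forall t, J t -> enorm (x t) <= M.
Proof.
move=> lb HM HK.
have Jt0 : J t0 by split.
have K0 : 0 <= K by apply: le_trans (HK t0 Jt0).
have [M HMz] := lb (`|x t0| + `|th| + K + 1).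
exists (Num.max 0 M) => [|t Jt]; first by rewrite le_max lexx.
have [b [t0b' bT] /andP[tb _]] := roint_right_point Jt ltr01.
have [t0t _] := Jt; have t0b : t0 < b by exact: le_lt_trans tb.
have bJ : `[t0, b] `<=` J by exact: cint_roint.
have sol : plant_solution P th (cint t0 b%:E) x u.
  rewrite cintE => s sb; have [/(_ s (bJ s sb)) H _ _] := cl.
  exact: has_deriv_sub bJ H.
have := HM b x u t0b sol; rewrite cintE.
set N := fine _ => Hle.
have N0 : 0 <= N by rewrite fine_ge0// LpN_ge0.
have NK : N <= K.
  have : (LpN +oo `[t0, b] psit <= K%:E)%E by apply: LpNy_le => // s /bJ; exact: HK.
  move=> H; rewrite -lee_fin fineK// ge0_fin_numE ?LpN_ge0//.
  by apply: le_lt_trans H _; exact: ltry.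
have gM : gamt (x t0) th N <= M.
  apply: le_trans (ler_norm _) _; apply: (HMz (x t0, th, N)) => //.
  have xn := normr_ge0 (x t0); have tn := normr_ge0 th.
  apply: pair_norm_lt; first apply: pair_norm_lt; last rewrite (ger0_norm N0); lra.
have ec : {within `[t0, b], continuous (enorm \o x)}.
  apply: continuous_subspaceW bJ _; apply/subspace_continuousP => s Js.
  have xc := cvg_coord (state_cvg Js).
  have H : (\sum_(i < q + p) x r i 0 ^+ 2) @[r --> within J (nbhs s)]
      --> \sum_(i < q + p) x s i 0 ^+ 2.
    by apply: cvg_bigsum => i; apply: cvgM; exact: xc.
  exact: (cvg_comp _ _ H (@sqrt_continuous R _)).
have gM' : ((gamt (x t0) th N)%:E <= (Num.max 0 M)%:E)%E by rewrite lee_fin le_max gM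
    orbT.
apply: le_trans (ler_norm _) _.
by apply: (LpNy_ge t0b ec (@subset_refl _ _) (le_trans Hle gM')); rewrite t0t ltW.
Qed.


(** * Convergence of psi and F to zero *)

Section asymptotics.
Hypothesis Ty : T = +oo%E.
Context (M : R).
Hypothesis xM : forall t, J t -> `|x t| <= M.
Hypothesis thhM : forall t, J t -> `|thh t| <= M.
Hypothesis psiM : forall t, J t -> `|psit t| <= M.
Hypothesis epsM : forall t, J t -> `|eps t| <= M.
Hypothesis fB : unif_locally_bounded
  (fun (z : 'cV[R]_(q + p) * 'cV[R]_d) t => f z.1 z.2 t).
Hypothesis phiB : unif_locally_bounded (fun (z : R * 'cV[R]_w) t => phi z.1 z.2 t).

Lemma late_in_J t : t0 <= t -> J t.
Proof. by move=> t0t; split=> //; rewrite Ty; exact: ltry. Qed.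

Lemma path_lipschitz {W : normedModType R} (y v : R -> W) (L : R) :
  (forall t, J t -> has_deriv J y t (v t)) -> (forall t, J t -> `|v t| <= L) ->
  forall t s, t0 <= t -> t <= s -> `|y s - y t| <= L * (s - t).
Proof.
move=> Hy HL t s t0t ts.
have sJ r : t <= r <= s -> J r.
  by move=> /andP[tr _]; apply: late_in_J; exact: le_trans tr.
have := @mean_value_ineq R W t s L y v 0 ts.
rewrite scaler0 subr0; apply => r tr; last by rewrite subr0; exact/HL/sJ.
apply: has_deriv_sub (Hy r (sJ r tr)) => z /=; rewrite in_itv /=; exact: sJ.
Qed.

Lemma f_path_bounded : exists2 Mf, 0 <= Mf & forall b t, J t -> `|b| <= M ->
  `|f (x t) b t| <= Mf.
Proof.
have [Mf HMf] := fB (M + 1); exists (Num.max 0 Mf); first by rewrite le_max lexx.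
move=> b t Jt bM; rewrite le_max; apply/orP; right.
apply: (HMf (x t, b) t (J0 Jt)); apply: pair_norm_lt.
  by apply: le_lt_trans (xM Jt) _; rewrite ltrDl.
by apply: le_lt_trans bM _; rewrite ltrDl.
Qed.

Lemma phi_path_bounded : exists2 Mp, 0 <= Mp & forall t, J t ->
    `|phi (psit t) om t| <= Mp.
Proof.
have [Mf HMf] := phiB (M + `|om| + 1).
have M0 : 0 <= M by apply: le_trans (psiM (late_in_J (lexx t0))).
exists (Num.max 0 Mf); first by rewrite le_max lexx.
move=> t Jt; rewrite le_max; apply/orP; right.
have om0 := normr_ge0 om; have pM := psiM Jt.
by apply: (HMf (psit t, om) t (J0 Jt)); apply: pair_norm_lt; lra.
Qed.

Hypothesis thM : `|th| <= M.

Lemma F_path_bounded : exists2 MF, 0 <= MF & forall t, J t -> `|F t| <= MF.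
Proof.
have [Mf Mf0 HMf] := f_path_bounded; exists (Mf + Mf); first exact: addr_ge0.
move=> t Jt; apply: le_trans (ler_normB _ _) _; apply: lerD; apply: HMf => //;
    exact: thhM.
Qed.

Lemma psi_path_to_0 (r : R) : 0 < r -> (LpN r%:E J psit < +oo)%E ->
  psit t @[t --> +oo] --> (0 : R).
Proof.
move=> r0 psiL.
have [MF MF0 HF] := F_path_bounded; have [Mp Mp0 Hp] := phi_path_bounded.
have M0 : 0 <= M by apply: le_trans thM.
pose L := MF + Mp + M + 1; have L0 : 0 < L by rewrite /L; lra.
have lip t s : t0 <= t -> t <= s -> `|psit s - psit t| <= L * (s - t).
  apply: (path_lipschitz (v := fun t => F t - phi (psit t) om t + eps t)).
    by move=> r' Jr; have [_ /(_ r' Jr)] := cl.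
  move=> r' Jr; apply: le_trans (ler_normD _ _) _.
  have := ler_normB (F r') (phi (psit r') om r').
  have := HF _ Jr; have := Hp _ Jr; have := epsM Jr; rewrite /L; lra.
have JE : J = roint t0 +oo%E by rewrite /J Ty.
apply: (barbalat (t0 := t0) r0).
- by rewrite -JE; exact: psi_path_continuous.
- by rewrite -JE.
(* With Lipschitz constant [L], a value of size [eta] cannot fall below [eta / 2] within the time
   [eta / 2 / L]. *)
move=> eta eta0; exists (eta / 2 / L); first by rewrite !divr_gt0.
exists (eta / 2); first by rewrite divr_gt0.
move=> t t0t gt s /andP[ts st].
have := lip t s t0t ts.
have : L * (s - t) <= eta / 2 by rewrite mulrC -ler_pdivlMr// lerBlDl.
have := lerB_dist (psit t) (psit s); rewrite distrC; lra.
Qed.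

Hypothesis alphaB : unif_locally_bounded alpha.
Hypothesis dtpsiB : unif_locally_bounded (dt psi).
Hypothesis LgB : unif_locally_bounded (fun y t => (lie (vg P y) psi y t)^-1).
Hypothesis fC : C1 (fun (z : 'cV[R]_((q + p) + d)) t => f (usubmx z) (dsubmx z) t).
Hypothesis dtfB : unif_locally_bounded
  (fun (z : 'cV[R]_(q + p) * 'cV[R]_d) t => dt (fun z' => f z'.1 z'.2) z t).
Hypothesis dxfB : forall j, unif_locally_bounded
  (fun (z : 'cV[R]_(q + p) * 'cV[R]_d) t => dx (fun y => f y z.2) j z.1 t).

Lemma path_unif_bounded {W : normedModType R} (h : 'cV[R]_(q + p) -> R -> W) :
  unif_locally_bounded h -> exists2 Mh, 0 <= Mh & forall t, J t -> `|h (x t) t| <= Mh.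
Proof.
move=> hB; have [Mh HMh] := hB (M + 1).
exists (Num.max 0 Mh); first by rewrite le_max lexx.
move=> t Jt; rewrite le_max; apply/orP; right; apply: HMh; first exact: J0.
by apply: le_lt_trans (xM Jt) _; rewrite ltrDl.
Qed.

Lemma input_bounded : exists2 Mu, 0 <= Mu & forall t, J t -> `|u t| <= Mu.
Proof.
have [Mf Mf0 Hf] := f_path_bounded; have [Mp Mp0 Hp] := phi_path_bounded.
have [Md Md0 Hd] := path_unif_bounded dtpsiB.
have [Mg Mg0 Hg] := path_unif_bounded LgB.
have M0 : 0 <= M by apply: le_trans thM.
exists ((Mf + Mp + M + Md) * Mg); first by rewrite mulr_ge0// !addr_ge0.
move=> t Jt; rewrite (closed_loop_input psiC Lg0 t00 cl Jt) /feedback.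
rewrite normrM ler_pM//; last exact: Hg.
apply: le_trans (ler_normB _ _) _; apply: lerD; last exact: Hd.
apply: le_trans (ler_normD _ _) _; apply: lerD; last exact: epsM.
apply: le_trans (ler_normB _ _) _; rewrite normrN; apply: lerD; last exact: Hp.
by apply: Hf => //; exact: thhM.
Qed.

Lemma velocity_bounded : exists2 Mv, 0 <= Mv &
  forall t, J t -> `|vf P (x t) th + u t *: vg P (x t)| <= Mv.
Proof.
have [Mu Mu0 Hu] := input_bounded.
case: Preg => [[_ f1B] [_ f2B] [_ g1B] [_ g2B]].
have [K1 H1] := f1B (M + 1); have [K3 H3] := g1B (M + 1); have [K4 H4] := g2B (M + 1).
have [K2 H2] := f2B (M + 1).
have M1 z : z <= M -> z < M + 1 by move=> zM; apply: le_lt_trans zM _; rewrite ltrDl.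
pose K := `|K1| + `|K2| + `|K3| + `|K4|.
have K0 : 0 <= K by rewrite !addr_ge0.
have col n m (a : 'cV[R]_n) (b : 'cV[R]_m) : `|a| <= K -> `|b| <= K ->
    `|col_mx a b| <= K.
  move=> aK bK; apply: cV_norm_le => // i; case: (splitP i) => j ij.
    have -> : i = lshift m j by apply/val_inj.
    by rewrite col_mxEu (le_trans (cV_coord_le _ _)).
  have -> : i = rshift n j by apply/val_inj.
  by rewrite col_mxEd (le_trans (cV_coord_le _ _)).
have n1 := normr_ge0 K1; have n2 := normr_ge0 K2; have n3 := normr_ge0 K3;
    have n4 := normr_ge0 K4.
have l1 := ler_norm K1; have l2 := ler_norm K2; have l3 := ler_norm K3;
    have l4 := ler_norm K4.
exists (K + Mu * K); first by rewrite addr_ge0// mulr_ge0.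
move=> t Jt; have xM1 := M1 _ (xM Jt).
apply: le_trans (ler_normD _ _) _; apply: lerD.
  apply: col; first by apply: (le_trans (H1 _ I xM1)); rewrite /K; lra.
  have := H2 (x t, th) I (pair_norm_lt xM1 (M1 _ thM)).
  by move=> /le_trans; apply; rewrite /K; lra.
rewrite normrZ ler_pM//; first exact: Hu.
apply: col; first by apply: (le_trans (H3 _ I xM1)); rewrite /K; lra.
by apply: (le_trans (H4 _ I xM1)); rewrite /K; lra.
Qed.

Lemma f_path_lipschitz : exists2 L, 0 <= L & forall b, `|b| <= M ->
  forall t s, t0 <= t -> t <= s -> `|f (x s) b s - f (x t) b t| <= L * (s - t).
Proof.
have [Mv Mv0 Hv] := velocity_bounded.
have [Mt HMt] := dtfB (M + 1).
have /choice[Md HMd] : forall j, exists Mj, forall (z : 'cV[R]_(q + p) * 'cV[R]_d) t,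
    0 <= t -> `|z| < M + 1 -> `|dx (fun y => f y z.2) j z.1 t| <= Mj.
  by move=> j; exact: dxfB.
pose S := \sum_j `|Md j|; have S0 : 0 <= S by rewrite sumr_ge0.
exists (`|Mt| + Mv * S); first by rewrite addr_ge0// mulr_ge0.
move=> b bM; apply: (path_lipschitz (v := fun t => dt (fun y => f y b) (x t) t
  + lie (vf P (x t) th + u t *: vg P (x t)) (fun y => f y b) (x t) t)) => t Jt.
  apply: (C1_chain (h := fun y => f y b)) => //; last exact: closed_loop_state cl t Jt.
    exact: (C1_slice b fC).
  exact: J0.
have zM : `|(x t, b)| < M + 1.
  by apply: pair_norm_lt; [apply: le_lt_trans (xM Jt) _|apply: le_lt_trans bM _];
      rewrite ltrDl.
apply: le_trans (ler_normD _ _) _; apply: lerD.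
  exact: le_trans (HMt (x t, b) t (J0 Jt) zM) (ler_norm _).
apply: (le_trans (ler_norm_sum _ _ _)); rewrite /S mulr_sumr; apply: ler_sum => j _.
rewrite normrZ ler_pM//; first exact: le_trans (cV_coord_le _ _) (Hv t Jt).
exact: le_trans (HMd j (x t, b) t (J0 Jt) zM) (ler_norm _).
Qed.

Lemma thetahat_path_lipschitz : exists2 L, 0 <= L & forall t s, t0 <= t -> t <= s ->
  `|thh s - thh t| <= L * (s - t).
Proof.
have [MF MF0 HF] := F_path_bounded.
have [Ma Ma0 Ha] := path_unif_bounded alphaB.
have M0 : 0 <= M by apply: le_trans thM.
pose K := \sum_(i < d) \sum_(j < d) `|Gamma i j|.
have K0 : 0 <= K by rewrite sumr_ge0// => i _; rewrite sumr_ge0.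
have B0 : 0 <= (MF + M) * Ma by rewrite mulr_ge0// addr_ge0.
exists (K * ((MF + M) * Ma)); first by rewrite mulr_ge0.
apply: (path_lipschitz (v := fun t => Gamma *m ((F t + eps t) *: alpha (x t) t))).
  by move=> t Jt; exact: (thetahat_deriv alphaC PsiC dx2 t00 cl).
move=> t Jt; apply: (mulmx_norm_le Gamma B0).
rewrite normrZ ler_pM//; last exact: Ha.
by apply: le_trans (ler_normD _ _) _; apply: lerD; [exact: HF|exact: epsM].
Qed.

(* No bound on the derivative of f in its second argument is available. Freezing
   x and t in alpha, a value of |F| away from 0 persists because the
   two-sided bound of |f(x,th,t) - f(x,b,t)| by |alpha^T (b - th)| transfers it to
   alpha(x(t),t)^T (thh(s) - th), which varies slowly with s. *)
Lemma F_path_to_0 : F t @[t --> +oo] --> (0 : R).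
Proof.
have [L1 L10 Hf] := f_path_lipschitz.
have [L2 L20 Hth] := thetahat_path_lipschitz.
have [Ma Ma0 Ha] := path_unif_bounded alphaB.
have JE : J = roint t0 +oo%E by rewrite /J Ty.
apply: (barbalat (t0 := t0) (r := 2)) => //.
- by rewrite -JE; exact: F_within_continuous.
- by rewrite -JE; apply: le_lt_trans LpN_F_le _; exact: ltry.
move=> eta eta0.
(* The lower bound [D1 * (eta / D) = 2 * e'] available at time [t] is lost at a rate of at most [C]:
   the first term is due to the drift of [thh], the second to that of the two values of [f]; the
   [+ 1] makes [C] positive. *)
pose C := D1 * (d%:R * (Ma * L2)) + 2 * L1 + 1.
have C0 : 0 < C by rewrite /C; have := mulr_ge0 (ltW D10) (mulr_ge0 (ler0n R d)
    (mulr_ge0 Ma0 L20)); lra.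
pose e' := D1 * eta / D / 2.
have e'0 : 0 < e' by rewrite !divr_gt0// mulr_gt0.
exists (e' / C); first by rewrite divr_gt0.
exists e' => // t t0t Ft s /andP[ts std].
have Jt := late_in_J t0t; have Js := late_in_J (le_trans t0t ts).
have t_ge0 := J0 Jt.
have st : C * (s - t) <= e' by rewrite mulrC -ler_pdivlMr// lerBlDl.
pose at_s := ((alpha (x t) t)^T *m (thh s - th)) 0 0.
have dal : `|at_s - al t| <= d%:R * (Ma * L2) * (s - t).
  have -> : at_s - al t = ((alpha (x t) t)^T *m (thh s - thh t)) 0 0.
    rewrite (_ : thh s - thh t = (thh s - th) - (thh t - th));
        last by rewrite opprB subrKA.
    rewrite mulmxBr [RHS]mxE; congr (_ + _); by rewrite [RHS]mxE.
  rewrite mxE; apply: (le_trans (ler_norm_sum _ _ _)).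
  apply: (@le_trans _ _ (\sum_(j < d) Ma * (L2 * (s - t)))).
    apply: ler_sum => j _; rewrite mxE normrM ler_pM//.
      exact: le_trans (cV_coord_le _ _) (Ha t Jt).
    exact: le_trans (cV_coord_le _ _) (Hth t s t0t ts).
  by rewrite sumr_const card_ord -[leLHS]mulr_natl !mulrA.
have alt : eta / D <= `|al t|.
  rewrite ler_pdivrMr// mulrC; apply: (le_trans Ft).
  by have [_] := mono (x t) (thh t) t_ge0; rewrite distrC.
have g1 : D1 * `|at_s| <= `|f (x t) (thh s) t - f (x t) th t| by exact: growth.
have h1 := Hf (thh s) (thhM Js) t s t0t ts.
have h2 := Hf th thM t s t0t ts.
have tri : `|f (x t) (thh s) t - f (x t) th t| <= `|F s| + L1 * (s - t) + L1 * (s - t).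
  rewrite (_ : f (x t) (thh s) t - f (x t) th t =
      (f (x s) th s - f (x t) th t) - F s - (f (x s) (thh s) s - f (x t) (thh s) t)).
    apply: le_trans (ler_normB _ _) _;
        have := ler_normB (f (x s) th s - f (x t) th t) (F s).
    by move: h1 h2; lra.
  by rewrite /F; ring.
have al2 : eta / D - d%:R * (Ma * L2) * (s - t) <= `|at_s|.
  by have := lerB_dist (al t) at_s; rewrite distrC; move: dal alt; lra.
have D1al : D1 * (eta / D) - D1 * (d%:R * (Ma * L2) * (s - t)) <= D1 * `|at_s|.
  by rewrite -mulrBr ler_wpM2l// ltW.
have E1 : D1 * (eta / D) = e' + e' by rewrite /e'; field; rewrite gt_eqF.
have E2 : C * (s - t) = D1 * (d%:R * (Ma * L2) * (s - t)) + 2 * (L1 * (s - t)) + (s -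
    t).
  by rewrite /C; ring.
move: D1al tri g1 st; rewrite E1 E2.
have : 0 <= s - t by rewrite subr_ge0.
lra.
Qed.

End asymptotics.

End performance.

Lemma norm_le_enorm (R : realType) n (v : 'cV[R]_n) : `|v| <= enorm v.
Proof.
apply: cV_norm_le; first exact: sqrtr_ge0.
move=> i; rewrite -sqrtr_sqr; apply: ler_wsqrtr.
by rewrite (bigD1 i)//= lerDl sumr_ge0// => j _; exact: sqr_ge0.
Qed.

Unset Implicit Arguments.
Unset Strict Implicit.

Theorem theorem1 (R : realType) (q p d w : nat) (P : plant R q p d)
    (Omth : set 'cV[R]_d) (Omw : set 'cV[R]_w)
    (psi : 'cV[R]_(q + p) -> R -> R) (phi : R -> 'cV[R]_w -> R -> R)
    (alpha Psi : 'cV[R]_(q + p) -> R -> 'cV[R]_d) (Gamma : 'M[R]_d)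
    (eps : R -> R) (t0 D D1 : R)
    (th : 'cV[R]_d) (om : 'cV[R]_w)
    (Tstar : \bar R) (x : R -> 'cV[R]_(q + p)) (thI : R -> 'cV[R]_d)
    (u : R -> R) :
  let f := fpsi P psi in
  let thh := fun t => thetahat psi alpha Psi Gamma (x t) (thI t) t in
  let F := fun t => f (x t) th t - f (x t) (thh t) t in
  let psit := fun t => psi (x t) t in
  let J := roint t0 Tstar in
  let Jinf := cint t0 +oo%E in
  (* standing assumptions *)
  plant_regular P ->
  closed Omth -> bounded_set Omth -> Omth th -> Omw om ->
  C1 psi ->
  (forall y t, 0 <= t -> lie (vg P y) psi y t != 0) ->
  posdef Gamma ->
  0 <= t0 ->
  {within Rplus, continuous eps} -> inLp 2%:E Jinf eps ->
  (* (i) *)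
  C1 alpha -> 0 < D ->
  (forall y t b bh, 0 <= t -> Omth b ->
    0 <= (f y bh t - f y b t) * (((alpha y t)^T *m (bh - b)) 0 0) /\
    `|f y bh t - f y b t| <= D * `|((alpha y t)^T *m (bh - b)) 0 0|) ->
  (* (ii) *)
  0 < D1 ->
  (forall y t b bh, 0 <= t -> Omth b ->
    D1 * `|((alpha y t)^T *m (bh - b)) 0 0| <= `|f y bh t - f y b t|) ->
  (* (iii) *)
  C1 Psi ->
  (forall (j : 'I_p) y t, 0 <= t ->
    dx Psi (rshift q j) y t - psi y t *: dx alpha (rshift q j) y t = 0) ->
  maximal_closed_loop P psi phi alpha Psi Gamma om eps th t0 Tstar x thI u ->
  (* P1 *)
  ((LpN 2%:E J F
      <= (Dfbound D D1 Gamma (th - thh t0) (fine (LpN 2%:E J eps)))%:E)%E /\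
   forall t, J t ->
     wnorm2 (invmx Gamma) (th - thh t) <=
       wnorm2 (invmx Gamma) (thh t0 - th)
       + D / (2 * D1 ^+ 2) * fine (LpN 2%:E J eps) ^+ 2) /\
  (* regularity of the designer's function, used for the continuation of
     bounded solutions *)
  ({within [set z : R * R | 0 <= z.2],
      continuous (fun z => phi z.1 om z.2)} ->
  (* (iv) *)
   forall gamt : 'cV[R]_(q + p) -> 'cV[R]_d -> R -> R,
   (forall y b s, 0 <= s -> 0 <= gamt y b s) ->
   locally_bounded_on [set z : 'cV[R]_(q + p) * 'cV[R]_d * R | 0 <= z.2]
     (fun z => gamt z.1.1 z.1.2 z.2) ->
   (forall b (T : R) y v, Omth b -> t0 < T ->
      plant_solution P b (cint t0 T%:E) y v ->
      (LpN +oo (cint t0 T%:E) (enorm \o y)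
        <= (gamt (y t0) b
              (fine (LpN +oo (cint t0 T%:E) (fun t => psi (y t) t))))%:E)%E) ->
  (* (v) *)
   forall gam : R -> 'cV[R]_w -> R -> R,
   target_gain phi Omw t0 2%:E +oo%E gam ->
  (* P2 *)
   [/\ Tstar = +oo%E,
       inLp +oo%E Jinf psit,
       inLpv +oo%E Jinf x
     & let nu := fine (LpN 2%:E Jinf eps) in
       (LpN +oo Jinf psit
          <= (gam (psi (x t0) t0) om
                (Dfbound D D1 Gamma (th - thh t0) nu + nu))%:E)%E] /\
  (* P3 *)
   (unif_locally_bounded
      (fun (z : 'cV[R]_(q + p) * 'cV[R]_d) t => f z.1 z.2 t) ->
    unif_locally_bounded (fun (z : R * 'cV[R]_w) t => phi z.1 z.2 t) ->
    (exists r : R, 1 < r /\ exists gam', target_gain phi Omw t0 2%:E r%:E gam') ->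
    inLp +oo%E Jinf eps ->
    psit t @[t --> +oo] --> (0 : R) /\
  (* P4 *)
    (C1 (fun (z : 'cV[R]_((q + p) + d)) t => f (usubmx z) (dsubmx z) t) ->
     unif_locally_bounded
       (fun (z : 'cV[R]_(q + p) * 'cV[R]_d) t =>
          dt (fun z' => f z'.1 z'.2) z t) ->
     unif_locally_bounded alpha ->
     unif_locally_bounded (dt psi) ->
     (* boundedness of df/dx and of (L_g psi)^-1 uniformly in time *)
     (forall j, unif_locally_bounded
       (fun (z : 'cV[R]_(q + p) * 'cV[R]_d) t =>
          dx (fun y => f y z.2) j z.1 t)) ->
     unif_locally_bounded (fun y t => (lie (vg P y) psi y t)^-1) ->
     F t @[t --> +oo] --> (0 : R)))).

Proof.
move=> f thh F psit J Jinf Preg Ocl Obd Oth Oom psiC Lg0 Gpos t00 epsc epsL.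
move=> alphaC D0 mono0 D10 growth0 PsiC dx2 mcl.
have [t0T cl _] := mcl.
have mono y t bh (t_ge0 : 0 <= t) := mono0 y t th bh t_ge0 Oth.
have growth y t bh (t_ge0 : 0 <= t) := growth0 y t th bh t_ge0 Oth.
have JinfE : Jinf = roint t0 +oo%E by exact: cint_inftyE.
have mJinf : measurable Jinf by rewrite JinfE; exact: measurable_roint.
have mJ : measurable J by exact: measurable_roint.
have JJ : J `<=` Jinf by move=> t [t0t _]; split=> //; exact: leey.
have [meps Leps] := epsL.
have mepsJ : measurable_fun J eps by exact: measurable_funS meps.
have LepsJ : (LpN 2%:E J eps < +oo)%E by apply: le_lt_trans Leps; exact: le_LpN.
have epscb b : {within `[t0, b], continuous eps}.
  apply: continuous_subspaceW epsc => t; rewrite /= in_itv /= => /andP[+ _].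
  exact: le_trans.
split.
  have nu0 : 0 <= fine (LpN 2%:E J eps) by rewrite fine_ge0// LpN_ge0.
  have sq b : t0 < b -> (b%:E < Tstar)%E ->
      sqint t0 b eps <= fine (LpN 2%:E J eps) ^+ 2.
    by move=> _ bT; apply: sqint_le_LpN => //; exact: cint_roint.
  split; first exact: (LpN_F_le Preg psiC alphaC PsiC dx2 Gpos D0 D10 mono growth epsc
      t00 t0T cl nu0 sq).
  move=> t Jt; rewrite -[X in _ <= X + _]wnorm2N opprB.
  exact: (V_path_le Preg psiC alphaC PsiC dx2 Gpos D0 D10 mono growth epsc t00 cl sq
      Jt).
move=> phic gamt gamt0 gamtB tgt gam gamG.
(* The norm over the half-line also dominates [eps] on [J], so it can be used before [Tstar] is
   known to be infinite. *)
pose nu := fine (LpN 2%:E Jinf eps).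
have nu0 : 0 <= nu by rewrite fine_ge0// LpN_ge0.
have sq b : t0 < b -> (b%:E < Tstar)%E -> sqint t0 b eps <= nu ^+ 2.
  move=> _ bT; apply: sqint_le_LpN => //; apply: subset_trans JJ; exact: cint_roint.
pose K := gam (psit t0) om (Dfbound D D1 Gamma (th - thh t0) nu + nu).
have psiK t : J t -> `|psit t| <= K.
  exact: (psi_path_le Preg psiC alphaC PsiC dx2 Gpos D0 D10 mono growth epsc t00 cl nu0
      sq phic Oom gamG).
have K0 : 0 <= K by apply: le_trans (psiK t0 _) => //; split.
have [Mx Mx0 eM] := state_path_bounded t0T cl gamtB (fun b y v => @tgt th b y v Oth)
    psiK.
have xM t : J t -> `|x t| <= Mx by move=> /eM; apply: le_trans; exact: norm_le_enorm.
have [Mt thhM] := thetahat_path_bounded Preg psiC alphaC PsiC dx2 Gpos D0 D10 mono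
    growth epsc t00 cl sq.
have Ty : Tstar = +oo%E.
  (* With [Tstar] finite, [thI] would be bounded along with [x] and the estimate, and the solution
     could be continued, against maximality. *)
  case ET : Tstar => [T| |]; [|by []|by move: t0T; rewrite ET].
  exfalso; have t0T' : t0 < T by rewrite -lte_fin -ET.
  have Jb t : J t -> t <= T by move=> [_]; rewrite ET lte_fin => /ltW.
  have [MI thIM] := thetaI_path_bounded Preg psiC alphaC PsiC dx2 Gpos D0 D10 mono
      growth epsc t00 cl sq xM Jb.
  have inJ t : t0 <= t < T -> J t by move=> tT; rewrite /J ET rointE /= in_itv.
  apply: (continue_closed_loop Preg psiC Lg0 alphaC PsiC t00 t0T' epsc phic (M :=
      Num.max Mx MI)
    (x := x) (thI := thI) (u := u)) => [t /inJ Jt|t /inJ Jt|].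
  - by rewrite le_max xM.
  - by rewrite le_max thIM ?orbT.
  - by rewrite -ET; exact: mcl.
have JE : J = Jinf by rewrite JinfE /J Ty.
have psic : {within J, continuous psit} := psi_path_continuous cl.
split.
  have psiL : (LpN +oo Jinf psit <= K%:E)%E by apply: LpNy_le => //; rewrite -JE.
  split=> //.
  - split; first by rewrite -JE; exact: subspace_continuous_measurable_fun.
    by apply: le_lt_trans psiL _; exact: ltry.
  - split=> [i|].
      rewrite -JE; apply: subspace_continuous_measurable_fun => //.
      apply/subspace_continuousP => t Jt.
      exact: (cvg_coord (state_cvg cl Jt)).
    apply: (@le_lt_trans _ _ Mx%:E); last exact: ltry.
    apply: LpNy_le => // t; rewrite -JE => Jt /=.
    by rewrite ger0_norm ?sqrtr_ge0//; exact: eM.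
move=> fB phiB [r [r1 [gam' gamG']]] [_ epsI].
pose Me := fine (LpN +oo Jinf eps).
have epsM t : J t -> `|eps t| <= Me.
  (* The segment up to [t + 1] is nondegenerate even for [t = t0], so the essential bound holds at
     [t] itself. *)
  move=> [t0t _]; have tt : t0 < t + 1 by apply: (@le_lt_trans _ _ t) => //;
      rewrite ltrDl ltr01.
  apply: (LpNy_ge tt (epscb _) (J := Jinf)); last by rewrite t0t lerDl ler01.
    by move=> s; rewrite /= in_itv /= => /andP[t0s _]; split=> //; exact: leey.
  by rewrite fineK// ge0_fin_numE// LpN_ge0.
pose M := Num.max (Num.max Mx Mt) (Num.max K (Num.max Me `|th|)).
have xM' t : J t -> `|x t| <= M by move=> /xM H; rewrite !le_max H.
have thhM' t : J t -> `|thh t| <= M by move=> /thhM H; rewrite !le_max H !orbT.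
have psiM' t : J t -> `|psit t| <= M by move=> /psiK H; rewrite !le_max H !orbT.
have epsM' t : J t -> `|eps t| <= M by move=> /epsM H; rewrite !le_max H !orbT.
have thM' : `|th| <= M by rewrite !le_max lexx !orbT.
have r0 : 0 < r by exact: lt_trans r1.
(* Now that [Tstar] is infinite, [F + eps] is square integrable over the whole half-line and the
   second gain applies there. *)
have psiLr : (LpN r%:E J psit < +oo)%E.
  have [_ _ _ _ gain] := gamG'.
  have zc := zeta_continuous Preg psiC alphaC PsiC dx2 epsc t00 cl.
  have zL := zeta_LpN_roint Preg psiC alphaC PsiC dx2 Gpos D0 D10 mono growth epsc t00
      t0T cl nu0 sq.
  have sol := psi_target_solution Preg psiC alphaC PsiC dx2 epsc t00 cl phic (T' :=
      +oo%E) _.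
  rewrite JE; have [] := gain om +oo%E _ psit Oom (ltry _) _ (sol _).
  - by rewrite -/Jinf -JE; split;
      [exact: subspace_continuous_measurable_fun|apply: le_lt_trans zL _; exact: ltry].
  - by rewrite -/Jinf -JE.
  - by case.
split; first exact: (psi_path_to_0 t00 cl Ty xM' thhM' psiM' epsM' fB phiB thM' r0
    psiLr).
move=> fC dtfB alphaB dtpsiB dxfB LgB.
exact: (F_path_to_0 Preg psiC Lg0 alphaC PsiC dx2 Gpos D0 D10 mono growth epsc t00 t0T
    cl nu0 sq
  Ty xM' thhM' psiM' epsM' fB phiB thM' alphaB dtpsiB LgB fC dtfB dxfB).
Qed.
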